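(* For all positive integers $m_1,\dots,m_\beta$ there exists a topology on the set $\mathrm{Karp}(\mathbb{PE}_{m_1}\times\dots\times\mathbb{PE}_{m_\beta}):=\mathrm{Karp}(\mathbb R^{m_1},\dots,\mathbb R^{m_\beta})$ (defined recursively in the context), making it a compact metrizable space, such that for every geodesic $\gamma$ in $\mathbb{PE}_{m_1}\times\dots\times\mathbb{PE}_{m_\beta}$ or in any boundary symmetric space, the limit $\lim_{t\to+\infty}\gamma(t)$ with respect to this topology exists and equals the point $\lim\gamma$ prescribed in the context.
   Context: For a real vector space $V$ with $1\le\dim V<\infty$, let $\mathbb{PE}(V)$ be the set of positive definite quadratic forms on $V$ considered up to multiplication by positive scalars; $\mathbb{PE}_n=\mathbb{PE}(\mathbb R^n)\simeq \mathrm{PGL}(n,\mathbb R)/\mathrm{PO}(n)$ (matrix $X$ corresponding to the form $v\mapsto\frac12v^\top Xv$). Geodesics. A geodesic in $\prod_{\tau=1}^\beta\mathbb{PE}(V_\tau)$ is a nonconstant curve $\gamma(t)=(\gamma_\tau(t))_\tau$ with $\gamma_\tau(t)=\text{class of }\sum_{j=1}^{\dim V_\tau} e^{\varphi^{(\tau)}_j t}(\ell^{(\tau)}_j)^2$, where $(\ell^{(\tau)}_j)_j$ is a basis of $V_\tau^*$ and $\varphi^{(\tau)}_1\ge\varphi^{(\tau)}_2\ge\dots$ are real ($\gamma_\tau$ is constant if these numbers are all equal for the given $\tau$). Velocities. For integers $p_1,\dots,p_\beta\ge1$ let $\Delta_\circ(p_1,\dots,p_\beta)$ be the set of collections of real numbers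 $\psi^{(\tau)}_1>\dots>\psi^{(\tau)}_{p_\tau}$ ($\tau=1,\dots,\beta$) modulo the equivalence $\psi^{(\tau)}_k\sim a\psi^{(\tau)}_k+b_\tau$, with one common $a>0$ and arbitrary $b_1,\dots,b_\beta\in\mathbb R$. The set $\mathrm{Karp}(V_1,\dots,V_\beta)$, defined by recursion on $\sum_\tau(\dim V_\tau-1)$: $$\mathrm{Karp}(V_1,\dots,V_\beta)=\prod_\tau\mathbb{PE}(V_\tau)\ \sqcup\bigsqcup_{(\mathcal W^{(1)},\dots,\mathcal W^{(\beta)})}\Delta_\circ(p_1,\dots,p_\beta)\times\mathrm{Karp}\Bigl(\bigl(W^{(\tau)}_{k-1}/W^{(\tau)}_k\bigr)_{1\le\tau\le\beta,\,1\le k\le p_\tau}\Bigr),$$ the disjoint union being over all tuples of flags $\mathcal W^{(\tau)}:\ V_\tau=W^{(\tau)}_0\supsetneq W^{(\tau)}_1\supsetneq\dots\supsetneq W^{(\tau)}_{p_\tau}=0$, $p_\tau\ge1$, such that $p_\tau\ge2$ for at least one $\tau$. Boundary symmetric spaces of $\mathrm{Karp}(V_1,\dots,V_\beta)$ are the subsets $\{(\mathcal W^{(\tau)})\}\times\{\psi\}\times\prod_{\tau,k}\mathbb{PE}(W^{(\tau)}_{k-1}/W^{(\tau)}_k)$, with $(\mathcal W^{(\tau)})$ a tuple of flags $\mathcal W^{(\tau)}:\ V_\tau=W^{(\tau)}_0\supsetneq W^{(\tau)}_1\supsetneq\dots\supsetneq W^{(\tau)}_{p_\tau}=0$, $p_\tau\ge1$,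 such that $p_\tau\ge2$ for at least one $\tau$, and $\psi\in\Delta_\circ(p_1,\dots,p_\beta)$. Prescribed limits. (1) Let $\gamma=(\gamma_\tau)_\tau$, $\gamma_\tau(t)=\text{class of }\sum_{j=1}^{\dim V_\tau} e^{\varphi^{(\tau)}_j t}(\ell^{(\tau)}_j)^2$, be a geodesic in $\prod_\tau\mathbb{PE}(V_\tau)$, where $(\ell^{(\tau)}_j)_j$ is a basis of $V_\tau^*$ and $\varphi^{(\tau)}_1\ge\varphi^{(\tau)}_2\ge\dots$ are real. For each $\tau$ let $\psi^{(\tau)}_1>\dots>\psi^{(\tau)}_{p_\tau}$ be the distinct values among the $\varphi^{(\tau)}_j$, with multiplicities $\alpha^{(\tau)}_1,\dots,\alpha^{(\tau)}_{p_\tau}$; put $i^{(\tau)}_0=0$, $i^{(\tau)}_k=\alpha^{(\tau)}_1+\dots+\alpha^{(\tau)}_k$, $W^{(\tau)}_k=\{v\in V_\tau:\ell^{(\tau)}_j(v)=0\ \forall j\le i^{(\tau)}_k\}$, and let $Q^{(\tau)}_k\in\mathbb{PE}(W^{(\tau)}_{k-1}/W^{(\tau)}_k)$ be the class of the form induced by $\sum_{i^{(\tau)}_{k-1}<j\le i^{(\tau)}_k}(\ell^{(\tau)}_j)^2$. Then $\lim\gamma$ is the point of the stratum of $(\mathcal W^{(\tau)})$ with coordinates $\bigl((\psi^{(\tau)}_k),(Q^{(\tau)}_k)\bigr)$, where $(Q^{(\tau)}_k)_{\tau,k}\in\prod_{\tau,k}\mathbb{PE}(W^{(\tau)}_{k-1}/W^{(\tau)}_k)\subset\mathrm{Karp}\bigl((W^{(\tau)}_{k-1}/W^{(\tau)}_k)_{\tau,k}\bigr)$.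 (2) For a geodesic $\gamma$ in the boundary symmetric space given by $(\mathcal W^{(\tau)})$ and $\psi$, regarded as a geodesic $\gamma'$ in $\prod_{\tau,k}\mathbb{PE}(W^{(\tau)}_{k-1}/W^{(\tau)}_k)$, $\lim\gamma$ is the point $(\psi;\lim\gamma')$ of the same stratum, with $\lim\gamma'\in\mathrm{Karp}\bigl((W^{(\tau)}_{k-1}/W^{(\tau)}_k)_{\tau,k}\bigr)$ given by (1). *)

(* Defs.v *)
From HB Require Import structures.
From mathcomp Require Import all_boot all_order all_algebra.
From mathcomp Require Import all_classical all_reals all_analysis.
From mathcomp Require Import ring.

Set Implicit Arguments.
Unset Strict Implicit.
Unset Printing Implicit Defensive.
Import Order.TTheory GRing.Theory Num.Theory.
Import numFieldNormedType.Exports.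
Local Open Scope classical_set_scope.
Local Open Scope ring_scope.
Local Open Scope quotient_scope.

Section VectorQuotient.
Import VectorInternalTheory.
Variables (K : fieldType) (V : vectType K) (W : {vspace V}).

Definition vquot : Type := Quotient.quot W.
HB.instance Definition _ := GRing.Zmodule.on vquot.
HB.instance Definition _ := EqQuotient.on vquot.

Lemma vquot_eq (x y : V) : (\pi_vquot x == \pi_vquot y) = (x - y \in W).
Proof. by rewrite [RHS]Quotient.idealrBE. Qed.

Lemma vquot_repr_sub (x : V) : repr (\pi_vquot x) - x \in W.
Proof. by rewrite -vquot_eq reprK. Qed.

Definition vquot_scale (a : K) (x : vquot) : vquot := \pi_vquot (a *: repr x).

Lemma vquot_scale_pi a (x : V) :
  vquot_scale a (\pi_vquot x) = \pi_vquot (a *: x).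
Proof. by apply/eqP; rewrite vquot_eq -scalerBr rpredZ ?vquot_repr_sub. Qed.

Lemma vquot_scaleA a b x :
  vquot_scale a (vquot_scale b x) = vquot_scale (a * b) x.
Proof.
by rewrite -[x]reprK (vquot_scale_pi b) 2!vquot_scale_pi scalerA.
Qed.
Lemma vquot_scale1 : left_id 1 vquot_scale.
Proof. by move=> x; rewrite -[x]reprK vquot_scale_pi scale1r. Qed.
Lemma vquot_scaleDr : right_distributive vquot_scale +%R.
Proof.
by move=> a x y; rewrite -[x]reprK -[y]reprK -raddfD !vquot_scale_pi scalerDr raddfD.
Qed.
Lemma vquot_scaleDl x : {morph vquot_scale^~ x : a b / a + b}.
Proof. by move=> a b; rewrite -[x]reprK !vquot_scale_pi scalerDl raddfD. Qed.

HB.instance Definition _ := GRing.Zmodule_isLmodule.Build K vquot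
  vquot_scaleA vquot_scale1 vquot_scaleDr vquot_scaleDl.

Lemma vquot_pi_scalable : scalable (\pi_vquot : V -> vquot).
Proof. by move=> a x; rewrite -vquot_scale_pi. Qed.
HB.instance Definition _ :=
  GRing.isScalable.Build K V vquot _ (\pi_vquot) vquot_pi_scalable.

Lemma vquot_vect_iso : Vector.axiom (dim (subvs_of W^C)) vquot.
Proof.
pose p (x : V) : subvs_of W^C := vsproj W^C (daddv_pi W^C W x).
have dW : (W^C :&: W = 0)%VS by rewrite capvC capv_compl.
have aW x : x \in (W^C + W)%VS by rewrite addvC addv_complf memvf.
have plin : linear p by move=> a x y; rewrite /p !linearP.
have pW x : x \in W -> p x = 0.
  move=> xW; rewrite /p; have := daddv_pi_add dW (aW x).
  rewrite (daddv_pi_id (capv_compl W) xW) => /(canRL (addrK _)) ->.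
  by rewrite subrr linear0.
have pK x : x - vsval (p x) \in W.
  rewrite /p vsprojK ?memv_pi // -[x in x - _](daddv_pi_add dW (aW x)).
  by rewrite addrC addKr memv_pi.
have prepr x : p (repr (\pi_vquot x)) = p x.
  apply/eqP; rewrite -subr_eq0.
  have -> : p (repr (\pi_vquot x)) - p x = p (repr (\pi_vquot x) - x).
    by rewrite /p !linearB.
  by rewrite pW // vquot_repr_sub.
exists (fun x : vquot => v2r (p (repr x))).
  move=> a x y; rewrite -[x]reprK -[y]reprK -linearP !prepr.
  by rewrite plin linearP.
exists (fun r => \pi_vquot (vsval (r2v r : subvs_of W^C))) => [x|r].
  rewrite v2rK -[RHS]reprK; apply/eqP.
  by rewrite vquot_eq -opprB rpredN pK.
rewrite prepr -[RHS]r2vK; congr (v2r _).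
apply: val_inj; rewrite /p /= vsprojK ?memv_pi //.
by rewrite daddv_pi_id //; exact: subvsP.
Qed.

HB.instance Definition _ := Lmodule_hasFinDim.Build K vquot vquot_vect_iso.

End VectorQuotient.

(** [U / W] for [W <= U]: cosets of the trace of [W] on the space [subvs_of U] *)
Definition subquot (K : fieldType) (V : vectType K) (U W : {vspace V}) :
    vectType K :=
  vquot (linfun (vsval : subvs_of U -> V) @^-1: W)%VS.

Section Subquotient.
Variables (K : fieldType) (V : vectType K) (U W : {vspace V}).

Definition subquot_pi (u : subvs_of U) : subquot U W := \pi_(vquot _) u.

Definition subquot_repr (x : subquot U W) : V := vsval (repr (x : vquot _)).

Lemma subquot_repr_mem x : subquot_repr x \in U.
Proof. exact: subvsP. Qed.

Lemma subquot_repr_pi u : subquot_repr (subquot_pi u) - vsval u \in W.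
Proof.
have := vquot_repr_sub (linfun (vsval : subvs_of U -> V) @^-1: W)%VS u.
by rewrite -memv_preim lfunE.
Qed.

Lemma subquot_repr_eq0 x : subquot_repr x \in W -> x = 0.
Proof.
move=> xW; rewrite -[x](reprK (x : vquot _)) -[RHS](raddf0 (\pi_(vquot _))).
by apply/eqP; rewrite vquot_eq subr0 -memv_preim lfunE.
Qed.

Lemma subquot_repr_linear a x y :
  subquot_repr (a *: x + y) - (a *: subquot_repr x + subquot_repr y) \in W.
Proof.
have rK (z : subquot U W) : subquot_pi (repr (z : vquot _)) = z.
  exact: (reprK (z : vquot _)).
have piL (u v : subvs_of U) :
    subquot_pi (a *: u + v) = a *: subquot_pi u + subquot_pi v.
  exact: linearP.
rewrite -{1}[x]rK -{1}[y]rK -piL.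
by have := subquot_repr_pi (a *: repr (x : vquot _) + repr (y : vquot _)).
Qed.

End Subquotient.

Definition classes (T : Type) (D : set T) (E : T -> T -> Prop) : Type :=
  {C : set T | exists2 x, D x & C = [set y | D y /\ E x y]}.

Definition class_of (T : Type) (D : set T) (E : T -> T -> Prop) (x : T)
    (Dx : D x) : classes D E :=
  exist _ [set y | D y /\ E x y] (ex_intro2 _ _ x Dx erefl).

Section PositiveForms.
Variables (R : realType) (V : vectType R).

Definition posdef_form (q : V -> R) : Prop :=
  exists B : {symmetric V},
    (forall v, q v = B v v) /\ (forall v, v != 0 -> 0 < q v).

Definition proportional (q q' : V -> R) : Prop :=
  exists2 a : R, 0 < a & q' = (fun v => a * q v).

Definition PE : Type := classes posdef_form proportional.

Lemma sumsq_posdef (J : finType) (P : pred J) (c : J -> R) (l : J -> V -> R) :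
  (forall j, P j -> scalar (l j)) -> (forall j, P j -> 0 < c j) ->
  (forall v, (forall j, P j -> l j v = 0) -> v = 0) ->
  posdef_form (fun v => \sum_(j | P j) c j * l j v ^+ 2).
Proof.
move=> llin cpos lker.
pose B (u v : V) : R := \sum_(j | P j) c j * (l j u * l j v).
have Bbil : bilinear_for *%R (idfun \; *%R) B.
  split=> [v|u] a x y; rewrite /B /= mulr_sumr -big_split /=;
    apply: eq_bigr => j Pj; rewrite llin //; ring.
have Bsym u v : B u v = (-1) ^+ false * idfun (B v u).
  by rewrite expr0 mul1r; apply: eq_bigr => j _; rewrite [l j u * _]mulrC.
pose Bm := bilinear_isBilinear.Build R V V R *%R (idfun \; *%R) B Bbil.
pose Bh := isHermitianSesquilinear.Build R V false idfun B Bsym.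
pose Bs : {symmetric V} := HB.pack B Bm Bh.
exists Bs; split=> [v|v v0]; first by apply: eq_bigr => j _; rewrite expr2.
rewrite lt_neqAle sumr_ge0 ?andbT; last first.
  by move=> j Pj; rewrite mulr_ge0 ?sqr_ge0 ?(ltW (cpos _ _)).
apply: contraNneq v0 => /esym/eqP; rewrite psumr_eq0; last first.
  by move=> j Pj; rewrite mulr_ge0 ?sqr_ge0 ?(ltW (cpos _ _)).
move=> /allP q0; apply/eqP/lker => j Pj; apply/eqP.
have := q0 j (mem_index_enum j); rewrite Pj /= mulf_eq0 gt_eqF ?cpos //=.
by rewrite expf_eq0.
Qed.

End PositiveForms.

Section Flags.
Variables (R : realType) (V : vectType R).

(** A flag [V = W_0 > W_1 > ... > W_p = 0] is the sequence [W_1, ..., W_p];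
    [p >= 1] is automatic when [V] is nonzero. *)
Definition is_flag (s : seq {vspace V}) : bool :=
  path (fun U W : {vspace V} => (W <= U)%VS && (W != U)) fullv s
  && (last fullv s == 0%VS).

Record flag := Flag { flag_seq :> seq {vspace V}; flagP : is_flag flag_seq }.

Definition flag_length (W : flag) : nat := size W.
Definition flag_space (W : flag) (k : nat) : {vspace V} :=
  nth 0%VS (fullv :: W) k.
(** 0-based: the index [k : 'I_p] stands for the quotient [W_k / W_(k+1)]. *)
Definition flag_quot (W : flag) (k : 'I_(flag_length W)) : vectType R :=
  subquot (flag_space W k) (flag_space W k.+1).

End Flags.

Section Velocities.
Variables (R : realType) (I : finType) (p : I -> nat).

Definition decreasing_velocity (psi : forall i, 'I_(p i) -> R) : Prop :=
  forall i (k l : 'I_(p i)), (k < l)%N -> psi i l < psi i k.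

Definition velocity_equiv (psi psi' : forall i, 'I_(p i) -> R) : Prop :=
  exists a : R, exists b : I -> R,
    0 < a /\ forall i k, psi' i k = a * psi i k + b i.

Definition Delta : Type := classes decreasing_velocity velocity_equiv.

End Velocities.

Section Families.
Variables (R : realType) (I : finType) (V : I -> vectType R).

Definition nontrivial_flags (W : forall i, flag (V i)) : bool :=
  [exists i, (2 <= flag_length (W i))%N].

Definition quot_index (W : forall i, flag (V i)) : finType :=
  {i : I & 'I_(flag_length (W i))}.

Definition quot_family (W : forall i, flag (V i)) (x : quot_index W) :
  vectType R := flag_quot (tagged x).

End Families.
Arguments quot_family {R I V} W x.

(** The recursion on [\sum_i (dim V_i - 1)] is that of the inductive type: this
    sum drops strictly in [Stratum]. The index set of the family changes from
    [I] to the pairs [(i, k)]. *)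
Inductive Karp (R : realType) (I : finType) (V : I -> vectType R) : Type :=
| Interior of (forall i, PE (V i))
| Stratum (W : forall i, flag (V i)) of nontrivial_flags W
    & Delta R (fun i => flag_length (W i)) & Karp (quot_family W).

(** [t |-> class of \sum_j e^(phi_j t) l_j^2], one component of a geodesic (it
    may be constant) *)
Section ExpLine.
Variables (R : realType) (V : vectType R).

Record exp_line := ExpLine {
  el_form : (\dim {:V}).-tuple 'Hom(V, R^o);
  el_exp : (\dim {:V}).-tuple R;
  el_basis : basis_of fullv el_form;
  el_sorted : sorted >=%R el_exp
}.

Variable g : exp_line.
Local Notation n := (\dim {:V}).

Definition el_coord (j : 'I_n) (v : V) : R := tnth (el_form g) j v.

Lemma el_coord_scalar j : scalar (el_coord j).
Proof. by move=> a x y; rewrite /el_coord linearP. Qed.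

Lemma el_coord_sep v : (forall j, el_coord j v = 0) -> v = 0.
Proof.
move=> v0; apply/eqP/contraT => vN0.
have f0 (f : 'Hom(V, R^o)) : f v = 0.
  have : f \in <<el_form g>>%VS by rewrite (span_basis (el_basis g)) memvf.
  move=> /coord_span ->; rewrite sum_lfunE big1 // => j _.
  have := v0 j; rewrite scale_lfunE -tnth_nth /el_coord => ->.
  by rewrite scaler0.
have vb : v = 0; last by rewrite vb eqxx in vN0.
rewrite (coord_vbasis (memvf v)) big1 // => i _.
have := f0 (linfun (coord (vbasis fullv) i : V -> R^o)).
by rewrite lfunE /= => ->; rewrite scale0r.
Qed.

Lemma el_coord_surj (r : 'I_n -> R) : exists v, forall j, el_coord j v = r j.
Proof.
have hlin : linear (fun v : V => \row_(j < n) el_coord j v).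
  by move=> a x y; apply/rowP => j; rewrite !mxE el_coord_scalar.
pose hL := GRing.isLinear.Build R V 'rV[R]_n _ _ hlin.
pose h : {linear V -> 'rV[R]_n} := HB.pack (fun v : V => \row_(j < n) el_coord j v) hL.
have hE v : linfun h v = \row_(j < n) el_coord j v by rewrite lfunE.
have ker0 : lker (linfun h) == 0%VS.
  rewrite -subv0; apply/subvP => v; rewrite memv_ker hE => /eqP/rowP v0.
  rewrite memv0; apply/eqP/el_coord_sep => j.
  by have := v0 j; rewrite !mxE.
have full : limg (linfun h) = fullv.
  apply/eqP; rewrite eqEdim subvf /= limg_dim_eq; last first.
    by rewrite (eqP ker0) capv0.
  by rewrite [X in (X <= _)%N]dimvf /= dim_matrix mul1r.
have : \row_j r j \in limg (linfun h) by rewrite full memvf.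
move=> /memv_imgP[v _ rv]; exists v => j.
by move: rv; rewrite hE => /rowP/(_ j); rewrite !mxE.
Qed.

Definition el_curve_form (t : R) (v : V) : R :=
  \sum_(j < n) expR (tnth (el_exp g) j * t) * el_coord j v ^+ 2.

Lemma el_curve_posdef t : posdef_form (el_curve_form t).
Proof.
apply: sumsq_posdef => [j _|j _|v v0]; first exact: el_coord_scalar.
  exact: expR_gt0.
by apply: el_coord_sep => j; exact: v0.
Qed.

Definition el_curve (t : R) : PE V := class_of _ (el_curve_posdef t).

(** The distinct exponents, in decreasing order since [el_exp] is sorted;
    [el_cut k] is the sum [i_k] of the first [k] multiplicities, and
    [el_space k] is [W_k]. *)
Definition el_values : seq R := undup (el_exp g).

Definition el_velocity (k : nat) : R := nth 0 el_values k.

Definition el_cut (k : nat) : nat :=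
  (\sum_(l < k) count_mem (el_velocity l) (el_exp g))%N.

Definition el_space (k : nat) : {vspace V} :=
  (\bigcap_(j < n | (j < el_cut k)%N) lker (tnth (el_form g) j))%VS.


Lemma mem_el_space k v :
  reflect (forall j : 'I_n, (j < el_cut k)%N -> el_coord j v = 0)
          (v \in el_space k).
Proof.
apply: (iffP subv_bigcapP) => [h j jk|h j jk].
  by have := h j jk; rewrite -memvE memv_ker => /eqP.
by rewrite -memvE memv_ker; apply/eqP/h.
Qed.

Lemma el_cut_mono k l : (k <= l)%N -> (el_cut k <= el_cut l)%N.
Proof.
move=> kl; rewrite /el_cut -!(big_mkord xpredT (fun l => count_mem (el_velocity l) _)).
by rewrite (big_cat_nat (leq0n k) kl) leq_addr.
Qed.

Lemma el_cut_last : el_cut (size el_values) = n.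
Proof.
rewrite -[RHS](size_tuple (el_exp g)) /el_cut.
rewrite -(big_mkord xpredT (fun l => count_mem (el_velocity l) (el_exp g))).
rewrite /el_velocity -(big_nth 0 xpredT (fun x => count_mem x (el_exp g))).
rewrite /el_values -sum1_size -[RHS]big_undup_iterop_count /=.
by apply: eq_bigr => x _; rewrite Monoid.iteropE iter_addn_0 mul1n.
Qed.

Lemma el_cut_lt k : (k < size el_values)%N -> (el_cut k < el_cut k.+1)%N.
Proof.
move=> kp; rewrite /el_cut big_ord_recr /= -[X in (X < _)%N]addn0 ltn_add2l.
by rewrite -has_count has_pred1 -mem_undup mem_nth.
Qed.

Lemma el_space0 : el_space 0 = fullv.
Proof. by rewrite /el_space big1 // => j; rewrite /el_cut big_ord0. Qed.

Lemma el_space_last : el_space (size el_values) = 0%VS.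
Proof.
apply/eqP; rewrite -subv0; apply/subvP => v /mem_el_space v0.
by rewrite memv0; apply/eqP/el_coord_sep => j; apply: v0; rewrite el_cut_last.
Qed.

Definition el_flag_seq : seq {vspace V} :=
  mkseq (fun k => el_space k.+1) (size el_values).

Lemma nth_el_flag k : (k <= size el_values)%N ->
  nth 0%VS (fullv :: el_flag_seq) k = el_space k.
Proof. by case: k => [|k] kp /=; rewrite ?el_space0 // nth_mkseq. Qed.

Lemma el_is_flag : is_flag el_flag_seq.
Proof.
apply/andP; split.
  apply/(pathP 0%VS) => k; rewrite size_mkseq => kp.
  rewrite nth_el_flag ?(ltnW kp) // nth_mkseq //; apply/andP; split.
    apply/subvP => v /mem_el_space vk; apply/mem_el_space => j jk.
    by apply: vk; apply: leq_trans jk (el_cut_mono _).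
  have cn : (el_cut k < n)%N.
    by rewrite -el_cut_last; apply: leq_trans (el_cut_lt kp) (el_cut_mono _).
  have [v vE] := el_coord_surj (fun j => (j == Ordinal cn)%:R).
  apply/eqP => eqW; have : v \in el_space k.
    by apply/mem_el_space => j jk; rewrite vE -val_eqE /= ltn_eqF.
  rewrite -eqW => /mem_el_space/(_ (Ordinal cn) (el_cut_lt kp)).
  by rewrite vE eqxx => /eqP; rewrite oner_eq0.
by rewrite (last_nth 0%VS) size_mkseq nth_el_flag ?el_space_last.
Qed.

Definition el_flag : flag V := Flag el_is_flag.

Lemma el_flag_length : flag_length el_flag = size el_values.
Proof. exact: size_mkseq. Qed.

Lemma el_flag_space k : (k <= flag_length el_flag)%N ->
  flag_space el_flag k = el_space k.
Proof. by rewrite el_flag_length => /nth_el_flag. Qed.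

(** The form on [W_k / W_(k+1)] induced by [\sum_(i_k <= j < i_(k+1)) l_j^2];
    see [el_quot_form_pi] for the independence of the representative. *)
Definition el_quot_form (k : 'I_(flag_length el_flag)) (x : flag_quot k) : R :=
  \sum_(j < n | (el_cut k <= j < el_cut k.+1)%N)
    el_coord j (subquot_repr x) ^+ 2.

Lemma el_quot_form_pi (k : 'I_(flag_length el_flag))
    (u : subvs_of (flag_space el_flag k)) :
  el_quot_form (subquot_pi _ u : flag_quot k) =
  \sum_(j < n | (el_cut k <= j < el_cut k.+1)%N) el_coord j (vsval u) ^+ 2.
Proof.
apply: eq_bigr => j /andP[_ jk]; congr (_ ^+ 2).
have Wk1 v : (v \in flag_space el_flag k.+1) = (v \in el_space k.+1).
  by rewrite el_flag_space.
have := subquot_repr_pi (flag_space el_flag k.+1) u.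
rewrite Wk1 => /mem_el_space/(_ j jk).
by rewrite /el_coord linearB => /eqP; rewrite subr_eq0 => /eqP.
Qed.

Lemma el_quot_posdef (k : 'I_(flag_length el_flag)) :
  posdef_form (@el_quot_form k).
Proof.
have Wk v : (v \in flag_space el_flag k) = (v \in el_space k).
  by rewrite el_flag_space // ltnW.
have Wk1 v : (v \in flag_space el_flag k.+1) = (v \in el_space k.+1).
  by rewrite el_flag_space.
rewrite (_ : @el_quot_form k = fun x => \sum_(j < n | (el_cut k <= j < el_cut k.+1)%N)
    1 * (el_coord j (subquot_repr x)) ^+ 2); last first.
  by apply/funext => x; apply: eq_bigr => j _; rewrite mul1r.
apply: sumsq_posdef => [j /andP[_ jk] a x y||x x0] //.
  have := subquot_repr_linear a x y; rewrite Wk1 => /mem_el_space/(_ j jk)/eqP.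
  set u := subquot_repr _; set v := subquot_repr x; set w := subquot_repr y.
  have -> : u - (a *: v + w) = -1 *: (a *: v + w) + u by rewrite scaleN1r addrC.
  rewrite !el_coord_scalar mulN1r addrC subr_eq0 => /eqP; exact.
apply: subquot_repr_eq0; rewrite Wk1; apply/mem_el_space => j jk.
have [jk'|jk'] := ltnP j (el_cut k); last by apply: x0; rewrite jk' jk.
have := subquot_repr_mem x; rewrite Wk => /mem_el_space; exact.
Qed.

Definition el_quot_class (k : 'I_(flag_length el_flag)) : PE (flag_quot k) :=
  class_of _ (el_quot_posdef k).

Lemma el_velocity_decr k l :
  (k < l < size el_values)%N -> el_velocity l < el_velocity k.
Proof.
move=> /andP[kl lp]; have kp := ltn_trans kl lp.
have srt : sorted >=%R el_values.
  apply: subseq_sorted (undup_subseq _) (el_sorted g).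
  by move=> x y z /= xy yz; apply: le_trans yz xy.
rewrite lt_neqAle nth_uniq ?undup_uniq // gtn_eqF //=.
apply: (sorted_leq_nth _ _ 0 srt) => //; last exact: ltnW.
  by move=> x y z /= xy yz; apply: le_trans yz xy.
exact: lexx.
Qed.

Lemma el_curve_const s t : (size el_values <= 1)%N -> el_curve s = el_curve t.
Proof.
move=> sz; have [c cE] : exists c, forall j, tnth (el_exp g) j = c.
  exists (el_velocity 0) => j.
  have : tnth (el_exp g) j \in el_values by rewrite mem_undup mem_tnth.
  rewrite /el_velocity; move: sz; case: el_values => [|x [|]] //= _.
  by rewrite inE => /eqP.
have curveE r : el_curve_form r = fun v => expR (c * r) * el_curve_form 0 v.
  apply/funext => v; rewrite /el_curve_form mulr_sumr.
  by apply: eq_bigr => j _; rewrite cE mulr0 expR0 mul1r.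
apply: eq_exist => /=; apply/seteqP; split => q [dq [a a0 qE]]; split=> //.
  exists (a * expR (c * s) / expR (c * t)).
    by rewrite !mulr_gt0 ?invr_gt0 ?expR_gt0.
  rewrite qE; apply/funext => v; rewrite (curveE s) (curveE t).
  by rewrite [RHS]mulrA divfK ?mulrA // gt_eqF ?expR_gt0.
exists (a * expR (c * t) / expR (c * s)).
  by rewrite !mulr_gt0 ?invr_gt0 ?expR_gt0.
rewrite qE; apply/funext => v; rewrite (curveE s) (curveE t).
by rewrite [RHS]mulrA divfK ?mulrA // gt_eqF ?expR_gt0.
Qed.

End ExpLine.

Section Geodesics.
Variables (R : realType) (I : finType) (V : I -> vectType R).

Record geodesic := Geodesic {
  geo_line : forall i, exp_line (V i);
  geo_nonconst : exists s t : R,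
    (fun i => el_curve (geo_line i) s) <> (fun i => el_curve (geo_line i) t)
}.

Variable g : geodesic.

Definition geo_curve (t : R) : forall i, PE (V i) :=
  fun i => el_curve (geo_line g i) t.

Definition geo_flags : forall i, flag (V i) := fun i => el_flag (geo_line g i).

Lemma geo_flags_nontrivial : nontrivial_flags geo_flags.
Proof.
have [s [t]] := geo_nonconst g; apply: contra_notT => /existsPn h.
apply: functional_extensionality_dep => i; apply: el_curve_const.
by have := h i; rewrite -ltnNge ltnS /geo_flags el_flag_length.
Qed.

Lemma geo_velocity_decr :
  decreasing_velocity (fun i (k : 'I_(flag_length (geo_flags i))) =>
    el_velocity (geo_line g i) k).
Proof.
move=> i k l kl; apply: el_velocity_decr.
by rewrite kl -el_flag_length ltn_ord.
Qed.

Definition geo_limit : Karp V :=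
  Stratum geo_flags_nontrivial (class_of _ geo_velocity_decr)
    (Interior (V := quot_family geo_flags)
       (fun x => el_quot_class (tagged x))).

End Geodesics.

Definition metrizable (R : realType) (T : topologicalType) : Prop :=
  exists d : T -> T -> R,
    [/\ forall x y, d x y = 0 <-> x = y,
        forall x y, d x y = d y x,
        forall x y z, d x z <= d x y + d y z
      & forall x, nbhs x =
          filter_from [set e : R | 0 < e] (fun e => [set y | d x y < e])].

(* Main.v *)
(** In a flat, a point is a collection of real numbers [a_j], one for each
    vector of an orthonormal frame, up to a shift in each block, and the point of
    the compactification to which a family of points tends is read off from the
    rates of growth of the differences [a_j - a_l]: the fastest rate gives the
    flags and the velocities, and one recurses inside the blocks of the flags. Together
    with the decomposition [K A K] of the symmetric space (spectral theorem), every
    point of [Karp] is thus a limit of an orthonormal frame and a family of points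
    of the flat. The limits of the bounded functions [ratio (a_j - a_l) (a_j' - a_l')],
    placed on the matrix [P_j (x) P_l (x) P_j' (x) P_l'] of projections, do not depend on
    the chosen frame and separate the points. They embed [Karp] in a space of
    matrices, whose metric is pulled back. Compactness follows because along
    an ultrafilter the frames converge and the numbers [a_j] have a limit in [Karp].

    For a geodesic with exponents [phi_j] and linear forms [l_j], let [A] be the
    matrix of the [l_j] in the diagonalizing orthonormal frame at time [t], [B] its
    inverse and [e^(b_m)] the eigenvalues. Then
    [e^(phi_j t) A_jm = e^(b_m) B_mj] with [A] and [B] bounded, which forces [b_m]
    to stay at bounded distance from some [phi_j t] and the limits of [A] and
    [B] to be triangular for the flags. *)
Require Import Defs.
From HB Require Import structures.
From mathcomp Require Import all_boot all_order all_algebra.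
From mathcomp Require Import all_classical all_reals all_analysis.
From mathcomp Require Import ring lra.
Set Implicit Arguments.
Unset Strict Implicit.
Unset Printing Implicit Defensive.
Import Order.TTheory GRing.Theory Num.Theory.
Import numFieldNormedType.Exports.
Local Open Scope classical_set_scope.
Local Open Scope ring_scope.

(** The recursion replaces the factors [V i] by quotients and so changes their index set at every
    stratum. The finite set [J] of coordinate indices stays the same: a stratum only refines the
    labelling [c : J -> I], and one orthogonal matrix on [J] serves all levels. All comparisons thus
    take place between matrices of one fixed size.

    Two frames representing the same point differ by an orthogonal matrix. Conjugates of two
    diagonal matrices by these frames coincide exactly when the diagonal entries agree wherever the
    transition matrix is nonzero; this reduces well-definedness and injectivity of the embedding to
    statements about single indices. Pairs of differences, and hence fourth tensor powers, appear
    because velocities are defined only up to a common factor and a shift in each block.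

    Points of strata are not given by the flat. Members of an ultrafilter on [Karp] and points of
    boundary geodesics are therefore replaced by points of the flat at a distance tending to
    zero. *)

(** * Limits of real functions along ultrafilters *)

Section Ultrafilters.
Variable R : realType.

Lemma ultra_fmap (S T : Type) (f : S -> T) (F : set_system S) :
  UltraFilter F -> UltraFilter (f @ F).
Proof.
move=> UF; split; first exact: fmap_proper_filter.
move=> G PG sG; apply/seteqP; split; last exact: sG.
move=> A GA; have [//|FA] := in_ultra_setVsetC (f @^-1` A) UF.
have /filter_ex[x []//] : G (A `&` ~` A) by apply: filterI => //; exact: sG.
Qed.

Lemma ultra_bounded_cvg (T : Type) (F : set_system T) (f : T -> R) (M : R) :
  UltraFilter F -> (\forall t \near F, `|f t| <= M) ->
  exists l : R, f @ F --> l.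
Proof.
move=> UF fM; have := @segment_compact R (- M) M.
rewrite compact_ultra => /(_ _ (ultra_fmap f UF))[|l [_ fl]].
  by apply: filterS fM => t; rewrite /= in_itv /= ler_norml.
by exists l.
Qed.

(** An ultrafilter decides each set [M < s t]. This dichotomy later decides between [Interior] and
    [Stratum]. *)
Lemma bounded_or_cvgy (T : Type) (F : set_system T) (s : T -> R) :
  UltraFilter F ->
  (exists M, \forall t \near F, s t <= M) \/ s @ F --> +oo.
Proof.
move=> UF; have [sb|sN] := pselect (exists M, \forall t \near F, s t <= M).
  by left.
right; apply/cvgryPgt => M.
have [//|sM] := in_ultra_setVsetC [set t | M < s t] UF.
case: sN; exists M; apply: filterS sM => t /=; by rewrite leNgt => /negP.
Qed.

Lemma cvg_fsum (T : Type) (F : set_system T) (J : finType) (P : pred J)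
    (f : J -> T -> R) (l : J -> R) : Filter F ->
  (forall j, P j -> f j t @[t --> F] --> l j) ->
  \sum_(j | P j) f j t @[t --> F] --> \sum_(j | P j) l j.
Proof. by move=> FF fl; apply: (cvg_big (@add_continuous R^o)). Qed.

Lemma ler_limit (T : Type) (F : set_system T) (f g : T -> R) (k l : R)
    {FF : ProperFilter F} : f @ F --> k -> g @ F --> l ->
  (\forall t \near F, f t <= g t) -> k <= l.
Proof.
move=> fk gl fg; rewrite -subr_ge0.
have : (g t - f t) @[t --> F] --> l - k by exact: cvgB.
apply: (closed_cvg (fun x : R => 0 <= x)); first exact: closed_ge.
by apply: filterS fg => t; rewrite subr_ge0.
Qed.

Lemma eq_limit (T : Type) (F : set_system T) (f : T -> R) (k l : R)
    {FF : ProperFilter F} : f @ F --> k -> f @ F --> l -> k = l.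
Proof. by apply: cvg_unique; exact: Rhausdorff. Qed.

End Ultrafilters.

(** * The spectral theorem *)

Section Orthogonal.
Variables (R : realType) (J : finType).
Implicit Types (A B C T S : J -> J -> R).

(** Matrices are plain functions over an arbitrary finite type, so that labellings of the index set
    and Kronecker products on [J * K] need no enumeration. *)
Definition mulk A B : J -> J -> R := fun j m => \sum_l A j l * B l m.
Definition idk : J -> J -> R := fun j m => (j == m)%:R.
Definition trk A : J -> J -> R := fun j m => A m j.
Definition orth T := mulk T (trk T) = idk /\ mulk (trk T) T = idk.
Definition blockwise (I : eqType) (c : J -> I) T :=
  forall j m, c j != c m -> T j m = 0.

Lemma mulkA A B C : mulk A (mulk B C) = mulk (mulk A B) C.
Proof.
apply/funext => j; apply/funext => m; rewrite /mulk.
under eq_bigr do rewrite mulr_sumr.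
rewrite exchange_big; apply: eq_bigr => l _; rewrite mulr_suml.
by apply: eq_bigr => k _; rewrite mulrA.
Qed.

Lemma sum_delta (F : J -> R) (j : J) : \sum_l (j == l)%:R * F l = F j.
Proof.
rewrite (bigD1 j) //= eqxx mul1r big1 ?addr0 // => l /negPf.
by rewrite eq_sym => ->; rewrite mul0r.
Qed.

Lemma mul1k A : mulk idk A = A.
Proof. by apply/funext => j; apply/funext => m; exact: sum_delta. Qed.

Lemma trkM A B : trk (mulk A B) = mulk (trk B) (trk A).
Proof.
apply/funext => j; apply/funext => m.
by apply: eq_bigr => l _; rewrite mulrC.
Qed.

Lemma tr1k : trk idk = idk.
Proof. by apply/funext => j; apply/funext => m; rewrite /trk /idk eq_sym. Qed.

Lemma mulk1 A : mulk A idk = A.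
Proof. by rewrite -[LHS]/(trk (trk _)) trkM tr1k mul1k. Qed.

Lemma orth1 : orth idk.
Proof. by split; rewrite tr1k mul1k. Qed.

Lemma orth_tr T : orth T -> orth (trk T).
Proof. by case. Qed.

Lemma orthM A B : orth A -> orth B -> orth (mulk A B).
Proof.
move=> [A1 A2] [B1 B2]; split; rewrite trkM.
  by rewrite -mulkA [mulk B _]mulkA B1 mul1k.
by rewrite -mulkA [mulk _ (mulk A B)]mulkA A2 mul1k.
Qed.

Lemma orth_row T j l : orth T -> \sum_m T j m * T l m = (j == l)%:R.
Proof. by move=> [T1 _]; exact: (congr1 (fun f => f j l) T1). Qed.

Lemma orth_le1 T j m : orth T -> `|T j m| <= 1.
Proof.
move=> oT; rewrite -(@expr_le1 _ 2) // real_normK ?num_real //.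
have <- : \sum_m T j m * T j m = 1 by rewrite orth_row ?eqxx.
rewrite (bigD1 m) //= -expr2.
by rewrite lerDl sumr_ge0 // => l _; rewrite -expr2 sqr_ge0.
Qed.

Lemma orth_row_neq0 T j : orth T -> exists m, T j m != 0.
Proof.
move=> oT; apply: contrapT => T0; have := orth_row j j oT.
rewrite eqxx big1 => [/esym/eqP|m _]; first by rewrite oner_eq0.
have [->|/eqP Tjm] := eqVneq (T j m) 0; first by rewrite mul0r.
by case: T0; exists m; apply/eqP.
Qed.

Lemma orth_col_neq0 T m : orth T -> exists j, T j m != 0.
Proof. by move=> /orth_tr/(@orth_row_neq0 _ m). Qed.

Section Block.
Variables (I : eqType) (c : J -> I).

Lemma blockwise_eq T j m : blockwise c T -> T j m != 0 -> c j = c m.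
Proof. by move=> bT; apply: contra_neq_eq => /bT. Qed.

Lemma blockwise1 : blockwise c idk.
Proof. by move=> j m; rewrite /idk; have [->|//] := eqVneq j m; rewrite eqxx. Qed.

Lemma blockwise_tr T : blockwise c T -> blockwise c (trk T).
Proof. by move=> bT j m jm; apply: bT; rewrite eq_sym. Qed.

Lemma blockwiseM A B : blockwise c A -> blockwise c B -> blockwise c (mulk A B).
Proof.
move=> bA bB j m jm; rewrite /mulk big1 // => l _.
have [jl|jl] := eqVneq (c j) (c l); last by rewrite bA // mul0r.
by rewrite bB ?mulr0 // -jl.
Qed.

End Block.

Lemma cvg_mulk (U : Type) (F : set_system U) (A B : U -> J -> J -> R)
    (A0 B0 : J -> J -> R) {FF : Filter F} :
  (forall j m, A t j m @[t --> F] --> A0 j m) ->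
  (forall j m, B t j m @[t --> F] --> B0 j m) ->
  forall j m, mulk (A t) (B t) j m @[t --> F] --> mulk A0 B0 j m.
Proof.
move=> hA hB j m; rewrite /mulk.
by apply: cvg_fsum => l _; exact: cvgM.
Qed.

Lemma orth_limit (U : Type) (F : set_system U) (T : U -> J -> J -> R)
    (T0 : J -> J -> R) : ProperFilter F ->
  (forall t, orth (T t)) ->
  (forall j m, T t j m @[t --> F] --> T0 j m) -> orth T0.
Proof.
move=> FF oT hT; split; apply/funext => j; apply/funext => m.
  have := cvg_mulk (j := j) (m := m) (B := fun t => trk (T t)) (B0 := trk T0) hT
    (fun j m => hT m j).
  under eq_fun do rewrite (oT _).1.
  by move=> h; exact: eq_limit (h _) (cvg_cst _).
have := cvg_mulk (j := j) (m := m) (A := fun t => trk (T t)) (A0 := trk T0)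
  (fun j m => hT m j) hT.
under eq_fun do rewrite (oT _).2.
by move=> h; exact: eq_limit (h _) (cvg_cst _).
Qed.

Lemma blockwise_limit (I : eqType) (c : J -> I) (U : Type) (F : set_system U)
    (T : U -> J -> J -> R) (T0 : J -> J -> R) : ProperFilter F ->
  (forall t, blockwise c (T t)) ->
  (forall j m, T t j m @[t --> F] --> T0 j m) -> blockwise c T0.
Proof.
move=> FF bT hT j m jm; have := hT j m.
under eq_fun do rewrite bT //.
by move=> h; exact: eq_limit h (cvg_cst _).
Qed.

(** Compactness of the orthogonal group: all entries are bounded by 1. *)
Lemma orth_ultra_cvg (U : Type) (F : set_system U) (T : U -> J -> J -> R) :
  UltraFilter F -> (forall t, orth (T t)) ->
  exists T0, forall j m, T t j m @[t --> F] --> T0 j m.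
Proof.
move=> UF oT.
have cv (jm : J * J) : exists l : R, T t jm.1 jm.2 @[t --> F] --> l.
  apply: (ultra_bounded_cvg (M := 1)); apply: nearW => t; exact: orth_le1.
have [L LP] := choice cv.
by exists (fun j m => L (j, m)) => j m; exact: (LP (j, m)).
Qed.

End Orthogonal.
Arguments idk {R J}.

Section Spectral.
Variables (R : realType) (J : finType) (I : eqType) (c : J -> I).
Variable S : J -> J -> R.
Hypotheses (Ssym : forall m n, S m n = S n m) (Sblock : blockwise c S).
Implicit Types T : J -> J -> R.

(** Pairwise distinct weights: the gain of [height] under a reflection mixing [p] and [q] carries
    the factor [w p - w q]. *)
Let w (j : J) : R := (enum_rank j : nat)%:R.
Let conj T : J -> J -> R := mulk T (mulk S (trk T)).
Let height T : R := \sum_j w j * conj T j j.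
Let OB T := orth T /\ blockwise c T.

Let w_inj : injective w.
Proof. by move=> p q /eqP; rewrite eqr_nat => /eqP/val_inj/enum_rank_inj. Qed.

Let conj_sym T j m : conj T j m = conj T m j.
Proof.
have trS : trk S = S by apply/funext => a; apply/funext => b; rewrite /trk Ssym.
rewrite /conj -[LHS]/(trk (mulk T (mulk S (trk T))) m j) !trkM trS.
by rewrite mulkA.
Qed.

Let conj_block T : OB T -> blockwise c (conj T).
Proof.
by move=> [_ bT]; do 2![apply: blockwiseM => //]; exact: blockwise_tr.
Qed.

(* The reflection in the hyperplane orthogonal to [e_p + tau e_q]: for small [tau]
   it increases [height] unless [conj T p q = 0], so that a maximum of [height]
   diagonalizes [S]. *)
Let vec p q (tau : R) (j : J) : R := (p == j)%:R + tau * (q == j)%:R.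
Let refl p q (tau : R) (j m : J) : R :=
  idk j m - (2 / (1 + tau ^+ 2)) * vec p q tau j * vec p q tau m.

Let sum_vec p q tau (F : J -> R) : \sum_j vec p q tau j * F j = F p + tau * F q.
Proof.
under eq_bigr do rewrite mulrDl -mulrA.
by rewrite big_split /= -mulr_sumr !sum_delta.
Qed.

Let sqr1_neq0 (tau : R) : 1 + tau ^+ 2 != 0.
Proof. by rewrite gt_eqF // ltr_pwDl ?sqr_ge0. Qed.

Let refl_tr p q tau : trk (refl p q tau) = refl p q tau.
Proof.
by apply/funext => j; apply/funext => m; rewrite /trk /refl /idk eq_sym; ring.
Qed.

Let refl_mul p q tau T j m :
  mulk (refl p q tau) T j m =
  T j m - 2 / (1 + tau ^+ 2) * vec p q tau j * (T p m + tau * T q m).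
Proof.
rewrite /mulk; under eq_bigr => l _.
  rewrite (_ : _ * _ = (j == l)%:R * T l m -
    2 / (1 + tau ^+ 2) * vec p q tau j * (vec p q tau l * T l m)); last first.
    by rewrite /refl /idk; ring.
  over.
rewrite sumrB -mulr_sumr (sum_vec _ _ _ (fun l => T l m)).
by rewrite (sum_delta (fun l => T l m)).
Qed.

Let refl_orth p q tau : p != q -> orth (refl p q tau).
Proof.
move=> pq; have rr : mulk (refl p q tau) (refl p q tau) = idk.
  apply/funext => j; apply/funext => m; rewrite refl_mul /refl /idk /vec.
  rewrite !eqxx [q == p]eq_sym (negPf pq) /=; field; exact: sqr1_neq0.
by split; rewrite refl_tr.
Qed.

Let refl_block p q tau : c p = c q -> blockwise c (refl p q tau).
Proof.
move=> cpq j m jm.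
have vec0 l : c l != c p -> vec p q tau l = 0.
  rewrite /vec => lp; have [pl|_] := eqVneq p l; first by rewrite pl eqxx in lp.
  have [ql|_] := eqVneq q l; first by rewrite cpq ql eqxx in lp.
  by rewrite mulr0 addr0.
have jm' : j != m by apply: contraNneq jm => ->.
rewrite /refl /idk (negPf jm').
have [jp|/vec0->] := eqVneq (c j) (c p); last first.
  by rewrite mulr0 mul0r subr0.
rewrite (vec0 m) ?mulr0 ?subr0 //; by rewrite eq_sym -jp.
Qed.

Let conj_refl p q tau T j :
  let D := conj T in let k := 2 / (1 + tau ^+ 2) in
  conj (mulk (refl p q tau) T) j j =
  D j j - 2 * k * vec p q tau j * (D j p + tau * D j q) +
  k ^+ 2 * vec p q tau j ^+ 2 *
    (D p p + 2 * tau * D p q + tau ^+ 2 * D q q).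
Proof.
move=> D k; have -> : conj (mulk (refl p q tau) T) =
    mulk (refl p q tau) (trk (mulk (refl p q tau) D)).
  have trD : trk D = D.
    by apply/funext => a; apply/funext => b; exact: conj_sym.
  by rewrite (trkM _ D) trD refl_tr /D /conj trkM refl_tr !mulkA.
rewrite refl_mul /trk !refl_mul -/k.
rewrite [D p j]conj_sym [D q j]conj_sym [D q p]conj_sym -/D.
rewrite -/(vec _ _ _ _); ring.
Qed.

(** A reflection in the plane of [p] and [q] changes only these two diagonal entries and preserves
    the trace, so the entries move by opposite amounts; hence the factor [w p - w q]. *)
Let refl_gain p q tau T : p != q ->
  height (mulk (refl p q tau) T) - height T =
  4 * tau / (1 + tau ^+ 2) ^+ 2 * (w p - w q) *
  (tau * (conj T q q - conj T p p) + (1 - tau ^+ 2) * conj T p q).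
Proof.
move=> pq; rewrite /height -sumrB.
under eq_bigr do rewrite conj_refl.
rewrite (bigD1 p) //= (bigD1 q) 1?eq_sym //= big1 => [|j /andP[jp jq]].
  rewrite /vec !eqxx (negPf pq) [q == p]eq_sym (negPf pq) /=.
  rewrite [conj T q p]conj_sym; field; exact: sqr1_neq0.
rewrite /vec [p == j]eq_sym [q == j]eq_sym (negPf jp) (negPf jq) /=; ring.
Qed.

Let max_diag T : OB T -> (forall T', OB T' -> height T' <= height T) ->
  forall p q, p != q -> conj T p q = 0.
Proof.
move=> OT Tmax p q pq; have [cpq|cpq] := eqVneq (c p) (c q); last first.
  by rewrite conj_block.
set A := (w p - w q) * conj T p q.
set B := (w p - w q) * (conj T q q - conj T p p).
have le0 tau : tau * (tau * B + (1 - tau ^+ 2) * A) <= 0.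
  have : height (mulk (refl p q tau) T) - height T <= 0.
    rewrite subr_le0; apply: Tmax; case: OT => oT bT; split.
      by apply: orthM => //; exact: refl_orth.
    by apply: blockwiseM => //; exact: refl_block.
  rewrite refl_gain //.
  have n0 : 0 < 4 / (1 + tau ^+ 2) ^+ 2.
    by rewrite divr_gt0 // exprn_even_gt0 //= sqr1_neq0.
  move=> h; rewrite -(pmulr_rle0 _ n0); apply: le_trans h.
  by rewrite le_eqVlt; apply/orP; left; apply/eqP; rewrite /A /B; ring.
have wpq : w p - w q != 0 by rewrite subr_eq0 (inj_eq w_inj).
suff /eqP : A = 0 by rewrite mulf_eq0 (negPf wpq) /= => /eqP.
apply/eqP/negPn/negP => A0.
(* At [tau = A * d] the expression of [le0] becomes [d * A^2 * (1 + d * B - d^2 * A^2)]. This [d]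
   bounds [d * |B| + d^2 * A^2] by 1/2, so the expression is positive. *)
set d := (2 + A ^+ 2 + 2 * `|B|)^-1.
have den0 : 0 < 2 + A ^+ 2 + 2 * `|B| by rewrite !ltr_pwDl ?sqr_ge0 ?mulr_ge0.
have d0 : 0 < d by rewrite invr_gt0.
have dE : d * 2 + d * A ^+ 2 + d * (2 * `|B|) = 1.
  by rewrite -!mulrDr mulVf // gt_eqF.
have B1 : - `|B| <= B by rewrite lerNnormlW.
have := le0 (A * d); have -> : A * d * (A * d * B + (1 - (A * d) ^+ 2) * A) =
  (d * A ^+ 2) * (1 + d * B - d * (d * A ^+ 2)) by ring.
have A2 : 0 < A ^+ 2 by rewrite exprn_even_gt0 //=.
have dA0 : 0 < d * A ^+ 2 by rewrite mulr_gt0.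
rewrite (pmulr_rle0 _ dA0); apply/negP; rewrite -ltNge.
have dB : - (d * `|B|) <= d * B by rewrite -mulrN ler_pM2l.
have dB0 : 0 <= d * `|B| by rewrite mulr_ge0 // ltW.
have : d * (d * A ^+ 2) <= d * 1 by rewrite ler_pM2l //; lra.
lra.
Qed.

(** The ultralimit of a maximizing sequence is again orthogonal and blockwise, and [height] is
    continuous in the entries. *)
Let max_exists : exists2 T, OB T & forall T', OB T' -> height T' <= height T.
Proof.
pose E : set R := [set height T | T in [set T | OB T]].
pose M := \sum_j `|w j| * \sum_l \sum_m `|S l m|.
have EM T : OB T -> height T <= M.
  move=> [oT _]; rewrite /height /M; apply: ler_sum => j _.
  rewrite (le_trans (ler_norm _)) // normrM ler_wpM2l //.
  rewrite /conj /mulk (le_trans (ler_norm_sum _ _ _)) //.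
  apply: ler_sum => l _; rewrite normrM.
  rewrite (@le_trans _ _ (1 * `|\sum_i S l i * trk T i j|)) //.
    by rewrite ler_wpM2r // orth_le1.
  rewrite mul1r (le_trans (ler_norm_sum _ _ _)) //; apply: ler_sum => m _.
  by rewrite normrM ler_piMr //; apply: orth_le1; exact: orth_tr.
have OB1 : OB (idk) by split; [exact: orth1|exact: blockwise1].
have supE : has_sup E.
  split; first by exists (height (idk)); exists (idk).
  by exists M => _ [T OT <-]; exact: EM.
have adh (n : nat) : exists T, OB T /\ sup E - n.+1%:R^-1 < height T.
  have n0 : 0 < (n.+1%:R^-1 : R) by [].
  by have [_ [T OT <-] Tn] := sup_adherent n0 supE; exists T.
have [T TP] := choice adh.
have [F [UF sF]] := ultraFilterLemma (@eventually_filter : ProperFilter \oo).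
have [T0 T0P] := orth_ultra_cvg UF (fun n => (TP n).1.1).
have OT0 : OB T0.
  split; first exact: orth_limit (fun n => (TP n).1.1) T0P.
  exact: blockwise_limit (fun n => (TP n).1.2) T0P.
exists T0 => // T' OT'.
have -> : height T0 = sup E.
  have h1 : height (T n) @[n --> F] --> height T0.
    apply: cvg_fsum => j _; apply: cvgM; first exact: cvg_cst.
    apply: cvg_mulk => [j1 m1|j1 m1]; first exact: T0P.
    apply: cvg_mulk => [j2 m2|j2 m2]; first exact: cvg_cst.
    exact: T0P.
  apply/eqP; rewrite eq_le; apply/andP; split.
    by apply: sup_ubound; [exact: supE.2|exists T0].
  rewrite -[sup E](subr0).
  have h2 : sup E - n.+1%:R^-1 @[n --> F] --> sup E - 0.
    apply: cvgB; first exact: cvg_cst.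
    by apply: cvg_trans (@cvg_harmonic R); apply: cvg_app; exact: sF.
  apply: (ler_limit h2 h1); by apply: nearW => n; rewrite ltW // (TP n).2.
by apply: sup_ubound; [exact: supE.2|exists T'].
Qed.

Lemma blockwise_spectral : exists T d, [/\ orth T, blockwise c T &
  forall m n, S m n = \sum_j d j * T j m * T j n].
Proof.
have [T OT Tmax] := max_exists; exists T, (fun j => conj T j j).
have [oT bT] := OT; split=> // m n.
have -> : S = mulk (trk T) (mulk (conj T) T).
  by rewrite /conj -!mulkA oT.2 mulk1 mulkA oT.2 mul1k.
rewrite /mulk; apply: eq_bigr => j _; rewrite (bigD1 j) //= big1 => [|l lj].
  by rewrite addr0 /trk; ring.
by rewrite max_diag 1?eq_sym // mul0r.
Qed.

End Spectral.

(** * Coordinates adapted to flags *)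

Section Classes.
Variables (T : Type) (D : set T) (E : T -> T -> Prop).
Hypothesis Esym : forall x y, E x y -> E y x.
Hypothesis Etrans : forall x y z, E x y -> E y z -> E x z.

Lemma class_related (C : classes D E) x y : sval C x -> sval C y -> E x y.
Proof.
have [z Dz ->] := svalP C => -[_ zx] [_ zy]; exact: Etrans (Esym zx) zy.
Qed.

Lemma class_eq (C C' : classes D E) x y :
  sval C x -> sval C' y -> E x y -> C = C'.
Proof.
move=> Cx C'y xy; apply: eq_sig_hprop => [? ? ?|]; first exact: Prop_irrelevance.
have [z Dz CE] := svalP C; have [z' Dz' C'E] := svalP C'.
move: Cx C'y; rewrite CE C'E => -[_ zx] [_ z'y].
have zz' : E z z' by apply: Etrans zx _; apply: Etrans xy _; exact: Esym.
apply/seteqP; split => w [Dw zw]; split=> //; last exact: Etrans zw.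
by apply: Etrans zw; exact: Esym.
Qed.

Lemma class_inhabited (C : classes D E) : (forall x, E x x) ->
  exists2 x, D x & sval C x.
Proof. by move=> Er; have [x Dx ->] := svalP C; exists x. Qed.

Lemma class_sub (C : classes D E) x : sval C x -> D x.
Proof. by have [z Dz ->] := svalP C => -[]. Qed.

End Classes.

Section Equivalences.
Variable R : realType.

Lemma proportional_refl (V : vectType R) (q : V -> R) : proportional q q.
Proof. by exists 1 => //; apply/funext => v; rewrite mul1r. Qed.

Lemma proportional_sym (V : vectType R) (q q' : V -> R) :
  proportional q q' -> proportional q' q.
Proof.
move=> [a a0 ->]; exists a^-1; first by rewrite invr_gt0.
by apply/funext => v; rewrite mulKf // gt_eqF.
Qed.

Lemma proportional_trans (V : vectType R) (q q' q'' : V -> R) :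
  proportional q q' -> proportional q' q'' -> proportional q q''.
Proof.
move=> [a a0 ->] [b b0 ->]; exists (b * a); first exact: mulr_gt0.
by apply/funext => v; rewrite mulrA.
Qed.

Variables (I : finType) (p : I -> nat).
Implicit Types psi : forall i, 'I_(p i) -> R.

Lemma velocity_refl psi : velocity_equiv psi psi.
Proof. by exists 1, (fun=> 0); split=> // i k; rewrite mul1r addr0. Qed.

Lemma velocity_sym psi psi' : velocity_equiv psi psi' -> velocity_equiv psi' psi.
Proof.
move=> [a [b [a0 h]]]; exists a^-1, (fun i => - a^-1 * b i).
split; first by rewrite invr_gt0.
by move=> i k; rewrite h mulrDr mulKf ?gt_eqF // mulNr addrK.
Qed.

Lemma velocity_trans psi psi' psi'' :
  velocity_equiv psi psi' -> velocity_equiv psi' psi'' ->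
  velocity_equiv psi psi''.
Proof.
move=> [a [b [a0 h]]] [a' [b' [a'0 h']]].
exists (a' * a), (fun i => a' * b i + b' i); split; first exact: mulr_gt0.
by move=> i k; rewrite h' h; ring.
Qed.

End Equivalences.

Section Polarization.
Variables (R : realType) (V : lmodType R).

Lemma polarization (S S' : finType) (P : pred S) (P' : pred S')
    (x : V -> S -> R) (x' : V -> S' -> R) (e : S -> R) (e' : S' -> R) :
  (forall j, P j -> scalar (x ^~ j)) -> (forall j, P' j -> scalar (x' ^~ j)) ->
  (forall v, \sum_(j | P j) e j * x v j ^+ 2 =
             \sum_(j | P' j) e' j * x' v j ^+ 2) ->
  forall u v, \sum_(j | P j) e j * (x u j * x v j) =
              \sum_(j | P' j) e' j * (x' u j * x' v j).
Proof.
move=> xs xs' q u v.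
have expand (Z : finType) (Q : pred Z) (y : V -> Z -> R) (f : Z -> R) :
    (forall j, Q j -> scalar (y ^~ j)) ->
    2 * \sum_(j | Q j) f j * (y u j * y v j) =
    \sum_(j | Q j) f j * y (u + v) j ^+ 2 - \sum_(j | Q j) f j * y u j ^+ 2
    - \sum_(j | Q j) f j * y v j ^+ 2.
  move=> ys; rewrite mulr_sumr -!sumrB; apply: eq_bigr => j Qj.
  by have := ys j Qj 1 u v; rewrite scale1r mul1r => ->; ring.
have n2 : 2 != 0 :> R by rewrite pnatr_eq0.
by apply: (mulfI n2); rewrite !expand // !q.
Qed.

End Polarization.

Section Coordinates.
Variables (R : realType) (J : finType).

(** The number [x i v j] is a coordinate of [v] only if [c j = i]. *)
Definition coords (I : finType) (V : I -> vectType R) (c : J -> I)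
    (x : forall i, V i -> J -> R) : Prop :=
  [/\ forall i j, c j = i -> scalar (x i ^~ j),
      forall i v, (forall j, c j = i -> x i v j = 0) -> v = 0
    & forall i (r : J -> R), exists v, forall j, c j = i -> x i v j = r j].

Definition act (T : J -> J -> R) (I : finType) (V : I -> vectType R)
    (x : forall i, V i -> J -> R) : forall i, V i -> J -> R :=
  fun i v j => \sum_m T j m * x i v m.

(** Two frames representing the same point may label [J] differently, so compatibility is stated
    through the nonzero entries of [T] instead of a common labelling. These entries carry all later
    comparisons. *)
Definition change (T : J -> J -> R) (I : finType) (V : I -> vectType R)
    (c : J -> I) (x : forall i, V i -> J -> R)
    (c2 : J -> I) (x2 : forall i, V i -> J -> R) : Prop :=
  [/\ orth T, coords c x, coords c2 x2, forall j m, T j m != 0 -> c j = c2 m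
    & forall i v j, c j = i -> x i v j = act T x2 v j].

Section Family.
Variables (I : finType) (V : I -> vectType R).
Implicit Types (c : J -> I) (x : forall i, V i -> J -> R).

Lemma coord0 c x i j : coords c x -> c j = i -> x i 0 j = 0.
Proof.
move=> [xs _ _] cj; have := xs i j cj (-1) 0 0.
by rewrite scaler0 addr0 mulN1r addNr.
Qed.

Lemma coord_dual c x i j : coords c x ->
  exists v, forall l, c l = i -> x i v l = (l == j)%:R.
Proof. by move=> [_ _ /(_ i (fun l => (l == j)%:R))]. Qed.

Lemma act1 x : act idk x = x.
Proof.
apply: functional_extensionality_dep => i.
by apply/funext => v; apply/funext => j; exact: sum_delta.
Qed.

Lemma actM A B x : act (mulk A B) x = act A (act B x).
Proof.
apply: functional_extensionality_dep => i.
apply/funext => v; apply/funext => j; rewrite /act /mulk.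
under eq_bigr do rewrite mulr_suml.
rewrite exchange_big; apply: eq_bigr => l _; rewrite mulr_sumr.
by apply: eq_bigr => k _; rewrite mulrA.
Qed.

Lemma coords_act T c x : orth T -> blockwise c T -> coords c x ->
  coords c (act T x).
Proof.
move=> oT bT [xs x0 xr]; split.
- move=> i j cj a u v; rewrite /act mulr_sumr -big_split /=.
  apply: eq_bigr => m _; have [jm|jm] := eqVneq (c j) (c m).
    by rewrite xs -?jm //; ring.
  by rewrite bT // !mul0r mulr0 addr0.
- move=> i v v0; apply: x0 => m cm.
  have <- : act (mulk (trk T) T) x v m = x i v m.
    by rewrite oT.2 act1.
  rewrite actM /act big1 // => j _; have [jm|jm] := eqVneq (c j) (c m).
    by rewrite -/(act T x v j) v0 ?mulr0 // jm.
  by rewrite /trk bT // mul0r.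
- move=> i r; have [v vE] := xr i (fun m => \sum_j T j m * r j).
  exists v => j cj; have <- : \sum_m mulk T (trk T) j m * r m = r j.
    by rewrite oT.1; exact: sum_delta.
  rewrite /act /mulk; under [RHS]eq_bigr do rewrite mulr_suml.
  rewrite exchange_big; apply: eq_bigr => m _.
  have [jm|jm] := eqVneq (c j) (c m).
    rewrite vE -?jm // mulr_sumr; apply: eq_bigr => k _; rewrite /trk; ring.
  by rewrite bT // mul0r big1 // => k _; rewrite !mul0r.
Qed.

Lemma change_act T1 T2 c x : coords c x -> orth T1 -> orth T2 ->
  blockwise c T1 -> blockwise c T2 ->
  change (mulk T1 (trk T2)) c (act T1 x) c (act T2 x).
Proof.
move=> cx o1 o2 b1 b2; have o3 := orth_tr o2.
split; [exact: orthM|exact: coords_act|exact: coords_act| |].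
  move=> j m; apply: blockwise_eq.
  by apply: blockwiseM => //; exact: blockwise_tr.
by move=> i v j _; rewrite -actM -mulkA o2.2 mulk1.
Qed.

Lemma change_sym T c x c2 x2 : change T c x c2 x2 -> change (trk T) c2 x2 c x.
Proof.
move=> [oT cx cx2 cT xT]; split=> //; first exact: orth_tr.
  by move=> j m /cT.
move=> i v m cm.
have <- : act (mulk (trk T) T) x2 v m = x2 i v m by rewrite oT.2 act1.
rewrite actM; apply: eq_bigr => j _.
have [Tjm|/cT jm] := eqVneq (T j m) 0; first by rewrite /trk Tjm !mul0r.
by rewrite -xT // jm.
Qed.

(* In coordinates related by an orthogonal matrix [T], both diagonal forms are
   compared on a vector dual to [x_j] and a vector dual to [x2_m]. *)
Lemma diagonal_eq T c x c2 x2 i (e e2 : J -> R) (k : R) :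
  change T c x c2 x2 ->
  (forall v, \sum_(m | c2 m == i) e2 m * x2 i v m ^+ 2 =
             k * \sum_(j | c j == i) e j * x i v j ^+ 2) ->
  forall j m, c j = i -> T j m != 0 -> e2 m = k * e j.
Proof.
move=> ch q j m cj Tjm; have [_ _ _ cT xT] := change_sym ch.
have [_ [xs _ _] [xs2 _ _] cT' xT'] := ch.
have [u uE] : exists u, forall l, c l = i -> x i u l = (l == j)%:R.
  by apply: coord_dual; have [] := ch.
have [w wE] : exists w, forall l, c2 l = i -> x2 i w l = (l == m)%:R.
  by apply: coord_dual; have [] := ch.
have cm : c2 m = i by rewrite -(cT' j m).
have xw : x i w j = T j m.
  rewrite xT' // /act (bigD1 m) //= wE // eqxx mulr1 big1 ?addr0 // => l lm.
  have [->|/cT' jl] := eqVneq (T j l) 0; first by rewrite mul0r.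
  by rewrite wE -?jl // (negPf lm) mulr0.
have x2u : x2 i u m = T j m.
  rewrite xT // /act (bigD1 j) //= uE // eqxx mulr1 big1 ?addr0 // => l lj.
  have [->|/cT ml] := eqVneq (trk T m l) 0; first by rewrite mul0r.
  by rewrite uE -?ml // (negPf lj) mulr0.
have /= := @polarization R (V i) J J (fun m => c2 m == i) (fun j => c j == i)
  (x2 i) (x i) e2 (fun j => k * e j) _ _ _ u w.
rewrite (bigD1 m) ?cm //= big1 ?addr0; last first.
  by move=> l /andP[/eqP cl lm]; rewrite [x2 i w l]wE // (negPf lm) !mulr0.
rewrite (bigD1 j) ?cj //= big1 ?addr0; last first.
  by move=> l /andP[/eqP cl lj]; rewrite [x i u l]uE // (negPf lj) mul0r mulr0.
rewrite wE // uE // !eqxx mulr1 mul1r x2u xw => h.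
apply: (mulIf Tjm); apply: h.
- by move=> l /eqP; exact: xs2.
- by move=> l /eqP; exact: xs.
- by move=> v; rewrite q mulr_sumr; apply: eq_bigr => l _; rewrite mulrA.
Qed.

(** Converse of [diagonal_eq]: replacing one factor of each square by its expression in the other
    frame turns both sides into one double sum of [T j m * x_j * x2_m], where the relation of the
    coefficients applies termwise. *)
Lemma diagonal_sum T c x c2 x2 i (e e2 : J -> R) (k : R) :
  change T c x c2 x2 ->
  (forall j m, c j = i -> T j m != 0 -> e2 m = k * e j) ->
  forall v, \sum_(m | c2 m == i) e2 m * x2 i v m ^+ 2 =
            k * \sum_(j | c j == i) e j * x i v j ^+ 2.
Proof.
move=> ch eE v; have [_ _ _ cT xT] := change_sym ch.
have [_ _ _ cT' xT'] := ch.
transitivity (\sum_(m | c2 m == i) \sum_(j | c j == i)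
    k * e j * (T j m * x i v j * x2 i v m)).
  apply: eq_bigr => m /eqP cm; rewrite expr2 {1}xT // /act.
  rewrite (bigID (fun j => c j == i)) /= [X in _ + X]big1 ?addr0; last first.
    move=> j ji; have [->|/cT ml] := eqVneq (trk T m j) 0; first by rewrite mul0r.
    by rewrite -ml cm eqxx in ji.
  rewrite mulr_suml mulr_sumr; apply: eq_bigr => j /eqP cj.
  have [Tjm|Tjm] := eqVneq (T j m) 0; first by rewrite /trk Tjm; ring.
  rewrite (eE j m) // /trk; ring.
rewrite exchange_big mulr_sumr; apply: eq_bigr => j /eqP cj.
rewrite expr2 {3}xT' // /act.
rewrite [in RHS](bigID (fun m => c2 m == i)) /= [X in _ + X]big1 ?addr0; last first.
  move=> m mi; have [->|/cT' ml] := eqVneq (T j m) 0; first by rewrite mul0r.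
  by rewrite -ml cj eqxx in mi.
rewrite !mulr_sumr; apply: eq_bigr => m _; ring.
Qed.

End Family.

Section Flags.
Variables (I : finType) (V : I -> vectType R).
Variables (c : J -> I) (x : forall i, V i -> J -> R).

(** [c' j = (i, k)] places the [j]-th coordinate on [W_k / W_(k+1)]. *)
Definition adapted (W : forall i, flag (V i)) (c' : J -> quot_index W) : Prop :=
  (forall j, tag (c' j) = c j) /\
  forall i (k : nat) v, v \in flag_space (W i) k <->
    forall j, c j = i -> (tagged (c' j) < k)%N -> x v j = 0.

Definition quot_coord (W : forall i, flag (V i)) :
    forall i', quot_family W i' -> J -> R :=
  fun i' z => x (subquot_repr (z : flag_quot (tagged i'))).

Lemma quot_index_eq (W : forall i, flag (V i)) (u w : quot_index W) :
  tag u = tag w -> (tagged u : nat) = tagged w -> u = w.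
Proof.
case: u w => i k [i' l] /= ii'; move: l; rewrite -ii' => l kl.
by congr (existT _ _ _); exact: val_inj.
Qed.

(** A representative is determined modulo [W_(k+1)], on which the coordinates of level [k] vanish;
    so these coordinates descend to [W_k / W_(k+1)]. *)
Lemma coords_quot (W : forall i, flag (V i)) (c' : J -> quot_index W) :
  coords c x -> adapted c' -> coords c' (quot_coord (W := W)).
Proof.
move=> [xs x0 xr] [cc' xW]; split.
- move=> i' j cj a u v; have ci : c j = tag i' by rewrite -cc' cj.
  have := subquot_repr_linear a u v.
  rewrite xW => /(_ j ci); rewrite cj ltnSn => /(_ isT).
  rewrite /quot_coord; set w := subquot_repr (a *: u + v).
  set w1 := subquot_repr u; set w2 := subquot_repr v.
  have -> : w - (a *: w1 + w2) = (-1) *: (a *: w1 + w2) + w.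
    by rewrite scaleN1r addrC.
  by rewrite !xs // mulN1r addrC => /eqP; rewrite subr_eq0 => /eqP.
- move=> i' z z0; apply: subquot_repr_eq0; rewrite xW => j ci.
  rewrite ltnS leq_eqVlt => /orP[/eqP jk|jk].
    by apply: z0; apply: quot_index_eq; rewrite ?cc'.
  by have := subquot_repr_mem z; rewrite xW => /(_ j ci jk).
- move=> i' r; have [v vE] := xr (tag i') (fun j => if c' j == i' then r j else 0).
  have vW : v \in flag_space (W (tag i')) (tagged i').
    rewrite xW => j ci jk; rewrite vE //.
    by case: eqP => // ji; rewrite ji ltnn in jk.
  exists (subquot_pi _ (vsproj _ v)) => j cj.
  have ci : c j = tag i' by rewrite -cc' cj.
  have := @subquot_repr_pi _ _ _ (flag_space (W (tag i')) (tagged i').+1)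
    (vsproj (flag_space (W (tag i')) (tagged i')) v).
  rewrite vsprojK // xW => /(_ j ci); rewrite cj ltnSn => /(_ isT).
  set w := subquot_repr _; have -> : w - v = (-1) *: v + w.
    by rewrite scaleN1r addrC.
  rewrite xs // mulN1r addrC => /eqP; rewrite subr_eq0 => /eqP.
  by rewrite /quot_coord -/w => ->; rewrite vE // cj eqxx.
Qed.

(* Otherwise [W_k = W_(k+1)]. *)
Lemma adapted_surj (W : forall i, flag (V i)) (c' : J -> quot_index W) :
  adapted c' -> forall i', exists j, c' j = i'.
Proof.
move=> [cc' xW] [i k]; apply: contrapT => nj.
have : path (fun U W : {vspace V i} => (W <= U)%VS && (W != U)) fullv (W i).
  by have /andP[] := flagP (W i).
move/(pathP 0%VS)/(_ k (ltn_ord k))=> /andP[_ /eqP]; apply.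
apply/vspaceP => v.
suff : v \in flag_space (W i) k.+1 <-> v \in flag_space (W i) k.
  by move=> vk; apply/idP/idP => /vk.
rewrite !xW; split => h j cj jk; first by apply: h => //; exact: ltnW.
move: jk; rewrite ltnS leq_eqVlt => /orP[/eqP jk|]; last exact: h.
case: nj; exists j; apply: quot_index_eq => //=; by rewrite cc'.
Qed.

End Flags.

(** The vector dual to [x2_m] lies in the flag space of its level, which makes [T] block triangular.
    The inverse of [T] is its transpose, so the same argument for [trk T] gives the opposite
    inequality of levels. *)
Lemma change_blocks (I : finType) (V : I -> vectType R) T c x c2 x2
    (W : forall i, flag (V i)) (c' c2' : J -> quot_index W) :
  change T c x c2 x2 -> adapted c x c' -> adapted c2 x2 c2' ->
  forall j m, T j m != 0 -> c' j = c2' m.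
Proof.
move=> ch ad ad2.
have le T0 (d d2 : J -> I) (y y2 : forall i, V i -> J -> R)
    (d' d2' : J -> quot_index W) : change T0 d y d2 y2 -> adapted d y d' ->
    adapted d2 y2 d2' -> forall j m, T0 j m != 0 ->
    (tagged (d2' m) <= tagged (d' j))%N.
  move=> [_ cy cy2 dT yT] [dd' yW] [dd2' y2W] j m Tjm; rewrite leqNgt.
  apply/negP => jm; have [w wE] := coord_dual (d2 m) m cy2.
  have : w \in flag_space (W (d2 m)) (tagged (d2' m)).
    rewrite y2W => l dl lm; rewrite wE //; case: eqP => // lm'.
    by rewrite lm' ltnn in lm.
  rewrite yW => /(_ j (dT _ _ Tjm) jm); rewrite yT; last exact: dT.
  rewrite /act (bigD1 m) //= wE // eqxx mulr1 big1 => [|l lm].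
    by rewrite addr0 => /eqP; rewrite (negPf Tjm).
  have [->|/dT jl] := eqVneq (T0 j l) 0; first by rewrite mul0r.
  by rewrite wE ?(negPf lm) ?mulr0 // -jl (dT j m).
move=> j m Tjm; apply: quot_index_eq.
  by rewrite ad.1 ad2.1; have [_ _ _ cT _] := ch; exact: cT.
apply/eqP; rewrite eqn_leq (le _ _ _ _ _ _ _ ch ad ad2) // andbT.
exact: (le _ _ _ _ _ _ _ (change_sym ch) ad2 ad).
Qed.

Lemma change_quot (I : finType) (V : I -> vectType R) T c x c2 x2
    (W : forall i, flag (V i)) (c' c2' : J -> quot_index W) :
  change T c x c2 x2 -> adapted c x c' -> adapted c2 x2 c2' ->
  change T c' (quot_coord x (W := W)) c2' (quot_coord x2 (W := W)).
Proof.
move=> ch ad ad2; have [oT cx cx2 cT xT] := ch; split=> //.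
- exact: coords_quot cx ad.
- exact: coords_quot cx2 ad2.
- exact: change_blocks ch ad ad2.
- by move=> i' v j cj; apply: xT; rewrite -ad.1 cj.
Qed.

End Coordinates.

(** * Limits in a flat *)

Section Limits.
Variable R : realType.

Definition velocity_at (I : finType) (p : I -> nat)
    (psi : forall i, 'I_(p i) -> R) (u : {i : I & 'I_(p i)}) : R :=
  psi (tag u) (tagged u).

(** Along [F], the point of the flat [a] in the frame with coordinates [x]
    tends to [y]. *)
Fixpoint flat_cvg (J : finType) (T : Type) (F : set_system T)
    (a : J -> T -> R) (I : finType) (V : I -> vectType R) (y : Karp V)
    {struct y} : (J -> I) -> (forall i, V i -> J -> R) -> Prop :=
  match y with
  | Interior q => fun c x =>
      exists alpha : J -> R,
        (forall j l, c j = c l ->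
           a j t - a l t @[t --> F] --> alpha j - alpha l) /\
        forall i, sval (q i)
          (fun v => \sum_(j | c j == i) expR (alpha j) * x i v j ^+ 2)
  | Stratum W _ psi y' => fun c x =>
      exists (c' : J -> quot_index W) psi0 (s : T -> R),
        [/\ sval psi psi0, adapted c x c', s @ F --> +oo,
            forall j l, c j = c l -> (a j t - a l t) / s t @[t --> F] -->
              velocity_at psi0 (c' j) - velocity_at psi0 (c' l)
          & flat_cvg F a y' c' (quot_coord x (W := W))]
  end.

Variable J : finType.

(** Only differences inside a block matter. Hence the terms [s t * psi] that drive the blocks of a
    stratum apart can be added or dropped when passing to the recursive level. *)
Lemma flat_cvg_ext T (F : set_system T) (a b : J -> T -> R) (I : finType)
    (V : I -> vectType R) (y : Karp V) c x :
  (forall j l, c j = c l -> forall t, a j t - a l t = b j t - b l t) ->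
  flat_cvg F a y c x -> flat_cvg F b y c x.
Proof.
elim: y c x => {I V} [I V q|I V W nt psi y IH] c x ab /=.
  move=> [alpha [h hq]]; exists alpha; split=> // j l jl.
  by under eq_fun do rewrite -ab //; exact: h.
move=> [c' [psi0 [s [ps ad soo h L]]]]; exists c', psi0, s; split=> //.
  by move=> j l jl; under eq_fun do rewrite -ab //; exact: h.
by apply: IH L => j l jl t; apply: ab; rewrite -!ad.1 jl.
Qed.

Lemma flat_cvg_fine T (F G : set_system T) (a : J -> T -> R) (I : finType)
    (V : I -> vectType R) (y : Karp V) c x :
  F `<=` G -> flat_cvg F a y c x -> flat_cvg G a y c x.
Proof.
move=> FG; have fine (Z : nbhsType) (f : T -> Z) (z : Z) :
    f @ F --> z -> f @ G --> z.
  by move=> fz A /fz; exact: FG.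
elim: y c x => {I V} [I V q|I V W nt psi y IH] c x /=.
  by move=> [alpha [h hq]]; exists alpha; split=> // j l /h; exact: fine.
move=> [c' [psi0 [s [ps ad soo h L]]]]; exists c', psi0, s; split=> //.
- by move=> A /soo; exact: FG.
- by move=> j l /h; exact: fine.
- exact: IH.
Qed.

(** If [a] and [b] grow at comparable or different rates, the limit of
    [ratio a b] records [a / b]; [ratio a 0] records the limit of [a]. *)
Definition ratio (a b : R) : R := a / (1 + `|a| + `|b|).

Lemma ratio0_inj a b : ratio a 0 = ratio b 0 -> a = b.
Proof.
have ratioE (z : R) : ratio z 0 * (1 + `|z|) = z.
  by rewrite /ratio normr0 addr0 divfK.
have ratioN (z : R) : `|ratio z 0| * (1 + `|z|) = `|z|.
  by rewrite -[in RHS](ratioE z) [in RHS]normrM [`|1 + _|]ger0_norm.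
move=> ab; have e : `|a| = `|b|.
  have := ratioN a; have := ratioN b; rewrite ab; set r := `|ratio b 0|.
  move=> hb ha; have h1 : (1 - r) * `|a| = (1 - r) * `|b|.
    by rewrite !mulrBl !mul1r -{1}ha -{1}hb; ring.
  have [r1|r1] := eqVneq (1 - r) 0; last exact: mulfI h1.
  have r1' : r = 1 by move/eqP: r1; rewrite subr_eq0 => /eqP.
  by move: hb; rewrite r1' mul1r; move/eqP; rewrite -subr_eq0 addrK oner_eq0.
by rewrite -(ratioE a) -(ratioE b) ab e.
Qed.

Lemma ratio_lt1 a b : `|ratio a b| < 1.
Proof.
have p : 0 < 1 + `|a| + `|b| by rewrite !ltr_pwDl.
rewrite /ratio normrM normfV (gtr0_norm p) ltr_pdivrMr // mul1r.
by have := normr_ge0 b; lra.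
Qed.

Section Ratio.
Variables (T : Type) (F : set_system T).
Context {FF : ProperFilter F}.

Lemma cvg_ratio (a b : T -> R) (k l : R) :
  a @ F --> k -> b @ F --> l -> ratio (a t) (b t) @[t --> F] --> ratio k l.
Proof.
move=> ak bl; apply: cvgM => //; apply: cvgV.
  by rewrite gt_eqF // !ltr_pwDl.
by apply: cvgD; [apply: cvgD; [exact: cvg_cst|]|]; exact: cvg_norm.
Qed.

(** Dividing numerator and denominator by [s] turns the summand 1 of [ratio] into [1 / s], which
    vanishes in the limit. The result is unchanged when [k] and [l] are scaled by a common positive
    factor. *)
Lemma cvg_ratio_rate (s a b : T -> R) (k l : R) : s @ F --> +oo ->
  a t / s t @[t --> F] --> k -> b t / s t @[t --> F] --> l ->
  `|k| + `|l| != 0 ->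
  ratio (a t) (b t) @[t --> F] --> k / (`|k| + `|l|).
Proof.
move=> soo ak bl kl.
have s0 : \forall t \near F, 0 < s t by move/cvgryPgt: soo; exact.
have sV : (s t)^-1 @[t --> F] --> (0 : R) by apply/gtr0_cvgV0.
have h : (a t / s t) / ((s t)^-1 + `|a t / s t| + `|b t / s t|) @[t --> F] -->
    k / (0 + `|k| + `|l|).
  apply: cvgM => //; apply: cvgV; first by rewrite add0r.
  by apply: cvgD; [apply: cvgD => //|]; exact: cvg_norm.
rewrite add0r in h; apply: cvg_trans h; apply: near_eq_cvg.
near=> t; have st : 0 < s t by near: t.
rewrite /ratio !normrM normfV (gtr0_norm st).
have d0 : 1 + `|a t| + `|b t| != 0 by rewrite gt_eqF // !ltr_pwDl.
have -> : (s t)^-1 + `|a t| / s t + `|b t| / s t = (1 + `|a t| + `|b t|) / s t.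
  by rewrite !mulrDl mul1r.
by field; rewrite d0 gt_eqF.
Unshelve. all: by end_near. Qed.

End Ratio.

(** In the interior, proportional forms have equal differences of exponents. In a stratum, the two
    velocities are equivalent, and the ratio of rates ignores the common factor and the shifts. If
    the rates of both pairs vanish, each pair lies in one block, since velocities decrease strictly,
    and the claim passes to the quotients. *)
Lemma flat_cvg_agree (T T2 : Type) (F : set_system T) (F2 : set_system T2)
    (a : J -> T -> R) (a2 : J -> T2 -> R) (I : finType) (V : I -> vectType R)
    (y : Karp V) U c x c2 x2 :
  ProperFilter F -> ProperFilter F2 -> change U c x c2 x2 ->
  flat_cvg F a y c x -> flat_cvg F2 a2 y c2 x2 ->
  forall j l j' l' m n m' n' (k k2 : R),
    c j = c l -> c j' = c l' ->
    U j m != 0 -> U l n != 0 -> U j' m' != 0 -> U l' n' != 0 ->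
    ratio (a j t - a l t) (a j' t - a l' t) @[t --> F] --> k ->
    ratio (a2 m t - a2 n t) (a2 m' t - a2 n' t) @[t --> F2] --> k2 -> k = k2.
Proof.
move=> PF PF2.
elim: y c x c2 x2 => {I V} [I V q|I V W nt psi y IH] c x c2 x2 ch /=.
  move=> [al [h hq]] [al2 [h2 hq2]] j l j' l' m n m' n' k k2 jl jl' jm ln jm' ln'.
  have [_ _ _ cU _] := ch.
  have al2E i : exists2 z, 0 < z & forall j m, c j = i -> U j m != 0 ->
      expR (al2 m) = z * expR (al j).
    have [z z0 hz] := class_related (@proportional_sym R (V i))
      (@proportional_trans R (V i)) (hq i) (hq2 i).
    exists z => //; apply: (diagonal_eq ch) => v; exact: (congr1 (fun f => f v) hz).
  have diffE j1 l1 m1 n1 : c j1 = c l1 -> U j1 m1 != 0 -> U l1 n1 != 0 ->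
      al2 m1 - al2 n1 = al j1 - al l1.
    move=> c1 U1 U2; have [z z0 hz] := al2E (c j1); apply: expR_inj.
    rewrite !expRD !expRN (hz j1 m1) // (hz l1 n1) // invfM mulrACA.
    by rewrite divff ?mul1r // gt_eqF.
  move=> hk hk2; rewrite -(eq_limit (cvg_ratio (h _ _ jl) (h _ _ jl')) hk).
  have mn : c2 m = c2 n by rewrite -(cU _ _ jm) -(cU _ _ ln).
  have mn' : c2 m' = c2 n' by rewrite -(cU _ _ jm') -(cU _ _ ln').
  rewrite -(eq_limit (cvg_ratio (h2 _ _ mn) (h2 _ _ mn')) hk2).
  by rewrite (diffE j l m n) // (diffE j' l' m' n').
move=> [c' [psi0 [s [ps ad soo h L]]]] [c2' [psi2 [s2 [ps2 ad2 soo2 h2 L2]]]].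
move=> j l j' l' m n m' n' k k2 jl jl' jm ln jm' ln' hk hk2.
have [_ _ _ cU _] := ch; have c'U := change_blocks ch ad ad2.
have mn : c2 m = c2 n by rewrite -(cU _ _ jm) -(cU _ _ ln).
have mn' : c2 m' = c2 n' by rewrite -(cU _ _ jm') -(cU _ _ ln').
have [A [B [A0 psiE]]] := class_related (@velocity_sym R _ _)
  (@velocity_trans R _ _) ps ps2.
pose D u w := velocity_at psi0 u - velocity_at psi0 w.
have DE u w : tag u = tag w ->
    velocity_at psi2 u - velocity_at psi2 w = A * D u w.
  by move=> uw; rewrite /D /velocity_at !psiE (congr1 B uw); ring.
have := h2 _ _ mn; rewrite DE ?ad2.1 // -(c'U _ _ jm) -(c'U _ _ ln) => h2'.
have := h2 _ _ mn'; rewrite DE ?ad2.1 // -(c'U _ _ jm') -(c'U _ _ ln') => h2''.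
have [D0|D0] := eqVneq (`|D (c' j) (c' l)| + `|D (c' j') (c' l')|) 0; last first.
  rewrite -(eq_limit (cvg_ratio_rate soo (h _ _ jl) (h _ _ jl') D0) hk).
  rewrite -(eq_limit (cvg_ratio_rate soo2 h2' h2'' _) hk2); last first.
    by rewrite !normrM -mulrDr mulf_neq0 // gt_eqF // gtr0_norm.
  rewrite !normrM -mulrDr -/(D _ _) (gtr0_norm A0).
  by field; rewrite D0 gt_eqF.
have D0' (u w : quot_index W) : tag u = tag w -> D u w = 0 -> u = w.
  move=> uw Duw; apply: quot_index_eq => //; apply/eqP; rewrite eqn_leq.
  have dec := class_sub ps.
  have key (u' w' : quot_index W) : tag u' = tag w' -> D u' w' = 0 ->
      (tagged u' <= tagged w')%N.
    case: u' w' => i1 k1 [i2 k2'] /= i12; move: k2'; rewrite -i12 => k2' D1.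
    rewrite leqNgt; apply/negP => /(dec i1).
    by move/eqP: D1; rewrite subr_eq0 => /eqP; rewrite /velocity_at /= => ->;
      rewrite ltxx.
  rewrite !key //; move/eqP: Duw; rewrite /D subr_eq0 => /eqP ->.
  exact: subrr.
move/eqP: D0; rewrite paddr_eq0 // !normr_eq0 => /andP[/eqP/D0' e /eqP/D0' e'].
apply: (IH _ _ _ _ (change_quot ch ad ad2) L L2) (jm) (ln) (jm') (ln') hk hk2.
  by apply: e; rewrite !ad.1.
by apply: e'; rewrite !ad.1.
Qed.

End Limits.

(** * Separation of points by the limits of ratios *)

Section Separation.
Variables (R : realType) (J : finType).

Lemma velocity_ltE (I : finType) (p : I -> nat) (psi : forall i, 'I_(p i) -> R)
    (u w : {i : I & 'I_(p i)}) : decreasing_velocity psi -> tag u = tag w ->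
  (velocity_at psi u < velocity_at psi w) = (tagged w < tagged u)%N.
Proof.
case: u w => i k [i' l] /= dec ii'; move: l; rewrite -ii' /velocity_at /= => l.
case: ltngtP => [lk|kl|/val_inj ->]; last by rewrite ltxx.
  by rewrite dec.
by rewrite ltNge ltW // dec.
Qed.

Lemma flag_inj (V : vectType R) (W W' : flag V) :
  flag_length W = flag_length W' ->
  (forall k, flag_space W k = flag_space W' k) -> W = W'.
Proof.
move=> sz sE; have : flag_seq W = flag_seq W'.
  by apply: (@eq_from_nth _ 0%VS) => // k _; exact: (sE k.+1).
case: W W' {sz sE} => s sP [s' s'P] /= ss'; subst s'.
by rewrite (bool_irrelevance sP s'P).
Qed.

Section Levels.
Variables (I : finType) (V : I -> vectType R) (U : J -> J -> R).
Variables (c c2 : J -> I) (x x2 : forall i, V i -> J -> R).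
Variables (W W2 : forall i, flag (V i)).
Variables (c' : J -> quot_index W) (c2' : J -> quot_index W2).
Hypotheses (ch : change U c x c2 x2).
Hypotheses (ad : adapted c x c') (ad2 : adapted c2 x2 c2').

(** Induction on the level: flags are strict, so some [l] sits exactly one level below [j]. Its
    partner [n] has at least the level of [l], and [m] lies strictly above [n] by monotonicity. *)
Lemma level_le :
  (forall j m l n, c j = c l -> U j m != 0 -> U l n != 0 ->
    (tagged (c' l) < tagged (c' j))%N -> (tagged (c2' n) < tagged (c2' m))%N) ->
  forall j m, U j m != 0 -> (tagged (c' j) <= tagged (c2' m))%N.
Proof.
move=> mono j m; have [k] := ubnP (tagged (c' j) : nat).
elim: k j m => // k IH j m jk Ujm.
have [->//|j0] := posnP (tagged (c' j)).
have lt1 : ((tagged (c' j)).-1 < flag_length (W (tag (c' j))))%N.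
  by rewrite (leq_ltn_trans (leq_pred _)).
have [l lE] := adapted_surj ad (existT _ (tag (c' j)) (Ordinal lt1)).
have [oU _ _ _ _] := ch; have [n Uln] := orth_row_neq0 l oU.
have levl : tagged (c' l) = (tagged (c' j)).-1 :> nat by rewrite lE.
have jl : (tagged (c' l) < tagged (c' j))%N by rewrite levl ltn_predL.
have cjl : c j = c l by rewrite -!ad.1 lE.
have := mono _ _ _ _ cjl Ujm Uln jl; apply: leq_trans.
have : (tagged (c' l) <= tagged (c2' n))%N.
  by apply: IH Uln; rewrite levl -ltnS prednK.
by rewrite levl -ltnS prednK.
Qed.

Hypothesis lev_eq : forall j m, U j m != 0 -> tagged (c' j) = tagged (c2' m) :> nat.

Lemma flag_length_le i : (flag_length (W i) <= flag_length (W2 i))%N.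
Proof.
have [->//|p0] := posnP (flag_length (W i)).
have lt1 : ((flag_length (W i)).-1 < flag_length (W i))%N by rewrite ltn_predL.
have [j jE] := adapted_surj ad (existT _ i (Ordinal lt1)).
have [oU _ _ cU _] := ch; have [m Ujm] := orth_row_neq0 j oU.
have := ltn_ord (tagged (c2' m)); rewrite -(lev_eq Ujm).
have -> : tag (c2' m) = i by rewrite ad2.1 -(cU j m) // -ad.1 jE.
by rewrite jE /= prednK.
Qed.

Lemma flag_space_le i k : (flag_space (W2 i) k <= flag_space (W i) k)%VS.
Proof.
apply/subvP => v; rewrite ad.2 ad2.2 => h j cj jk.
have [_ _ _ cU xU] := ch; rewrite xU // /act big1 // => m _.
have [->|Ujm] := eqVneq (U j m) 0; first by rewrite mul0r.
by rewrite h ?mulr0 -?(cU j m) -?(lev_eq Ujm).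
Qed.

End Levels.

Section Cases.
Variables (T : Type) (F : set_system T) (a : J -> T -> R).
Context {FF : ProperFilter F}.
Variables (I : finType) (V : I -> vectType R).
Variables (c : J -> I) (x : forall i, V i -> J -> R).

(** With a trivial second pair the limit has modulus below 1 in the interior, whereas in a stratum
    some pair gives modulus 1 ([stratum_ratio1]). This tells the two constructors apart. *)
Lemma interior_ratio (q : forall i, PE (V i)) :
  flat_cvg F a (Interior q) c x -> forall j l, c j = c l ->
  exists2 k, `|k| < 1 &
    ratio (a j t - a l t) (a l t - a l t) @[t --> F] --> k.
Proof.
move=> [al [h _]] j l jl; exists (ratio (al j - al l) (al l - al l)).
  exact: ratio_lt1.
by apply: cvg_ratio; exact: h.
Qed.

Lemma stratum_ratio (W : forall i, flag (V i)) (c' : J -> quot_index W)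
    (psi : forall i, 'I_(flag_length (W i)) -> R) :
  nontrivial_flags W -> adapted c x c' -> decreasing_velocity psi ->
  exists j l, c j = c l /\
    velocity_at psi (c' j) - velocity_at psi (c' l) != 0.
Proof.
move=> /existsP[i p2] ad dec.
have [j jE] := adapted_surj ad (existT _ i (Ordinal (ltnW p2))).
have [l lE] := adapted_surj ad (existT _ i (Ordinal p2)).
exists j, l; split; first by rewrite -!ad.1 jE lE.
by rewrite subr_eq0 gt_eqF // velocity_ltE // jE lE.
Qed.

Lemma stratum_ratio1 (W : forall i, flag (V i)) nt psi (y : Karp (quot_family W)) :
  flat_cvg F a (Stratum nt psi y) c x -> exists j l, c j = c l /\
  exists2 k, `|k| = 1 &
    ratio (a j t - a l t) (a l t - a l t) @[t --> F] --> k.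
Proof.
move=> [c' [psi0 [s [ps ad soo h _]]]].
have [j [l [jl D0]]] := stratum_ratio nt ad (class_sub ps).
exists j, l; split=> //.
set D := _ - _ in D0; exists (D / (`|D| + `|0 : R|)).
  by rewrite normr0 addr0 normrM normfV normr_id divff // normr_eq0.
apply: (cvg_ratio_rate soo (h _ _ jl)); last by rewrite normr0 addr0 normr_eq0.
by have := h l l erefl; rewrite subrr.
Qed.

End Cases.

(* [S' / S] is the common dilation factor of the two velocities. *)
Let dilation (X Y X' Y' : R) : Y != 0 -> Y' != 0 ->
  X / (`|X| + `|Y|) = X' / (`|X'| + `|Y'|) ->
  Y / (`|Y| + `|X|) = Y' / (`|Y'| + `|X'|) ->
  0 < Y' / Y /\ X' = Y' / Y * X.
Proof.
move=> Y0 Y'0; rewrite ![`|Y| + _]addrC ![`|Y'| + _]addrC.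
have S0 : 0 < `|X| + `|Y| by rewrite ltr_wpDl // normr_gt0.
have S0' : 0 < `|X'| + `|Y'| by rewrite ltr_wpDl // normr_gt0.
set S := `|X| + `|Y| in S0 *; set S' := `|X'| + `|Y'| in S0' *.
move=> hX hY; have Y'E : Y' = S' / S * Y.
  have -> : S' / S * Y = S' * (Y / S) by ring.
  by rewrite hY mulrC divfK // gt_eqF.
have -> : Y' / Y = S' / S by rewrite Y'E mulfK.
split; first exact: divr_gt0.
have -> : S' / S * X = S' * (X / S) by ring.
by rewrite hX mulrC divfK // gt_eqF.
Qed.

Let normsum_neq0 (X Y : R) : Y != 0 -> `|X| + `|Y| != 0.
Proof. by move=> Y0; rewrite gt_eqF // ltr_wpDl // normr_gt0. Qed.

(** The mixed cases are excluded by the modulus of a limit. For two strata, all velocity differences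
    are related by one positive factor [A]; so both sides order the levels alike, which gives equal
    flags, then equivalent velocities, and finally the induction hypothesis on the quotients. *)
Lemma flat_cvg_separates (T T2 : Type) (F : set_system T) (F2 : set_system T2)
    (a : J -> T -> R) (a2 : J -> T2 -> R) (I : finType) (V : I -> vectType R)
    (y y2 : Karp V) U c x c2 x2 :
  ProperFilter F -> ProperFilter F2 -> change U c x c2 x2 ->
  flat_cvg F a y c x -> flat_cvg F2 a2 y2 c2 x2 ->
  (forall j l j' l' m n m' n',
    c j = c l -> c j' = c l' ->
    U j m != 0 -> U l n != 0 -> U j' m' != 0 -> U l' n' != 0 ->
    exists k : R,
    ratio (a j t - a l t) (a j' t - a l' t) @[t --> F] --> k /\
    ratio (a2 m t - a2 n t) (a2 m' t - a2 n' t) @[t --> F2] --> k) -> y = y2.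
Proof.
move=> PF PF2.
elim: y y2 c x c2 x2 => {I V} [I V q|I V W nt psi y IH];
  move=> [q2|W2 nt2 psi2 y2] c x c2 x2 ch L L2 H; have [oU _ _ cU _] := ch.
- move: L L2 => /= [al [h hq]] [al2 [h2 hq2]]; congr Interior.
  apply: functional_extensionality_dep => i.
  have diffE j l m n : c j = c l -> U j m != 0 -> U l n != 0 ->
      al j - al l = al2 m - al2 n.
    move=> jl Ujm Uln; have mn : c2 m = c2 n by rewrite -(cU _ _ Ujm) -(cU _ _ Uln).
    have [k [k1 k2]] := H j l l l m n n n jl erefl Ujm Uln Uln Uln.
    apply: ratio0_inj; rewrite -[X in ratio _ X](subrr (al l)).
    rewrite (eq_limit (cvg_ratio (h _ _ jl) (h l l erefl)) k1).
    rewrite -[X in _ = ratio _ X](subrr (al2 n)).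
    exact: esym (eq_limit (cvg_ratio (h2 _ _ mn) (h2 n n erefl)) k2).
  have [z z0 zE] : exists2 z, 0 < z & forall j m, c j = i -> U j m != 0 ->
      expR (al2 m) = z * expR (al j).
    have [[j0 /eqP cj0]|nj] := pselect (exists j, c j == i); last first.
      exists 1 => // j m cj; by case: nj; exists j; apply/eqP.
    have [m0 Um0] := orth_row_neq0 j0 oU.
    exists (expR (al2 m0 - al j0)); first exact: expR_gt0.
    move=> j m cj Ujm; rewrite -expRD; congr expR.
    have := diffE j j0 m m0; rewrite cj cj0 => /(_ erefl Ujm Um0); lra.
  apply: (class_eq (@proportional_sym R (V i)) (@proportional_trans R (V i))
    (hq i) (hq2 i)).
  by exists z => //; apply/funext => v; rewrite (diagonal_sum ch zE).
- have [m [n [mn [k2 k21 hk2]]]] := stratum_ratio1 L2.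
  have [j Ujm] := orth_col_neq0 m oU; have [l Uln] := orth_col_neq0 n oU.
  have jl : c j = c l by rewrite (cU _ _ Ujm) (cU _ _ Uln).
  have [k k1 hk] := interior_ratio L jl.
  have [k' [h1 h2]] := H _ _ _ _ _ _ _ _ jl erefl Ujm Uln Uln Uln.
  move: k1 k21; rewrite (eq_limit hk h1) (eq_limit hk2 h2) => + k1.
  by rewrite k1 ltxx.
- have [j [l [jl [k k1 hk]]]] := stratum_ratio1 L.
  have [m Ujm] := orth_row_neq0 j oU; have [n Uln] := orth_row_neq0 l oU.
  have mn : c2 m = c2 n by rewrite -(cU _ _ Ujm) -(cU _ _ Uln).
  have [k2 k21 hk2] := interior_ratio L2 mn.
  have [k' [h1 h2]] := H _ _ _ _ _ _ _ _ jl erefl Ujm Uln Uln Uln.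
  move: k21 k1; rewrite (eq_limit hk h1) (eq_limit hk2 h2) => + k1.
  by rewrite k1 ltxx.
move: L L2 => /= [c' [psi0 [s [ps ad soo h L]]]].
move=> [c2' [psi20 [s2 [ps2 ad2 soo2 h2 L2]]]].
pose D j l := velocity_at psi0 (c' j) - velocity_at psi0 (c' l).
pose D2 m n := velocity_at psi20 (c2' m) - velocity_at psi20 (c2' n).
have HD j l j' l' m n m' n' : c j = c l -> c j' = c l' ->
    U j m != 0 -> U l n != 0 -> U j' m' != 0 -> U l' n' != 0 ->
    `|D j l| + `|D j' l'| != 0 -> `|D2 m n| + `|D2 m' n'| != 0 ->
    D j l / (`|D j l| + `|D j' l'|) = D2 m n / (`|D2 m n| + `|D2 m' n'|).
  move=> jl jl' jm ln jm' ln' D0 D20.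
  have mn : c2 m = c2 n by rewrite -(cU _ _ jm) -(cU _ _ ln).
  have mn' : c2 m' = c2 n' by rewrite -(cU _ _ jm') -(cU _ _ ln').
  have [k [k1 k2]] := H _ _ _ _ _ _ _ _ jl jl' jm ln jm' ln'.
  rewrite (eq_limit (cvg_ratio_rate soo (h _ _ jl) (h _ _ jl') D0) k1).
  by rewrite (eq_limit (cvg_ratio_rate soo2 (h2 _ _ mn) (h2 _ _ mn') D20) k2).
have [p [q [pq Dpq]]] := stratum_ratio nt ad (class_sub ps).
rewrite -/(D p q) in Dpq.
have [p2 Up] := orth_row_neq0 p oU; have [q2 Uq] := orth_row_neq0 q oU.
(* Otherwise, compared with a pair whose velocities differ in the second stratum, the reference pair
   would have limit 0 on the second side and a nonzero limit on the first. *)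
have D2pq : D2 p2 q2 != 0.
  apply/negP => /eqP D20.
  have [m [n [mn D2mn]]] := stratum_ratio nt2 ad2 (class_sub ps2).
  rewrite -/(D2 m n) in D2mn.
  have [j Ujm] := orth_col_neq0 m oU; have [l Uln] := orth_col_neq0 n oU.
  have jl : c j = c l by rewrite (cU _ _ Ujm) (cU _ _ Uln).
  have := HD _ _ _ _ _ _ _ _ pq jl Up Uq Ujm Uln.
  have n1 : `|D p q| + `|D j l| != 0 by rewrite gt_eqF // ltr_wpDr // normr_gt0.
  have n2 : `|D2 p2 q2| + `|D2 m n| != 0 by rewrite gt_eqF // ltr_wpDl // normr_gt0.
  move=> /(_ n1 n2); rewrite D20 mul0r => /eqP.
  by rewrite mulf_eq0 invr_eq0 (negPf n1) (negPf Dpq).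
pose A := D2 p2 q2 / D p q.
have DE j l m n : c j = c l -> U j m != 0 -> U l n != 0 ->
    0 < A /\ D2 m n = A * D j l.
  move=> jl Ujm Uln; apply: dilation => //; (apply: HD => //);
    [exact: normsum_neq0|exact: normsum_neq0|rewrite addrC; exact: normsum_neq0|
     rewrite addrC; exact: normsum_neq0].
have A0 : 0 < A by have [] := DE _ _ _ _ pq Up Uq.
have lev_lt j m l n : c j = c l -> U j m != 0 -> U l n != 0 ->
    (tagged (c' l) < tagged (c' j))%N = (tagged (c2' n) < tagged (c2' m))%N.
  move=> jl Ujm Uln; have mn : c2 m = c2 n by rewrite -(cU _ _ Ujm) -(cU _ _ Uln).
  rewrite -(velocity_ltE (class_sub ps)) ?ad.1 //.
  rewrite -(velocity_ltE (class_sub ps2)) ?ad2.1 //.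
  rewrite -subr_lt0 -[RHS]subr_lt0 -/(D j l) -/(D2 m n).
  by have [_ ->] := DE _ _ _ _ jl Ujm Uln; rewrite pmulr_rlt0.
have lev_eq j m : U j m != 0 -> tagged (c' j) = tagged (c2' m) :> nat.
  move=> Ujm; apply/eqP; rewrite eqn_leq (level_le ch ad) //=; last first.
    by move=> j1 m1 l1 n1 jl Uj Ul; rewrite (lev_lt _ _ _ _ jl Uj Ul).
  apply: (level_le (change_sym ch) ad2) => // m1 j1 n1 l1 mn Uj Ul.
  have jl : c j1 = c l1 by rewrite (cU _ _ Uj) (cU _ _ Ul).
  by rewrite (lev_lt _ _ _ _ jl Uj Ul).
have lev_eq' m j : trk U m j != 0 -> tagged (c2' m) = tagged (c' j) :> nat.
  by move=> /lev_eq.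
have WW2 : W = W2.
  apply: functional_extensionality_dep => i; apply: flag_inj.
    apply/eqP; rewrite eqn_leq (flag_length_le ch ad ad2 lev_eq).
    exact: (flag_length_le (change_sym ch) ad2 ad lev_eq').
  move=> k; apply/eqP; rewrite eqEsubv (flag_space_le (change_sym ch) ad2 ad lev_eq').
  exact: (flag_space_le ch ad ad2 lev_eq).
subst W2; rewrite (bool_irrelevance nt2 nt).
have chq := change_quot ch ad ad2.
have c'U := change_blocks ch ad ad2.
have -> : psi = psi2.
  apply: (class_eq (@velocity_sym R _ _) (@velocity_trans R _ _) ps ps2).
  (* The shift of the block [i] is read off at one of its indices. The default 0 concerns empty
     blocks, whose flags have length 0. *)
  pose B i := if [pick j | c j == i] is Some j then
    velocity_at psi20 (c' j) - A * velocity_at psi0 (c' j) else 0.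
  exists A, B; split=> // i k.
  have [j jE] := adapted_surj ad (existT _ i k).
  have ci : c j = i by rewrite -ad.1 jE.
  rewrite /B; case: pickP => [j0 /eqP cj0|/(_ j)]; last by rewrite ci eqxx.
  have [m Ujm] := orth_row_neq0 j oU; have [m0 Ujm0] := orth_row_neq0 j0 oU.
  have jj0 : c j = c j0 by rewrite ci.
  have [_] := DE _ _ _ _ jj0 Ujm Ujm0; rewrite /D2 /D.
  rewrite -(c'U _ _ Ujm) -(c'U _ _ Ujm0) jE /velocity_at /=; lra.
congr Stratum; apply: (IH _ _ _ _ _ chq L L2).
move=> j l j' l' m n m' n' jl jl'; apply: H; rewrite -!ad.1 ?jl ?jl' //.
Qed.

End Separation.

(** * Existence of limits *)

Section Existence.
Variables (R : realType) (J : finType).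

Lemma scalar_lfun (V : vectType R) (f : V -> R) : scalar f ->
  exists h : 'Hom(V, R^o), forall v, h v = f v.
Proof.
move=> fs; pose fL := GRing.isLinear.Build R V R^o _ f fs.
pose g : {linear V -> R^o} := HB.pack f fL.
by exists (linfun g) => v; rewrite lfunE.
Qed.

(** The level of [j] is the rank of [nu j] in decreasing order among the distinct values in its
    block; negation adapts this to an increasing sort. *)
Lemma rank_exists (I : eqType) (c : J -> I) (nu : J -> R) : exists lev : J -> nat,
  (forall j l, c j = c l -> (lev j < lev l)%N = (nu l < nu j)) /\
  (forall j k, (k < lev j)%N -> exists l, c l = c j /\ lev l = k).
Proof.
pose vals i : seq R := sort <=%R (undup [seq - nu l | l <- enum J & c l == i]).
have lt_vals i : sorted <%R (vals i) by rewrite sort_lt_sorted undup_uniq.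
have in_vals i x : reflect (exists2 l, c l = i & x = - nu l) (x \in vals i).
  rewrite mem_sort mem_undup; apply: (iffP mapP) => -[l].
    by rewrite mem_filter => /andP[/eqP cl _] ->; exists l.
  by move=> cl ->; exists l => //; rewrite mem_filter cl eqxx mem_enum.
have mem j : - nu j \in vals (c j) by apply/in_vals; exists j.
exists (fun j => index (- nu j) (vals (c j))); split=> [j l jl|j k kj].
  have meml : - nu l \in vals (c j) by rewrite jl.
  rewrite -jl -[RHS]ltrN2 -[in RHS](nth_index 0 (mem j)) -[in RHS](nth_index 0 meml).
  by rewrite (lt_sorted_ltn_nth 0 (lt_vals (c j))) // inE index_mem.
have kp : (k < size (vals (c j)))%N.
  by apply: leq_trans kj _; exact: index_size.
have /in_vals[l cl lE] := mem_nth 0 kp; exists l; split=> //.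
by rewrite -lE cl index_uniq // lt_sorted_uniq.
Qed.

Section Family.
Variables (I : finType) (V : I -> vectType R).
Variables (c : J -> I) (x : forall i, V i -> J -> R).
Hypothesis cx : coords c x.

Lemma coord_space i (P : pred J) : exists W : {vspace V i},
  forall v, v \in W <-> forall j, c j = i -> P j -> x v j = 0.
Proof.
have [xs _ _] := cx.
have h j : exists h : 'Hom(V i, R^o), c j = i -> forall v, h v = x v j.
  have [cj|cj] := eqVneq (c j) i; last by exists 0 => /eqP; rewrite (negPf cj).
  by have [f fE] := scalar_lfun (xs i j cj); exists f.
have [f fE] := choice h.
exists (\bigcap_(j | (c j == i) && P j) lker (f j))%VS => v.
rewrite memvE; split=> [/subv_bigcapP vW j cj Pj|vW].
  by rewrite -fE //; apply/eqP; rewrite -memv_ker memvE vW // cj eqxx.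
apply/subv_bigcapP => j /andP[/eqP cj Pj].
by rewrite -memvE memv_ker fE // vW.
Qed.

(** The levels in each block form an initial segment, so consecutive spaces differ by a dual vector.
    An empty block gets [p i = 0], the flag of a zero space. *)
Lemma flags_exist (lev : J -> nat) :
  (forall j k, (k < lev j)%N -> exists l, c l = c j /\ lev l = k) ->
  exists (W : forall i, flag (V i)) (c' : J -> quot_index W),
    adapted c x c' /\ forall j, tagged (c' j) = lev j :> nat.
Proof.
move=> lev_init; have [xs x0 xr] := cx.
pose p i := (\max_(j | c j == i) (lev j).+1)%N.
have lev_p j : (lev j < p (c j))%N.
  exact: (@leq_bigmax_cond _ (fun l => c l == c j) (fun l => (lev l).+1)).
have lev_surj i k : (k < p i)%N -> exists l, c l = i /\ lev l = k.
  rewrite ltnNge => /bigmax_leqP nk.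
  have [j [cj jk]] : exists j, c j = i /\ (k <= lev j)%N.
    apply: contrapT => nj; apply: nk => j /eqP cj; rewrite ltnNge.
    by apply/negP => kj; apply: nj; exists j.
  move: jk; rewrite leq_eqVlt => /orP[/eqP ->|/lev_init]; first by exists j.
  by rewrite cj.
have spaces i : exists Wk : nat -> {vspace V i}, forall k v,
    v \in Wk k <-> forall j, c j = i -> (lev j < k)%N -> x v j = 0.
  have [Wk WkE] := choice (fun k => coord_space i (fun j => lev j < k)%N).
  by exists Wk.
have [Wk WkE] : exists Wk : forall i, nat -> {vspace V i}, forall i k v,
    v \in Wk i k <-> forall j, c j = i -> (lev j < k)%N -> x v j = 0.
  exists (fun i => projT1 (cid (spaces i))) => i; exact: projT2 (cid (spaces i)).
pose s i := mkseq (fun k => Wk i k.+1) (p i).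
have nth_s i k : (k <= p i)%N -> nth 0%VS (fullv :: s i) k = Wk i k.
  case: k => [|k] kp /=; last by rewrite nth_mkseq.
  by apply/vspaceP => v; rewrite memvf; apply/esym/WkE.
have Wp i : Wk i (p i) = 0%VS.
  apply/eqP; rewrite -subv0; apply/subvP => v /WkE v0; rewrite memv0.
  by apply/eqP; apply: x0 => j cj; apply: v0; rewrite // -cj.
have sP i : is_flag (s i).
  apply/andP; split; last by rewrite (last_nth 0%VS) size_mkseq nth_s // Wp.
  apply/(pathP 0%VS) => k; rewrite size_mkseq => kp.
  rewrite nth_s ?(ltnW kp) // nth_mkseq //; apply/andP; split.
    by apply/subvP => v /WkE vk; apply/WkE => j cj jk; apply: vk => //; exact: ltnW.
  have [j [cj jk]] := lev_surj i k kp; have [v vE] := coord_dual i j cx.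
  apply/eqP => eqW; have : v \in Wk i k.
    by apply/WkE => l cl lk; rewrite vE //; case: eqP => // lj;
      rewrite lj jk ltnn in lk.
  rewrite -eqW => /WkE/(_ j cj); rewrite jk => /(_ (ltnSn _)).
  by rewrite vE // eqxx => /eqP; rewrite oner_eq0.
pose W i := Flag (sP i).
have lenW i : flag_length (W i) = p i by exact: size_mkseq.
have lev_W j : (lev j < flag_length (W (c j)))%N by rewrite lenW.
exists W, (fun j => existT _ (c j) (Ordinal (lev_W j))); split=> //; split=> //.
move=> i k v; have [kp|pk] := leqP k (p i).
  by rewrite /flag_space nth_s.
rewrite /flag_space nth_default; last by rewrite /= size_mkseq.
rewrite memv0; split=> [/eqP -> j cj _|v0]; first exact: coord0 cx cj.
apply/eqP; apply: x0 => j cj; apply: v0 => //=.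
by apply: leq_trans (ltnW pk); rewrite -cj.
Qed.

End Family.

(** The speed [s] dominates all differences inside blocks. If it stays bounded, the differences
    converge and the limit is interior; otherwise their rates relative to [s] converge and define
    flags and velocities of a stratum. *)
Lemma flat_cvg_exists (T : Type) (F : set_system T) (a : J -> T -> R)
    (I : finType) (V : I -> vectType R) c (x : forall i, V i -> J -> R) :
  UltraFilter F -> coords c x -> exists y : Karp V, flat_cvg F a y c x.
Proof.
move=> UF.
(* The number of pairs with equal labels drops in a stratum, since a nontrivial velocity separates
   at least one such pair. *)
have [N] := ubnP #|[pred jl : J * J | c jl.1 == c jl.2]|.
elim: N I V c x => // N IH I V c x cN cx; have [xs x0 xr] := cx.
pose same (jl : J * J) := c jl.1 == c jl.2.
pose diff (jl : J * J) t := a jl.1 t - a jl.2 t.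
pose s t : R := 1 + \sum_(jl | same jl) `|diff jl t|.
have sum0 t : 0 <= \sum_(jl | same jl) `|diff jl t| by exact: sumr_ge0.
have s0 t : 0 < s t by rewrite ltr_pwDl.
have diff_s j l t : c j = c l -> `|a j t - a l t| <= s t.
  move=> jl; rewrite /s (bigD1 (j, l)) /=; last by rewrite /same /= jl.
  by rewrite addrCA lerDl addr_ge0 // sumr_ge0.
(* Subtracting the value at a chosen representative of the block makes the limits functions of a
   single index. *)
pose rep j := odflt j [pick l | c l == c j].
have rep_c j : c (rep j) = c j by rewrite /rep; case: pickP => //= l /eqP.
have rep_eq j l : c j = c l -> rep j = rep l.
  rewrite /rep => jl; rewrite jl; case: pickP => //= /(_ l); by rewrite eqxx.
have [[M sM]|soo] := bounded_or_cvgy s UF.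
  have cv j : exists l : R, a j t - a (rep j) t @[t --> F] --> l.
    apply: (ultra_bounded_cvg (M := M)).
    by apply: filterS sM => t; apply: le_trans; apply: diff_s; rewrite rep_c.
  have [al alE] := choice cv.
  have pd i : posdef_form (fun v => \sum_(j | c j == i) expR (al j) * x i v j ^+ 2).
    apply: (sumsq_posdef (l := fun j v => x i v j)) => [j /eqP|j _|v v0].
    - exact: xs.
    - exact: expR_gt0.
    - by apply: x0 => j cj; apply: v0; rewrite cj.
  exists (Interior (fun i => class_of _ (pd i))); exists al; split.
    move=> j l jl; rewrite (_ : (fun t => _) =
        (fun t => (a j t - a (rep j) t) - (a l t - a (rep l) t))).
      exact: cvgB.
    by apply/funext => t; rewrite (rep_eq j l) //; ring.
  by move=> i; split=> //; exact: proportional_refl.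
have cv j : exists l : R, (a j t - a (rep j) t) / s t @[t --> F] --> l.
  apply: (ultra_bounded_cvg (M := 1)); apply: nearW => t.
  rewrite normrM normfV (gtr0_norm (s0 t)) ler_pdivrMr // mul1r.
  by apply: diff_s; rewrite rep_c.
have [nu nuE] := choice cv.
have rate j l : c j = c l -> (a j t - a l t) / s t @[t --> F] --> nu j - nu l.
  move=> jl; rewrite (_ : (fun t => _) =
      (fun t => (a j t - a (rep j) t) / s t - (a l t - a (rep l) t) / s t)).
    exact: cvgB.
  by apply/funext => t; rewrite (rep_eq j l) //; ring.
(* The absolute rates at time [t] add up to [1 - 1 / s t]; were [nu] constant on blocks, the limit
   would read 1 = 0. *)
have [j0 [l0 [jl0 nu0]]] : exists j l, c j = c l /\ nu j != nu l.
  apply: contrapT => nj.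
  have h1 : 1 - (s t)^-1 @[t --> F] --> (1 - 0 : R).
    by apply: cvgB; [exact: cvg_cst|apply/gtr0_cvgV0 => //; exact: nearW].
  have h2 : \sum_(jl | same jl) `|diff jl t / s t| @[t --> F] -->
      \sum_(jl | same jl) `|nu jl.1 - nu jl.2|.
    by apply: cvg_fsum => -[j l] /eqP jl; apply: cvg_norm; exact: rate.
  have e : (fun t => 1 - (s t)^-1) =
      (fun t => \sum_(jl | same jl) `|diff jl t / s t|).
    apply/funext => t; under eq_bigr do
      rewrite normrM normfV (gtr0_norm (s0 t)).
    rewrite -mulr_suml (_ : \sum_(jl | _) _ = s t - 1); last first.
      by rewrite /s addrC addKr.
    by rewrite mulrBl mul1r divff // gt_eqF.
  rewrite e in h1; have : (1 - 0 : R) = \sum_(jl | same jl) `|nu jl.1 - nu jl.2|.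
    exact: eq_limit h1 h2.
  have -> : \sum_(jl | same jl) `|nu jl.1 - nu jl.2| = 0.
    apply: big1 => -[j l] /eqP/= jl; have [->|nujl] := eqVneq (nu j) (nu l).
      by rewrite subrr normr0.
    by case: nj; exists j, l.
  by rewrite subr0 => /eqP; rewrite oner_eq0.
have [lev [lev_lt lev_init]] := rank_exists c nu.
have [W [c' [ad c'lev]]] := flags_exist cx lev_init.
have nu_eq j l : c' j = c' l -> nu j = nu l.
  move=> jl; have cjl : c j = c l by rewrite -!ad.1 jl.
  have := lev_lt _ _ cjl; have := lev_lt _ _ (esym cjl).
  by rewrite -!c'lev jl ltnn; case: ltgtP.
have nt : nontrivial_flags W.
  have : lev j0 != lev l0.
    rewrite neq_ltn !lev_lt // orbC; by rewrite neq_lt in nu0.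
  have lenW j : (lev j < flag_length (W (c j)))%N.
    by rewrite -c'lev -ad.1 ltn_ord.
  move=> levN; apply/existsP; exists (c j0).
  have := lenW l0; have := lenW j0; rewrite -jl0; move: levN.
  case: (flag_length _) => [|[|n]] //.
  by rewrite !ltnS !leqn0 => /[swap] /eqP -> /[swap] /eqP ->.
(* By [adapted_surj] every pair [(i, k)] is attained, so the default 0 never occurs. *)
pose psi0 i (k : 'I_(flag_length (W i))) : R :=
  if [pick j | c' j == existT _ i k] is Some j then nu j else 0.
have psi0E j : velocity_at psi0 (c' j) = nu j.
  rewrite /velocity_at /psi0; case: pickP => [l /eqP|/(_ j)].
    by move=> lj; apply: nu_eq; rewrite lj; case: (c' j).
  by case: (c' j) => i k /=; rewrite eqxx.
have dec : decreasing_velocity psi0.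
  move=> i k l kl.
  have [jk jkE] := adapted_surj ad (existT _ i k).
  have [jl jlE] := adapted_surj ad (existT _ i l).
  have := psi0E jk; have := psi0E jl; rewrite jkE jlE /velocity_at /= => -> ->.
  rewrite -lev_lt -?c'lev ?jkE ?jlE //.
  by rewrite -!ad.1 jkE jlE.
have [y Ly] : exists y : Karp (quot_family W), flat_cvg F a y c' (quot_coord x (W := W)).
  apply: IH; last exact: coords_quot cx ad.
  rewrite -ltnS; apply: leq_trans cN; rewrite ltnS.
  apply: proper_card; apply/properP; split.
    apply/fintype.subsetP => -[j l]; rewrite !inE /= => /eqP jl.
    by rewrite -!ad.1 jl.
  exists (j0, l0); rewrite !inE /= ?jl0 //.
  by apply: contraNN nu0 => /eqP/nu_eq ->.
exists (Stratum nt (class_of _ dec) y), c', psi0, s; split=> //.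
- by split=> //; exact: velocity_refl.
- by move=> j l jl; rewrite !psi0E; exact: rate.
Qed.

End Existence.

(** * Orthonormal frames *)

Section Frames.
Variables (R : realType) (J : finType).

Lemma flag_space_anti (V : vectType R) (W : flag V) k :
  (flag_space W k.+1 <= flag_space W k)%VS.
Proof.
have [kp|pk] := ltnP k (size W); last by rewrite /flag_space /= nth_default // sub0v.
have /andP[/(pathP 0%VS)/(_ k kp)/andP[h _] _] := flagP W.
exact: h.
Qed.

Section Family.
Variables (I : finType) (V : I -> vectType R).
Variables (c : J -> I) (x : forall i, V i -> J -> R).
Hypothesis cx : coords c x.

Lemma dual_family : exists e : forall i, J -> V i,
  forall i m l, c l = i -> x (e i m) l = (l == m)%:R.
Proof.
exists (fun i m => projT1 (cid (coord_dual i m cx))) => i m l cl.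
exact: projT2 (cid (coord_dual i m cx)) l cl.
Qed.

Lemma scalar_expand (e : forall i, J -> V i) i (f : V i -> R) v :
  (forall i m l, c l = i -> x (e i m) l = (l == m)%:R) -> scalar f ->
  f v = \sum_(m | c m == i) x v m * f (e i m).
Proof.
move=> eE fs; have [xs x0 _] := cx; have [h hE] := scalar_lfun fs.
have vE : v = \sum_(m | c m == i) x v m *: e i m.
  apply/eqP; rewrite -subr_eq0; apply/eqP; apply: x0 => l cl.
  have [g gE] := scalar_lfun (xs i l cl).
  rewrite -gE linearB /= linear_sum gE (bigD1 l) ?cl //= linearZ /= gE eE //.
  rewrite eqxx big1 => [|m /andP[_ ml]].
    by rewrite addr0 [_ *: _]mulr1 subrr.
  by rewrite linearZ /= gE eE // eq_sym (negPf ml) [_ *: _]mulr0.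
rewrite -hE [in LHS]vE linear_sum; apply: eq_bigr => m _.
by rewrite linearZ /= hE.
Qed.

(** Simultaneous diagonalization of the restrictions of [b] to the coordinate
    subspaces labelled by [ck]. *)
Lemma diagonalize (L : eqType) (ck : J -> L) (b : forall i, V i -> V i -> R) :
  (forall j l, ck j = ck l -> c j = c l) ->
  (forall i v, scalar (fun u => b i u v)) -> (forall i u v, b i u v = b i v u) ->
  exists T d, [/\ orth T, blockwise ck T & forall i k v,
    (forall m, c m = i -> ck m != k -> x v m = 0) ->
    b i v v = \sum_(j | c j == i) d j * act T x v j ^+ 2].
Proof.
move=> ckc bs bsym; have [e eE] := dual_family.
pose S m n := if ck m == ck n then b (c m) (e (c m) m) (e (c m) n) else 0.
have Ssym m n : S m n = S n m.
  rewrite /S [ck n == _]eq_sym; case: eqP => // /ckc ->; exact: bsym.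
have Sblock : blockwise ck S by move=> m n; rewrite /S => /negPf ->.
have [T [d [oT bT ST]]] := blockwise_spectral Ssym Sblock.
exists T, d; split=> // i k v vk.
transitivity (\sum_(m | c m == i) \sum_(n | c n == i)
    x v m * x v n * S m n).
  rewrite (scalar_expand v eE (bs i v)); apply: eq_bigr => m /eqP cm.
  rewrite bsym (scalar_expand v eE (bs i (e i m))) mulr_sumr.
  apply: eq_bigr => n /eqP cn; rewrite mulrA /S.
  have [mk|mk] := eqVneq (ck m) k; last by rewrite vk // !mul0r.
  have [nk|nk] := eqVneq (ck n) k; last by rewrite (vk n) // mulr0 !mul0r.
  by rewrite mk nk eqxx cm bsym.
have bTc j m : T j m != 0 -> c j = c m.
  by move=> Tjm; apply: ckc; exact: blockwise_eq bT Tjm.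
have actE j : \sum_(m | c m == i) T j m * x v m =
    if c j == i then act T x v j else 0.
  case: eqP => cj.
    rewrite /act [RHS](bigID (fun m => c m == i)) /= [X in _ + X]big1 ?addr0 //.
    move=> m cm; have [->|/bTc jm] := eqVneq (T j m) 0; first by rewrite mul0r.
    by rewrite -jm cj eqxx in cm.
  apply: big1 => m /eqP cm; have [->|/bTc jm] := eqVneq (T j m) 0.
    by rewrite mul0r.
  by case: cj; rewrite jm.
transitivity (\sum_j d j * (\sum_(m | c m == i) T j m * x v m) ^+ 2).
  under eq_bigr => m _ do under eq_bigr => n _ do rewrite ST mulr_sumr.
  under eq_bigr do rewrite exchange_big.
  rewrite exchange_big; apply: eq_bigr => j _.
  rewrite expr2 mulr_suml mulr_sumr; apply: eq_bigr => m _.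
  rewrite !mulr_sumr; apply: eq_bigr => n _; ring.
rewrite (bigID (fun j => c j == i)) /= [X in _ + X]big1 ?addr0.
  by apply: eq_bigr => j ji; rewrite actE ji.
by move=> j /negPf ji; rewrite actE ji expr0n mulr0.
Qed.

Lemma act_dual T i j : orth T -> blockwise c T ->
  exists v, forall l, c l = i -> act T x (v : V i) l = (l == j)%:R.
Proof. by move=> oT bT; exact: coord_dual (coords_act oT bT cx). Qed.

Lemma posdef_diagonal (f : forall i, V i -> R) : (forall i, posdef_form (f i)) ->
  exists T b, [/\ orth T, blockwise c T & forall i v,
    f i v = \sum_(j | c j == i) expR (b j) * act T x v j ^+ 2].
Proof.
move=> fpd; pose B i := projT1 (cid (fpd i)).
have [fB fpos] : (forall i v, f i v = B i v v) /\
    forall i v, v != 0 -> 0 < f i v.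
  by split=> i v; have [h1 h2] := projT2 (cid (fpd i)); [exact: h1|exact: h2].
have Bs i v : scalar (fun u => B i u v) by move=> a u w; rewrite linearPl.
have Bsym i u v : B i u v = B i v u.
  by rewrite (hermC (B i)) expr0 mul1r.
have [T [d [oT bT Td]]] := diagonalize (fun j l => id) Bs Bsym.
have fE i v : f i v = \sum_(j | c j == i) d j * act T x v j ^+ 2.
  by rewrite fB; apply: (Td i i) => m ->; rewrite eqxx.
have d0 j : 0 < d j.
  have [v vE] := act_dual (c j) j oT bT.
  have <- : f (c j) v = d j.
    rewrite fE (bigD1 j) //= vE // eqxx expr1n mulr1 big1 ?addr0 //.
    by move=> l /andP[/eqP cl lj]; rewrite vE // (negPf lj) expr0n mulr0.
  apply: fpos; apply/eqP => v0; have := vE j erefl.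
  by rewrite v0 (coord0 (coords_act oT bT cx)) // eqxx => /esym/eqP;
    rewrite oner_eq0.
exists T, (fun j => ln (d j)); split=> // i v; rewrite fE.
by apply: eq_bigr => j _; rewrite lnK // posrE.
Qed.

End Family.

(** The spectral theorem replaces Gram-Schmidt. The nonnegative form [b], the squared length of the
    component removed by a projection onto [W_(k+1)], vanishes exactly on [W_(k+1)]. Once it is
    diagonalized, the coordinates of level [k] with zero eigenvalue are those that move on to level
    [k+1]. *)
Lemma adapted_frame (I : finType) (V : I -> vectType R) c
    (x : forall i, V i -> J -> R) (W : forall i, flag (V i)) : coords c x ->
  exists T (c' : J -> quot_index W),
    [/\ orth T, blockwise c T & adapted c (act T x) c'].
Proof.
move=> cx.
have step k : exists T (lev : J -> nat),
    [/\ orth T, blockwise c T, forall j, (lev j <= k)%N &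
     forall i n v, (n <= k)%N -> v \in flag_space (W i) n <->
       forall j, c j = i -> (lev j < n)%N -> act T x v j = 0].
  elim: k => [|k [T [lev [oT bT lev_k TW]]]].
    exists idk, (fun=> 0%N); split=> //; [exact: orth1|exact: blockwise1|].
    by move=> i n v; rewrite leqn0 => /eqP ->; rewrite memvf.
  have cTx := coords_act oT bT cx; have [Ts T0 _] := cTx.
  pose f i : 'End(V i) := (\1 - projv (flag_space (W i) k.+1))%VF.
  have fE i v : (f i v = 0) <-> v \in flag_space (W i) k.+1.
    rewrite /f add_lfunE opp_lfunE id_lfunE; split.
      by move=> /eqP; rewrite subr_eq0 => /eqP ->; exact: memv_proj.
    by move=> vW; rewrite projv_id // subrr.
  pose b i u v := \sum_(l | c l == i) act T x (f i u) l * act T x (f i v) l.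
  have bs i v : scalar (fun u => b i u v).
    move=> a u w; rewrite /b mulr_sumr -big_split /=; apply: eq_bigr => l /eqP cl.
    by rewrite linearP Ts //; ring.
  have bsym i u v : b i u v = b i v u.
    by apply: eq_bigr => l _; rewrite mulrC.
  have b0 i v : b i v v = 0 <-> v \in flag_space (W i) k.+1.
    rewrite -fE /b; split=> [bv|->].
      apply: T0 => j cj; apply/eqP; rewrite -sqrf_eq0 expr2.
      move/eqP: bv; rewrite psumr_eq0 => [/allP/(_ j (mem_index_enum j))|l _].
        by rewrite cj eqxx.
      by rewrite -expr2 sqr_ge0.
    by apply: big1 => l /eqP cl; rewrite (coord0 cTx cl) mulr0.
  have bge0 i v : 0 <= b i v v.
    by apply: sumr_ge0 => l _; rewrite -expr2 sqr_ge0.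
  (* Rotating only inside the levels reached so far keeps the spaces up to [W_k] adapted. *)
  have [T' [d [oT' bT' T'd]]] := diagonalize cTx (ck := fun j => (c j, lev j))
    (fun j l => @congr1 _ _ fst _ _) bs bsym.
  have bT'c : blockwise c T'.
    by move=> j m jm; apply: bT'; rewrite xpair_eqE (negPf jm).
  have bd i v : (forall m, c m = i -> (lev m < k)%N -> act T x v m = 0) ->
      b i v v = \sum_(j | c j == i) d j * act T' (act T x) v j ^+ 2.
    move=> v0; apply: (T'd i (i, k)) => m cm.
    by rewrite cm xpair_eqE eqxx /= => mk; apply: v0; rewrite // ltn_neqAle mk lev_k.
  have lowE i (v : V i) n : (forall m, c m = i -> (lev m < n)%N -> act T x v m = 0) <->
      (forall m, c m = i -> (lev m < n)%N -> act T' (act T x) v m = 0).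
    have low U (y : forall i, V i -> J -> R) : blockwise (fun j => (c j, lev j)) U ->
        (forall m, c m = i -> (lev m < n)%N -> y i v m = 0) ->
        forall m, c m = i -> (lev m < n)%N -> act U y v m = 0.
      move=> bU y0 m cm mn; rewrite /act big1 // => l _.
      have [->|Uml] := eqVneq (U m l) 0; first by rewrite mul0r.
      by have [ml1 ml2] := blockwise_eq bU Uml; rewrite y0 ?mulr0 -?ml1 -?ml2.
    split; first exact: low.
    move=> h m cm mn; have := low _ _ (blockwise_tr bT') h m cm mn.
    by rewrite -actM oT'.2 act1.
  exists (mulk T' T), (fun j => if (lev j == k) && (d j == 0) then k.+1 else lev j).
  split; [exact: orthM|exact: blockwiseM| |].
    by move=> j; case: ifP => // _; exact: leqW.
  move=> i n v; rewrite actM leq_eqVlt ltnS => /orP[/eqP ->|nk]; last first.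
    rewrite TW // lowE; split=> h m cm mn; apply: h => //.
      move: mn; case: ifP => // _ kn; by have := leq_trans (ltnW kn) nk; rewrite ltnn.
    by case: ifP => // /andP[/eqP mk _]; rewrite mk ltnNge nk in mn.
  split=> [vW|h].
    have vk : v \in flag_space (W i) k by exact: subvP (flag_space_anti _ _) _ vW.
    have low := (TW i k v (leqnn k)).1 vk; have low' := (lowE i v k).1 low.
    have := bd i v low; rewrite (b0 i v).2 // => /esym/eqP.
    (* [d] represents [b] on vectors of [W_k]; the vector dual to a coordinate of level [k] is one
       of them. *)
    have dge0 j : c j = i -> lev j = k -> 0 <= d j.
      move=> cj jk; have [w wE] := act_dual cTx i j oT' bT'c.
      have low_w m : c m = i -> (lev m < k)%N -> act T x w m = 0.
        move: m; apply/lowE => m cm mk; rewrite wE //; case: eqP => // mj.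
        by rewrite mj jk ltnn in mk.
      suff <- : b i w w = d j by exact: bge0.
      rewrite (bd i w low_w) (bigD1 j) /=; last by rewrite cj.
      rewrite wE // eqxx expr1n mulr1 big1 ?addr0 // => l /andP[/eqP cl lj].
      by rewrite wE // (negPf lj) expr0n mulr0.
    rewrite psumr_eq0 => [/allP d0 j cj|j /eqP cj].
      case: ifP => [|/negbT]; first by rewrite ltnn.
      rewrite negb_and => jd _; have := lev_k j; rewrite leq_eqVlt.
      move=> /orP[jk|]; last exact: low'.
      have := d0 j (mem_index_enum j); rewrite cj eqxx /= mulf_eq0 sqrf_eq0.
      by rewrite jk /= in jd; rewrite (negPf jd) => /eqP.
    have := lev_k j; rewrite leq_eqVlt => /orP[/eqP jk|/(low' _ cj) ->].
      by rewrite mulr_ge0 ?sqr_ge0 // dge0.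
    by rewrite expr0n mulr0.
  apply/b0; rewrite bd.
    apply: big1 => j /eqP cj; have [->|dj] := eqVneq (d j) 0; first by rewrite mul0r.
    by rewrite h ?expr0n ?mulr0 // (negPf dj) andbF ltnS.
  apply/lowE => m cm mk; apply: h => //.
  by rewrite (ltn_eqF mk) /= ltnS ltnW.
pose p := (\max_i flag_length (W i))%N.
have [T [lev [oT bT _ TW]]] := step p.
have cTx := coords_act oT bT cx.
have lenp i : (flag_length (W i) <= p)%N by exact: leq_bigmax.
have W0 i k : (flag_length (W i) <= k)%N -> flag_space (W i) k = 0%VS.
  rewrite leq_eqVlt => /orP[/eqP <-|kp]; last by rewrite /flag_space nth_default.
  by rewrite /flag_space /flag_length -last_nth; have /andP[_ /eqP] := flagP (W i).
have lev_lt j : (lev j < flag_length (W (c j)))%N.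
  rewrite ltnNge; apply/negP => levj; have [v vE] := coord_dual (c j) j cTx.
  have : v \in flag_space (W (c j)) (flag_length (W (c j))).
    rewrite TW // => l cl lp; rewrite vE //; case: eqP => // lj.
    by rewrite lj ltnNge levj in lp.
  rewrite W0 // memv0 => /eqP v0; have := vE j erefl.
  by rewrite v0 (coord0 cTx) // eqxx => /esym/eqP; rewrite oner_eq0.
exists T, (fun j => existT _ (c j) (Ordinal (lev_lt j))); split=> //; split=> //.
move=> i k v; have [kp|pk] := leqP k p; first by rewrite TW.
have lk : (flag_length (W i) <= k)%N by apply: leq_trans (lenp i) (ltnW pk).
rewrite W0 // memv0; split=> [/eqP -> j cj _|v0]; first exact: coord0 cTx cj.
apply/eqP; have [_ x0 _] := cTx; apply: x0 => j cj; apply: v0 => //=.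
by apply: leq_trans lk; rewrite -cj.
Qed.

Lemma adapted_act (I : finType) (V : I -> vectType R) c
    (x : forall i, V i -> J -> R) (W : forall i, flag (V i))
    (c' : J -> quot_index W) T : orth T -> blockwise c' T ->
  adapted c x c' -> adapted c (act T x) c'.
Proof.
move=> oT bT ad; split; first exact: ad.1.
move=> i k v; rewrite ad.2.
have low U (y : forall i, V i -> J -> R) : blockwise c' U ->
    (forall m, c m = i -> (tagged (c' m) < k)%N -> y i v m = 0) ->
    forall m, c m = i -> (tagged (c' m) < k)%N -> act U y v m = 0.
  move=> bU y0 m cm mn; rewrite /act big1 // => l _.
  have [->|Uml] := eqVneq (U m l) 0; first by rewrite mul0r.
  by have ml := blockwise_eq bU Uml; rewrite y0 ?mulr0 -?ad.1 -?ml // ad.1.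
split; first exact: low.
move=> h m cm mn; have := low _ _ (blockwise_tr bT) h m cm mn.
by rewrite -actM oT.2 act1.
Qed.

(** Supplies the speed of a stratum: it outgrows everything that happens inside the blocks by a
    factor [r] tending to infinity. *)
Lemma dominated (T : Type) (F : set_system T) (a : J -> T -> R) (r s : T -> R) :
  Filter F -> r @ F --> +oo ->
  (\forall t \near F, r t * (1 + \sum_j `|a j t|) <= s t) ->
  s @ F --> +oo /\ forall j, a j t / s t @[t --> F] --> 0.
Proof.
move=> FF roo rs.
have r0 : \forall t \near F, 0 < r t by move/cvgryPgt: roo; exact.
have sum0 t : 0 <= \sum_j `|a j t| by exact: sumr_ge0.
have rle : \forall t \near F, r t <= s t.
  near=> t; have rt : 0 < r t by near: t.
  apply: (@le_trans _ _ (r t * (1 + \sum_j `|a j t|))); last by near: t.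
  by rewrite ler_pMr // lerDl.
have soo : s @ F --> +oo.
  apply/cvgryPgt => M; near=> t; apply: (@lt_le_trans _ _ (r t)).
    by near: t; move/cvgryPgt: roo; exact.
  by near: t.
split=> // j; have rV : (r t)^-1 @[t --> F] --> (0 : R) by apply/gtr0_cvgV0.
apply/norm_cvg0P; apply: (squeeze_cvgr _ (cvg_cst 0) rV).
near=> t; have rt : 0 < r t by near: t.
have st : 0 < s t by apply: lt_le_trans rt _; near: t.
rewrite normr_ge0 /= normrM normfV (gtr0_norm st) ler_pdivrMr //.
rewrite mulrC ler_pdivlMr //.
apply: (@le_trans _ _ (r t * (1 + \sum_j `|a j t|))); last by near: t.
rewrite mulrC ler_pM2l // (bigD1 j) //= addrCA lerDl.
by rewrite addr_ge0 // sumr_ge0.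
Unshelve. all: by end_near. Qed.

(** The term [s t * psi0] fixes the rates, to which [a] contributes nothing; inside a block it
    cancels and leaves the family [a] of the recursive level. *)
Lemma flat_cvg_stratum (T : Type) (F : set_system T) (a : J -> T -> R)
    (s : T -> R) (I : finType) (V : I -> vectType R) c
    (x : forall i, V i -> J -> R) (W : forall i, flag (V i)) nt psi psi0
    (y : Karp (quot_family W)) (c' : J -> quot_index W) : Filter F ->
  sval psi psi0 -> adapted c x c' -> s @ F --> +oo ->
  (forall j, a j t / s t @[t --> F] --> 0) ->
  flat_cvg F a y c' (quot_coord x (W := W)) ->
  flat_cvg F (fun j t => s t * velocity_at psi0 (c' j) + a j t)
    (Stratum nt psi y) c x.
Proof.
move=> FF ps ad soo as0 L; exists c', psi0, s; split=> //; last first.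
  by apply: flat_cvg_ext L => j l jl t; rewrite jl; ring.
move=> j l _; have s0 : \forall t \near F, 0 < s t by move/cvgryPgt: soo; exact.
set D := velocity_at psi0 (c' j) - velocity_at psi0 (c' l).
have h : D + (a j t / s t - a l t / s t) @[t --> F] --> D + (0 - 0).
  by apply: cvgD; [exact: cvg_cst|exact: cvgB].
rewrite subr0 addr0 in h; apply: cvg_trans h; apply: near_eq_cvg.
near=> t; have st : s t != 0 by rewrite gt_eqF //; near: t.
by rewrite /D; field.
Unshelve. all: by end_near. Qed.

(** An interior point is a constant family in a diagonalizing frame. For a stratum, the frame is
    first adapted to the flags, then rotated inside the blocks to represent the inner point, and the
    blocks are driven apart at a dominating speed. *)
Lemma flat_cvg_represents (I : finType) (V : I -> vectType R) (y : Karp V) c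
    (x : forall i, V i -> J -> R) : coords c x ->
  exists T (a : J -> nat -> R),
    [/\ orth T, blockwise c T & flat_cvg \oo a y c (act T x)].
Proof.
elim: y c x => {I V} [I V q|I V W nt psi y IH] c x cx.
  have fE i : exists f, posdef_form f /\ sval (q i) f.
    by have [f pf qf] := class_inhabited (q i) (@proportional_refl R (V i)); exists f.
  pose f i := projT1 (cid (fE i)).
  have fP i : posdef_form (f i) by exact: (projT2 (cid (fE i))).1.
  have fq i : sval (q i) (f i) by exact: (projT2 (cid (fE i))).2.
  have [T [b [oT bT fT]]] := posdef_diagonal cx fP.
  exists T, (fun j _ => b j); split=> //; exists b; split.
    by move=> j l _; exact: cvg_cst.
  by move=> i; rewrite -(_ : f i = (fun v => _)) //; apply/funext => v; rewrite fT.
have [T1 [c' [oT1 bT1 ad]]] := adapted_frame W cx.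
have cT1x := coords_act oT1 bT1 cx.
have [T2 [a [oT2 bT2 L]]] := IH c' _ (coords_quot cT1x ad).
have bT2c : blockwise c T2.
  by move=> j m; rewrite -!ad.1 => jm; apply: bT2; apply: contraNneq jm => ->.
have [psi0 _ ps] := class_inhabited psi (@velocity_refl R _ _).
pose s (n : nat) : R := n%:R * (1 + \sum_j `|a j n|).
have [soo as0] := @dominated _ \oo a (fun n => n%:R) s _ (@cvgr_idn R)
  (nearW _ (fun n => lexx _)).
exists (mulk T2 T1), (fun j n => s n * velocity_at psi0 (c' j) + a j n).
split; [exact: orthM|exact: blockwiseM|rewrite actM].
apply: flat_cvg_stratum => //; exact: adapted_act.
Qed.

End Frames.

(** * Limits of geodesics *)

Section Geodesics.
Variable R : realType.

(** An upward closed property holds on an initial segment of a decreasing list. This turns the index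
    cuts [el_cut] into conditions on exponents. *)
Lemma sorted_count (s : seq R) (P : pred R) :
  sorted >=%R s -> (forall u w, w <= u -> P w -> P u) ->
  forall j, (j < size s)%N -> (j < count P s)%N = P (nth 0 s j).
Proof.
move=> ss Pup; elim: s ss => //= u s IH us [|j] js /=.
  case Pu: (P u) => //=; rewrite add0n lt0n; apply/negbTE; rewrite negbK.
  rewrite -leqn0 leqNgt -has_count; apply/hasPn => w ws; apply: contraFN Pu.
  apply: Pup; have /allP := order_path_min (rev_trans (@le_trans _ R)) us; exact.
case Pu: (P u) => /=; first by rewrite add1n ltnS IH // (path_sorted us).
rewrite add0n.
have nP w : w \in s -> ~~ P w.
  move=> ws; apply: contraFN Pu; apply: Pup.
  have /allP := order_path_min (rev_trans (@le_trans _ R)) us; exact.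
rewrite (negPf (nP _ (mem_nth 0 js))).
suff -> : count P s = 0%N by [].
by apply/eqP; rewrite -leqn0 leqNgt -has_count; apply/hasPn.
Qed.

Section ExpLine.
Variables (V : vectType R) (g : exp_line V).
Local Notation n := (\dim {:V}).

Definition el_level (j : 'I_n) : nat := index (tnth (el_exp g) j) (el_values g).

Lemma el_level_lt j : (el_level j < size (el_values g))%N.
Proof. by rewrite index_mem mem_undup mem_tnth. Qed.

Lemma el_velocity_level j : el_velocity g (el_level j) = tnth (el_exp g) j.
Proof. by rewrite /el_velocity nth_index // mem_undup mem_tnth. Qed.

Lemma el_cut_count k : (k <= size (el_values g))%N ->
  el_cut g k = count (fun u => index u (el_values g) < k)%N (el_exp g).
Proof.
elim: k => [|k IH] kp.
  rewrite /el_cut big_ord0; apply/esym/eqP; rewrite -leqn0 leqNgt -has_count.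
  by rewrite -all_predC; apply/allP.
have -> : el_cut g k.+1 = (el_cut g k + count_mem (el_velocity g k) (el_exp g))%N.
  by rewrite /el_cut big_ord_recr.
rewrite IH ?(ltnW kp) // -count_predUI.
rewrite [X in (_ + X)%N](_ : _ = 0%N) ?addn0; last first.
  apply/eqP; rewrite -leqn0 leqNgt -has_count; apply/hasPn => u _ /=.
  apply/negP => /andP[uk /eqP uE]; move: uk; rewrite uE index_uniq ?undup_uniq //.
  by rewrite ltnn.
apply: eq_in_count => u us /=; rewrite [RHS]ltnS [RHS]leq_eqVlt [RHS]orbC; congr (_ || _).
apply/eqP/eqP => [->|<-]; first by rewrite index_uniq ?undup_uniq.
by rewrite /el_velocity nth_index // mem_undup.
Qed.

Lemma el_cut_level k (j : 'I_n) : (k <= size (el_values g))%N ->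
  (j < el_cut g k)%N = (el_level j < k)%N.
Proof.
move=> kp; rewrite el_cut_count // /el_level (tnth_nth 0).
have [kn|] := boolP (k == 0)%N.
  by rewrite (eqP kn) (eq_count (a2 := pred0)) ?count_pred0.
rewrite -lt0n => k0; pose P u := (el_velocity g k.-1 <= u)%R.
have lk : (k.-1 < size (el_values g))%N by rewrite prednK.
have E u : u \in (el_exp g : seq R) -> (index u (el_values g) < k)%N = P u.
  move=> us; have ui : u = el_velocity g (index u (el_values g)).
    by rewrite /el_velocity nth_index // mem_undup.
  have ip : (index u (el_values g) < size (el_values g))%N.
    by rewrite index_mem mem_undup.
  rewrite /P [in RHS]ui; apply/idP/idP => [ik|].
    have : (index u (el_values g) <= k.-1)%N by rewrite -ltnS prednK.
    rewrite leq_eqVlt => /orP[/eqP ->//|h]; apply/ltW/el_velocity_decr.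
    by rewrite h.
  apply: contraTT; rewrite -leqNgt -ltNge => ki; apply: el_velocity_decr.
  by rewrite ip andbT (leq_trans _ ki) // prednK.
rewrite E ?mem_nth ?size_tuple // (eq_in_count E) sorted_count ?size_tuple //.
  exact: el_sorted.
by move=> u w wu /le_trans; exact.
Qed.

Lemma mem_el_space_level k v : (k <= size (el_values g))%N ->
  v \in el_space g k <-> forall j, (el_level j < k)%N -> el_coord g j v = 0.
Proof.
by move=> kp; split=> [/mem_el_space h j|h]; [rewrite -el_cut_level //; exact: h|
  apply/mem_el_space => j; rewrite el_cut_level //; exact: h].
Qed.

Lemma el_velocity_lt (j : 'I_n) k : (k < size (el_values g))%N ->
  (el_level j < k)%N = (el_velocity g k < tnth (el_exp g) j).
Proof.
move=> kp; rewrite -el_velocity_level; apply/idP/idP => [jk|].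
  by apply: el_velocity_decr; rewrite jk.
apply: contraTT; rewrite -leqNgt -leNgt leq_eqVlt => /orP[/eqP ->//|kj].
by apply/ltW/el_velocity_decr; rewrite kj el_level_lt.
Qed.

Lemma el_dual : exists f : 'I_n -> V, forall j l,
  el_coord g l (f j) = (l == j)%:R.
Proof.
have [f fE] := choice (fun j => el_coord_surj g (fun l => (l == j)%:R)).
by exists f.
Qed.

End ExpLine.

Lemma cvgy_affine (T : Type) (F : set_system T) (f h : T -> R) (r l : R) :
  Filter F -> 0 < r -> f @ F --> +oo -> h @ F --> l ->
  r * f t + h t @[t --> F] --> +oo.
Proof.
move=> FF r0 foo hl; apply/cvgryPgt => M.
have hb : \forall t \near F, l - 1 <= h t.
  by apply: (cvgr_ge l) => //; rewrite ltrBlDr ltrDl.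
have fb : \forall t \near F, (M - l + 1) / r < f t by move/cvgryPgt: foo; exact.
near=> t; have h1 : l - 1 <= h t by near: t.
have : (M - l + 1) / r < f t by near: t.
by rewrite ltr_pdivrMr // mulrC => h2; lra.
Unshelve. all: by end_near. Qed.

Lemma cvg_expNy (T : Type) (F : set_system T) (f : T -> R) :
  f @ F --> +oo -> expR (- f t) @[t --> F] --> 0.
Proof. by move=> foo; exact: (cvg_comp _ _ foo (@cvgr_expR R)). Qed.

Variable J : finType.

Section Limit.
Variables (I : finType) (V : I -> vectType R) (g : geodesic V).
Variables (c : J -> I) (x : forall i, V i -> J -> R).
Hypothesis cx : coords c x.
Variables (U : Type) (F : set_system U) (tau : U -> R).
Hypotheses (UF : UltraFilter F) (tauoo : tau @ F --> +oo).
Variables (T : U -> J -> J -> R) (b : J -> U -> R) (T0 : J -> J -> R).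
Hypotheses (oT : forall t, orth (T t)) (bT : forall t, blockwise c (T t)).
Hypothesis TT0 : forall j m, T t j m @[t --> F] --> T0 j m.
Hypothesis formE : forall t i v,
  el_curve_form (geo_line g i) (tau t) v =
  \sum_(j | c j == i) expR (b j t) * act (T t) x v j ^+ 2.

Let oT0 : orth T0. Proof. exact: orth_limit oT TT0. Qed.
Let bT0 : blockwise c T0. Proof. exact: blockwise_limit bT TT0. Qed.
Let cx0 : coords c (act T0 x). Proof. exact: coords_act. Qed.

Local Notation n i := (\dim {:V i}).
Local Notation ell i := (el_coord (geo_line g i)).
Local Notation phi i j := (tnth (el_exp (geo_line g i)) j).
Local Notation lev i := (@el_level (V i) (geo_line g i)).
Local Notation vel i := (el_velocity (geo_line g i)).
Local Notation len i := (size (el_values (geo_line g i))).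

(** Transition matrices between the coordinates [ell] of the geodesic and the
    orthonormal coordinates that diagonalize it at time [t]; the exponential
    factors relate each matrix to the transpose of its inverse. *)
Let transition : exists (A : forall i, 'I_(n i) -> J -> U -> R)
    (B : forall i, J -> 'I_(n i) -> U -> R)
    (A0 : forall i, 'I_(n i) -> J -> R) (B0 : forall i, J -> 'I_(n i) -> R),
  [/\ forall i j m, A i j m t @[t --> F] --> A0 i j m,
      forall i m j, B i m j t @[t --> F] --> B0 i m j,
      forall i j v, ell i j v = \sum_(m | c m == i) A0 i j m * act T0 x v m,
      forall i m v, c m = i -> act T0 x v m = \sum_j B0 i m j * ell i j v
    & forall i j m t, c m = i ->
        expR (phi i j * tau t) * A i j m t = expR (b m t) * B i m j t].
Proof.
have [e eE] := dual_family cx.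
have fex i : exists f : 'I_(n i) -> V i,
    forall j l, ell i l (f j) = (l == j)%:R by exact: el_dual.
pose f i := projT1 (cid (fex i)).
have fE i j l : ell i l (f i j) = (l == j)%:R by exact: projT2 (cid (fex i)) j l.
pose et (S : J -> J -> R) i (m : J) := \sum_l S m l *: e i l : V i.
have etE S i m l : orth S -> blockwise c S -> c l = i ->
    act S x (et S i m) l = (l == m)%:R.
  move=> oS bS cl; have [xs _ _] := coords_act oS bS cx.
  have [h hE] := scalar_lfun (xs i l cl); rewrite -hE linear_sum /=.
  under eq_bigr => k _ do rewrite linearZ /= hE [_ *: _]/(_ * _).
  rewrite eq_sym -(orth_row _ _ oS); apply: eq_bigr => k _; congr (_ * _).
  rewrite /act (bigD1 k) //= big1 ?addr0.
    have [->|Slk] := eqVneq (S l k) 0; first by rewrite mul0r.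
    by rewrite eE ?eqxx ?mulr1 // -(blockwise_eq bS Slk).
  move=> p pk; have [->|Slp] := eqVneq (S l p) 0; first by rewrite mul0r.
  by rewrite eE ?(negPf pk) ?mulr0 // -(blockwise_eq bS Slp).
have ellE S i j m : ell i j (et S i m) = \sum_l S m l * ell i j (e i l).
  have [h hE] := scalar_lfun (el_coord_scalar (geo_line g i) j).
  by rewrite -hE linear_sum /=; apply: eq_bigr => l _; rewrite linearZ /= hE.
exists (fun i j m t => ell i j (et (T t) i m)), (fun i m j t => act (T t) x (f i j) m).
exists (fun i j m => ell i j (et T0 i m)), (fun i m j => act T0 x (f i j) m); split.
- move=> i j m; rewrite ellE; under eq_fun do rewrite ellE.
  by apply: cvg_fsum => l _; apply: cvgM; [exact: TT0|exact: cvg_cst].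
- by move=> i m j; apply: cvg_fsum => l _; apply: cvgM; [exact: TT0|exact: cvg_cst].
- move=> i j v; have etE0 i' m l : c l = i' -> act T0 x (et T0 i' m) l = (l == m)%:R.
    exact: etE.
  rewrite (scalar_expand cx0 v etE0 (el_coord_scalar _ j)).
  by apply: eq_bigr => m _; rewrite mulrC.
- move=> i m v cm; have [xs _ _] := cx0.
  have [h hE] := scalar_lfun (xs i m cm).
  have vE : v = \sum_j ell i j v *: f i j.
    apply/eqP; rewrite -subr_eq0; apply/eqP.
    apply: (el_coord_sep (g := geo_line g i)) => l.
    have [k kE] := scalar_lfun (el_coord_scalar (geo_line g i) l).
    rewrite -kE linearB /= linear_sum kE (bigD1 l) //= linearZ /= kE fE.
    rewrite eqxx big1 => [|j jl]; first by rewrite addr0 [_ *: _]mulr1 subrr.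
    by rewrite linearZ /= kE fE eq_sym (negPf jl) [_ *: _]mulr0.
  rewrite -hE [in LHS]vE linear_sum; apply: eq_bigr => j _.
  by rewrite linearZ /= hE mulrC.
move=> i j m t cm; have [xs _ _] := coords_act (oT t) (bT t) cx.
have := @polarization R (V i) 'I_(n i) J xpredT (fun l => c l == i)
  (fun v l => ell i l v) (act (T t) x (i := i))
  (fun l => expR (phi i l * tau t)) (fun l => expR (b l t)) _ _ (fun v => formE t v)
  (et (T t) i m) (f i j).
rewrite (bigD1 j) //= fE eqxx mulr1 big1 ?addr0; last first.
  by move=> l lj; rewrite fE (negPf lj) !mulr0.
rewrite (bigD1 m) ?cm //= etE // eqxx mul1r big1 ?addr0.
  by apply=> [l _|l /eqP]; [exact: el_coord_scalar|exact: xs].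
by move=> l /andP[/eqP cl lm]; rewrite etE // (negPf lm) mul0r mulr0.
Qed.

(** Triangularity of the limits [A0] and [B0] describes each [W_p] by the coordinates [act T0 x] as
    well as by the [ell]. On equal levels the exponential factors converge, which identifies the
    induced form on each quotient. *)
Lemma geodesic_flat_cvg : flat_cvg F b (geo_limit g) c (act T0 x).
Proof.
have [A [B [A0 [B0 [AA0 BB0 ellA xB AB]]]]] := transition.
have [xs x0 xr] := cx0.
(* The product of the two limit matrices is the identity, so that each [b m]
   stays at bounded distance from some exponent of the geodesic. *)
have near_exp m : exists (k : nat) (beta : R), (k < len (c m))%N /\
    b m t - vel (c m) k * tau t @[t --> F] --> beta.
  have [v vE] := coord_dual (c m) m cx0.
  have [j [Aj Bj]] : exists j, A0 (c m) j m != 0 /\ B0 (c m) m j != 0.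
    apply: contrapT => nj; have := xB _ m v erefl; rewrite vE // eqxx big1.
      by move/eqP; rewrite oner_eq0.
    move=> j _; have -> : ell (c m) j v = A0 (c m) j m.
      rewrite ellA (bigD1 m) //= vE // eqxx mulr1 big1 ?addr0 //.
      by move=> l /andP[/eqP cl lm]; rewrite vE // (negPf lm) mulr0.
    have [->|B1] := eqVneq (B0 (c m) m j) 0; first by rewrite mul0r.
    have [->|A1] := eqVneq (A0 (c m) j m) 0; first by rewrite mulr0.
    by case: nj; exists j.
  have quo : A (c m) j m t / B (c m) m j t @[t --> F] --> A0 (c m) j m / B0 (c m) m j.
    by apply: cvgM => //; exact: cvgV.
  have Bt : \forall t \near F, B (c m) m j t != 0.
    exact: cvgr_neq0 (BB0 _ _ _) Bj.
  have quoE : \forall t \near F, expR (b m t - phi (c m) j * tau t) =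
      A (c m) j m t / B (c m) m j t.
    near=> t; have Bt1 : B (c m) m j t != 0 by near: t.
    rewrite expRD expRN; apply: (canRL (mulfK Bt1)).
    by rewrite mulrAC -AB // mulrC mulKf // gt_eqF ?expR_gt0.
  have quo0 : 0 < A0 (c m) j m / B0 (c m) m j.
    rewrite lt_def mulf_neq0 ?invr_eq0 //=.
    apply: (ler_limit (cvg_cst 0) quo); near=> t.
    have <- : expR (b m t - phi (c m) j * tau t) = A (c m) j m t / B (c m) m j t.
      by near: t.
    exact: expR_ge0.
  exists (lev (c m) j), (ln (A0 (c m) j m / B0 (c m) m j)).
  split; first exact: el_level_lt.
  have h : ln (A (c m) j m t / B (c m) m j t) @[t --> F] -->
      (ln (A0 (c m) j m / B0 (c m) m j) : R).
    by apply: (continuous_cvg _ (continuous_ln quo0)).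
  apply: cvg_trans h; apply: near_eq_cvg; near=> t.
  rewrite el_velocity_level.
  have <- : expR (b m t - phi (c m) j * tau t) = A (c m) j m t / B (c m) m j t.
    by near: t.
  by rewrite expRK.
have [k kP] := choice near_exp; have [beta betaP] := choice kP.
have betaE i m : c m = i -> b m t - vel i (k m) * tau t @[t --> F] --> beta m.
  by move=> <-; exact: (betaP m).2.
have k_lt i m : c m = i -> (k m < len i)%N by move=> <-; exact: (betaP m).1.
(* Here [A = e^(b_m - phi_j tau) B]; for [phi_j] above the growth rate of [b_m] the exponent tends
   to -oo while [B] converges. [B0_lev] is the mirror argument. *)
have A0_lev i j m : c m = i -> A0 i j m != 0 -> (k m <= lev i j)%N.
  move=> cm; apply: contraNT; rewrite -ltnNge (el_velocity_lt _ (k_lt _ _ cm)) => lt.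
  have e0 : expR (- ((phi i j - vel i (k m)) * tau t +
      - (b m t - vel i (k m) * tau t))) @[t --> F] --> 0.
    apply: cvg_expNy; apply: (cvgy_affine (l := - beta m)) => //.
      by rewrite subr_gt0.
    by apply: cvgN; exact: betaE.
  have h : expR (- ((phi i j - vel i (k m)) * tau t +
      - (b m t - vel i (k m) * tau t))) * B i m j t @[t --> F] --> 0 * B0 i m j.
    by apply: cvgM.
  rewrite mul0r in h; apply/eqP; apply: eq_limit (AA0 i j m) _.
  rewrite (_ : A i j m = fun t => expR (- ((phi i j - vel i (k m)) * tau t +
      - (b m t - vel i (k m) * tau t))) * B i m j t) //.
  apply/funext => t; apply: (mulfI (x := expR (phi i j * tau t))).
    by rewrite gt_eqF ?expR_gt0.
  rewrite AB // mulrA -expRD; congr (expR _ * _); ring.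
have B0_lev i j m : c m = i -> B0 i m j != 0 -> (lev i j <= k m)%N.
  move=> cm; apply: contraNT; rewrite -ltnNge => lt.
  have {}lt : phi i j < vel i (k m).
    by rewrite -el_velocity_level; apply: el_velocity_decr; rewrite lt el_level_lt.
  have e0 : expR (- ((vel i (k m) - phi i j) * tau t +
      (b m t - vel i (k m) * tau t))) @[t --> F] --> 0.
    apply: cvg_expNy; apply: (cvgy_affine (l := beta m)) => //.
      by rewrite subr_gt0.
    exact: betaE.
  have h : expR (- ((vel i (k m) - phi i j) * tau t +
      (b m t - vel i (k m) * tau t))) * A i j m t @[t --> F] --> 0 * A0 i j m.
    by apply: cvgM.
  rewrite mul0r in h; apply/eqP; apply: eq_limit (BB0 i m j) _.
  rewrite (_ : B i m j = fun t => expR (- ((vel i (k m) - phi i j) * tau t +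
      (b m t - vel i (k m) * tau t))) * A i j m t) //.
  apply/funext => t; apply: (mulfI (x := expR (b m t))).
    by rewrite gt_eqF ?expR_gt0.
  rewrite -AB // mulrA -expRD; congr (expR _ * _); ring.
(* On equal levels the linear growth cancels and only the bounded part of [b_m] survives. *)
have AB0 i j m : c m = i -> lev i j = k m -> A0 i j m = expR (beta m) * B0 i m j.
  move=> cm jm; have h : expR (b m t - vel i (k m) * tau t) * B i m j t @[t --> F] -->
      expR (beta m) * B0 i m j.
    apply: cvgM => //; apply: (continuous_cvg _ (@continuous_expR R _)); exact: betaE.
  apply: eq_limit (AA0 i j m) _.
  rewrite (_ : A i j m = fun t => expR (b m t - vel i (k m) * tau t) * B i m j t) //.
  apply/funext => t; apply: (mulfI (x := expR (phi i j * tau t))).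
    by rewrite gt_eqF ?expR_gt0.
  rewrite AB // mulrA -expRD -jm el_velocity_level; congr (expR _ * _); ring.
have spaceE i p v : (p <= len i)%N -> v \in flag_space (geo_flags g i) p <->
    forall m, c m = i -> (k m < p)%N -> act T0 x v m = 0.
  move=> pl; rewrite el_flag_space ?el_flag_length // mem_el_space_level //.
  split=> h.
    move=> m cm mp; rewrite (xB i) // big1 // => j _.
    have [->|/(B0_lev _ _ _ cm) jm] := eqVneq (B0 i m j) 0; first by rewrite mul0r.
    by rewrite h ?mulr0 // (leq_ltn_trans jm).
  move=> j jp; rewrite ellA big1 // => m /eqP cm.
  have [->|/(A0_lev _ _ _ cm) jm] := eqVneq (A0 i j m) 0; first by rewrite mul0r.
  by rewrite h ?mulr0 // (leq_ltn_trans jm).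
have k_flag m : (k m < flag_length (geo_flags g (c m)))%N.
  by rewrite el_flag_length k_lt.
pose c' m : quot_index (geo_flags g) := existT _ (c m) (Ordinal (k_flag m)).
have ad : adapted c (act T0 x) c'.
  split=> // i p v; have [pl|lp] := leqP p (len i); first exact: spaceE.
  rewrite /flag_space nth_default; last by rewrite /= size_mkseq.
  rewrite memv0; split=> [/eqP -> j cj _|v0]; first exact: coord0 cx0 cj.
  by apply/eqP; apply: x0 => j cj; apply: v0 => //=; apply: ltn_trans lp; exact: k_lt.
exists c', (fun i (p : 'I_(flag_length (geo_flags g i))) => vel i p), tau; split=> //.
- by split; [exact: geo_velocity_decr|exact: velocity_refl].
- move=> j l jl; rewrite /velocity_at /=.
  have rate m : b m t / tau t @[t --> F] --> vel (c m) (k m).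
    have tau0 : \forall t \near F, 0 < tau t by move/cvgryPgt: tauoo; exact.
    have h : vel (c m) (k m) + (b m t - vel (c m) (k m) * tau t) * (tau t)^-1
        @[t --> F] --> vel (c m) (k m) + beta m * 0.
      apply: cvgD; first exact: cvg_cst.
      by apply: cvgM; [exact: betaE|apply/gtr0_cvgV0].
    rewrite mulr0 addr0 in h; apply: cvg_trans h; apply: near_eq_cvg.
    near=> t; have t0 : tau t != 0 by rewrite gt_eqF //; near: t.
    by field.
  by under eq_fun do rewrite mulrBl; apply: cvgB; exact: rate.
exists beta; split=> [j l jl|u].
  have cjl : c j = c l by rewrite -[c j]/(tag (c' j)) jl.
  have kjl : k j = k l by rewrite -[k j]/(nat_of_ord (tagged (c' j))) jl.
  rewrite (_ : (fun t => _) = (fun t => (b j t - vel (c j) (k j) * tau t) -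
      (b l t - vel (c l) (k l) * tau t))).
    by apply: cvgB; exact: betaE.
  by apply/funext => t; rewrite cjl kjl; ring.
pose q (z : quot_family (geo_flags g) u) : R :=
  \sum_(m | c' m == u) expR (beta m) * quot_coord (act T0 x) z m ^+ 2.
suff qE : @el_quot_form _ _ (geo_line g (tag u)) (tagged u) = q.
  rewrite -/q -qE; split; [exact: el_quot_posdef|exact: proportional_refl].
apply/funext => z; rewrite /q /el_quot_form /quot_coord {q}.
set i := tag u; set p := tagged u; set v := subquot_repr _.
have pl : (p < len i)%N by rewrite -el_flag_length ltn_ord.
have vW : v \in flag_space (geo_flags g i) p by exact: subquot_repr_mem.
have v0 := (spaceE i p v (ltnW pl)).1 vW.
have ell0 j : (lev i j < p)%N -> ell i j v = 0.
  move: j; apply/(mem_el_space_level _ (ltnW pl)).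
  by rewrite -el_flag_space ?el_flag_length // ltnW.
have c'u m : (c' m == u) = (c m == i) && (k m == p :> nat).
  apply/eqP/andP => [mu|[/eqP cm /eqP km]]; last exact: quot_index_eq.
  by rewrite -[c m]/(tag (c' m)) -[k m]/(nat_of_ord (tagged (c' m))) mu.
(* Expanding one factor of each square, by [A0] on the left and by [B0] on the right, gives the same
   double sum. Terms from other levels vanish by triangularity on one side of [p] and by [v \in W_p]
   on the other. *)
transitivity (\sum_(m | c' m == u) \sum_(j | lev i j == p)
    expR (beta m) * B0 i m j * act T0 x v m * ell i j v).
  rewrite exchange_big /=; apply: eq_big => [j|j].
    by rewrite leqNgt !el_cut_level ?(ltnW pl) // -leqNgt ltnS eqn_leq andbC.
  rewrite leqNgt !el_cut_level ?(ltnW pl) // -leqNgt ltnS -eqn_leq => /eqP jp.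
  rewrite expr2 {1}ellA mulr_suml (bigID (fun m => k m == p :> nat)) /=.
  rewrite [X in _ + X]big1 ?addr0 => [|m /andP[/eqP cm mp]].
    apply: eq_big => [m|m /andP[/eqP cm /eqP mp]]; first by rewrite c'u.
    by rewrite AB0 // mp.
  have [->|/(A0_lev _ _ _ cm)] := eqVneq (A0 i j m) 0; first by rewrite !mul0r.
  rewrite -jp leq_eqVlt (negPf mp) /= => /v0 -> //; by rewrite mulr0 mul0r.
apply: eq_bigr => m; rewrite c'u => /andP[/eqP cm /eqP mp].
rewrite expr2 {3}(xB i m v cm) !mulr_sumr [RHS](bigID (fun j => lev i j == p)) /=.
rewrite [X in _ + X]big1 ?addr0 => [|j jp].
  by apply: eq_bigr => j _; ring.
have [->|/(B0_lev _ _ _ cm)] := eqVneq (B0 i m j) 0; first by ring.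
rewrite mp leq_eqVlt (negPf jp) /= => /ell0 ->; ring.
Unshelve. all: by end_near. Qed.

End Limit.

End Geodesics.

(** * The topology *)

Section UltraNear.

(** Allows convergence at +oo to be checked along each finer ultrafilter, where frames converge
    automatically. If [A] were not in [G], the restriction of [G] to the complement would extend to
    an ultrafilter contradicting [h]. *)
Lemma ultra_near (T : Type) (G : set_system T) (A : set T) : ProperFilter G ->
  (forall F, UltraFilter F -> G `<=` F -> F A) -> G A.
Proof.
move=> PG h; apply: contrapT => nA.
have PW : ProperFilter (within (~` A) G).
  split; last exact: within_filter.
  move=> W0; apply: nA; have {}W0 : G [set t | (~` A) t -> set0 t] := W0.
  apply: filterS W0 => t At0.
  by apply: contrapT => nAt; exact: At0.
have [F [UF sF]] := ultraFilterLemma PW.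
have FA : F A by apply: h => // B GB; apply: sF; apply: filterS GB.
have FnA : F (~` A) by apply: sF; exact: withinT.
have PF : ProperFilter F by exact: ultra_proper.
by apply: (@filter_not_empty _ F PF); rewrite -(setICr A); exact: filterI.
Qed.

End UltraNear.

Section Metric.
Variables (R : realType) (T : Type) (d : T -> T -> R).
Hypotheses (d0 : forall x y, d x y = 0 <-> x = y).
Hypotheses (dtri : forall x y z, d x z <= d x y + d y z).

Let nb (x : T) : set_system T :=
  filter_from [set e : R | 0 < e] (fun e => [set y | d x y < e]).

Let nb_filter x : ProperFilter (nb x).
Proof.
have dxx : d x x = 0 by apply/d0.
apply: filter_from_proper => [|e /= e0]; last by exists x => /=; rewrite dxx.
apply: filter_from_filter; first by exists 1 => /=.
move=> e1 e2 /= e10 e20; exists (Num.min e1 e2) => /=.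
  by rewrite lt_min e10.
by move=> y /=; rewrite lt_min => /andP[].
Qed.

Let nb_singleton x A : nb x A -> A x.
Proof. by move=> [e /= e0]; apply; rewrite /= (d0 x x).2. Qed.

Let nb_nb x A : nb x A -> nb x (nb^~ A).
Proof.
move=> [e /= e0 eA]; exists e => //= y xy.
exists (e - d x y) => /=; first by rewrite subr_gt0.
move=> z /= yz; apply: eA => /=; apply: le_lt_trans (dtri x y z) _.
by rewrite -ltrBrDl.
Qed.

Let metric_nbhs : nbhsType :=
  HB.pack T (gen_eqMixin T) (gen_choiceMixin T) (hasNbhs.Build T nb).

(** The neighbourhood filters are generated by the balls of [d] by definition, so [metrizable] can
    be read off from the construction. *)
Definition metric_topology : topologicalType :=
  HB.pack metric_nbhs
    (@Nbhs_isNbhsTopological.Build metric_nbhs nb_filter nb_singleton nb_nb).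

Lemma metric_topology_cvg (S : Type) (F : set_system S) (f : S -> T) (z : T) :
  Filter F -> d z (f t) @[t --> F] --> 0 -> 
  (f : S -> metric_topology) @ F --> (z : metric_topology).
Proof.
move=> FF fz A [e /= e0 eA].
have : \forall t \near F, d z (f t) < e by exact: (cvgr_lt 0 fz).
by apply: filterS => t ft; apply: eA.
Qed.

End Metric.

(** * Kronecker products and conjugates of diagonal matrices *)

Section Kronecker.
Variable R : realType.

Definition kron (J K : finType) (A : J -> J -> R) (B : K -> K -> R) :
    J * K -> J * K -> R := fun j m => A j.1 m.1 * B j.2 m.2.

Lemma kronM (J K : finType) (A C : J -> J -> R) (B D : K -> K -> R) :
  mulk (kron A B) (kron C D) = kron (mulk A C) (mulk B D).
Proof.
apply/funext => j; apply/funext => m; rewrite /mulk /kron.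
rewrite mulr_suml -(pair_bigA _ (fun l k => A j.1 l * B j.2 k * (C l m.1 * D k m.2))) /=.
apply: eq_bigr => l _; rewrite mulr_sumr; apply: eq_bigr => k _; ring.
Qed.

Lemma kron1 (J K : finType) : kron (@idk R J) (@idk R K) = idk.
Proof.
apply/funext => -[j k]; apply/funext => -[m n]; rewrite /kron /idk /= xpair_eqE.
by case: eqP; case: eqP; rewrite ?mulr1 ?mulr0.
Qed.

Lemma orth_kron (J K : finType) (A : J -> J -> R) (B : K -> K -> R) :
  orth A -> orth B -> orth (kron A B).
Proof.
move=> [A1 A2] [B1 B2]; have tr : trk (kron A B) = kron (trk A) (trk B) by [].
by split; rewrite tr kronM ?A1 ?B1 ?A2 ?B2 kron1.
Qed.

Section Sandwich.
Variable S : finType.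

Definition diagk (gam : S -> R) : S -> S -> R := fun j l => gam j * (j == l)%:R.

Lemma diagkM gam (A : S -> S -> R) j l : mulk (diagk gam) A j l = gam j * A j l.
Proof.
rewrite /mulk /diagk; under eq_bigr do rewrite -mulrA.
by rewrite -mulr_sumr sum_delta.
Qed.

Lemma mulk_diag gam (A : S -> S -> R) j l : mulk A (diagk gam) j l = A j l * gam l.
Proof.
rewrite mulrC -(sum_delta (fun m => gam m * A j m)); apply: eq_bigr => m _.
by rewrite /diagk eq_sym; ring.
Qed.

(** With [M] the product of [K] and the transpose of [K2], equality means that [M] intertwines the
    diagonal matrices, that is [(g j - g2 l) * M j l = 0] entrywise. *)
Lemma sandwich_eq (K K2 : S -> S -> R) (g g2 : S -> R) : orth K -> orth K2 ->
  mulk (trk K) (mulk (diagk g) K) = mulk (trk K2) (mulk (diagk g2) K2) <->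
  forall j l, mulk K (trk K2) j l != 0 -> g j = g2 l.
Proof.
move=> oK oK2; pose M := mulk K (trk K2).
have com : mulk (trk K) (mulk (diagk g) K) = mulk (trk K2) (mulk (diagk g2) K2) <->
    mulk (diagk g) M = mulk M (diagk g2).
  rewrite /M; split=> e.
    have := congr1 (fun Z => mulk K (mulk Z (trk K2))) e.
    by rewrite !mulkA oK.1 mul1k -!mulkA oK2.1 mulk1 !mulkA.
  have := congr1 (fun Z => mulk (trk K) (mulk Z K2)) e.
  by rewrite !mulkA oK.2 mul1k -!mulkA oK2.2 mulk1 !mulkA.
rewrite com; split=> [e j l Mjl|e].
  apply: (mulIf Mjl); have := congr1 (fun Z => Z j l) e.
  by rewrite diagkM mulk_diag mulrC [RHS]mulrC => ->; rewrite mulrC.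
apply/funext => j; apply/funext => l; rewrite diagkM mulk_diag.
have [->|Mjl] := eqVneq (M j l) 0; first by rewrite mul0r mulr0.
by rewrite (e j l Mjl) mulrC.
Qed.

End Sandwich.
End Kronecker.

(** * The embedding into matrices, compactness, and limits of geodesics *)

Section Compactification.
Variables (R : realType) (I J : finType) (V : I -> vectType R).
Variables (c : J -> I) (x : forall i, V i -> J -> R).
Hypothesis cx : coords c x.

Local Notation J4 := ((J * J) * (J * J))%type.
Implicit Types (T : J -> J -> R) (y z : Karp V).

Let tens T : J4 -> J4 -> R := kron (kron T T) (kron T T).
(** Differences across blocks have no meaning, since each form is given up to its own scalar; such
    indices get 0. *)
Let gam (a : J -> R) (j : J4) : R :=
  if (c j.1.1 == c j.1.2) && (c j.2.1 == c j.2.2)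
  then ratio (a j.1.1 - a j.1.2) (a j.2.1 - a j.2.2) else 0.
(** The tensor products of projections onto the rows of [T], weighted by [g]. *)
Let Psi T (g : J4 -> R) : J4 -> J4 -> R :=
  mulk (trk (tens T)) (mulk (diagk g) (tens T)).
Let good T := orth T /\ blockwise c T.

Let cvg_gam (U : Type) (F : set_system U) (a : J -> U -> R) :
  UltraFilter F -> exists g : J4 -> R, forall j, gam (a^~ t) j @[t --> F] --> g j.
Proof.
move=> UF; have cv j : exists l : R, gam (a^~ t) j @[t --> F] --> l.
  apply: (ultra_bounded_cvg (M := 1)); apply: nearW => t; rewrite /gam.
  by case: ifP => _; rewrite ?normr0 // ltW // ratio_lt1.
by have [g gE] := choice cv; exists g.
Qed.

Let cvg_tens (U : Type) (F : set_system U) (T : U -> J -> J -> R) T0 :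
  Filter F -> (forall j m, T t j m @[t --> F] --> T0 j m) ->
  forall j m, tens (T t) j m @[t --> F] --> tens T0 j m.
Proof. by move=> FF TT j m; do !apply: cvgM. Qed.

Let cvg_Psi (U : Type) (F : set_system U) (T : U -> J -> J -> R) T0
    (g : U -> J4 -> R) g0 : Filter F ->
  (forall j m, T t j m @[t --> F] --> T0 j m) ->
  (forall j, g t j @[t --> F] --> g0 j) ->
  forall m n, Psi (T t) (g t) m n @[t --> F] --> Psi T0 g0 m n.
Proof.
move=> FF TT gg m n; apply: cvg_mulk => [j l|j l]; first exact: cvg_tens.
under eq_fun do rewrite diagkM; rewrite diagkM.
by apply: cvgM => //; exact: cvg_tens.
Qed.

Let Psi_eq T T2 g g2 : orth T -> orth T2 ->
  Psi T g = Psi T2 g2 <-> forall j m, tens (mulk T (trk T2)) j m != 0 -> g j = g2 m.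
Proof.
have oK S : orth S -> orth (tens S) by move=> oS; do 2!apply: orth_kron.
move=> oT oT2; rewrite /Psi sandwich_eq; [|exact: oK|exact: oK].
suff -> : mulk (tens T) (trk (tens T2)) = tens (mulk T (trk T2)) by [].
by rewrite /tens -!kronM.
Qed.

Let tens_neq0 T (j m : J4) : (tens T j m != 0) =
  [&& T j.1.1 m.1.1 != 0, T j.1.2 m.1.2 != 0, T j.2.1 m.2.1 != 0 &
      T j.2.2 m.2.2 != 0].
Proof. by rewrite /tens /kron !mulf_eq0 !negb_or -andbA. Qed.

Let agree (U U2 : Type) (F : set_system U) (F2 : set_system U2)
    (a : J -> U -> R) (a2 : J -> U2 -> R) T T2 g g2 y :
  ProperFilter F -> ProperFilter F2 -> good T -> good T2 ->
  flat_cvg F a y c (act T x) -> flat_cvg F2 a2 y c (act T2 x) ->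
  (forall j, gam (a^~ t) j @[t --> F] --> g j) ->
  (forall j, gam (a2^~ t) j @[t --> F2] --> g2 j) ->
  Psi T g = Psi T2 g2.
Proof.
move=> PF PF2 [oT bT] [oT2 bT2] L L2 hg hg2; apply/Psi_eq => // j m.
have ch := change_act cx oT oT2 bT bT2; have [_ _ _ cM _] := ch.
rewrite tens_neq0 => /and4P[M1 M2 M3 M4].
have := hg j; have := hg2 m; rewrite /gam.
rewrite -(cM _ _ M1) -(cM _ _ M2) -(cM _ _ M3) -(cM _ _ M4).
have [/andP[/eqP c1 /eqP c2] h2 h1|_ h2 h1] :=
    boolP ((c j.1.1 == c j.1.2) && (c j.2.1 == c j.2.2)).
  exact: (flat_cvg_agree PF PF2 ch L L2 c1 c2 M1 M2 M3 M4 h1 h2).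
by rewrite -(eq_limit (cvg_cst _) h1) (eq_limit (cvg_cst _) h2).
Qed.

(** Along one fixed ultrafilter on [nat] all bounded ratios have limits, so every sequence
    representing a point yields a vector of limits. *)
Let ultranat : exists N : set_system nat, UltraFilter N /\ \oo `<=` N.
Proof. exact: ultraFilterLemma. Qed.
Let N := projT1 (cid ultranat).
Let UN : UltraFilter N. Proof. exact: (projT2 (cid ultranat)).1. Qed.
#[local] Existing Instance UN.
Let sN : \oo `<=` N. Proof. exact: (projT2 (cid ultranat)).2. Qed.

Let represented y : exists r : (J -> J -> R) * (J -> nat -> R) * (J4 -> R),
  [/\ good r.1.1, flat_cvg N r.1.2 y c (act r.1.1 x) &
      forall j, gam (r.1.2^~ n) j @[n --> N] --> r.2 j].
Proof.
have [T [a [oT bT L]]] := flat_cvg_represents y cx.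
have [g gE] := cvg_gam a UN; exists (T, a, g); split=> //=.
exact: flat_cvg_fine L.
Qed.

Let rep y := projT1 (cid (represented y)).
Let repP y : [/\ good (rep y).1.1, flat_cvg N (rep y).1.2 y c (act (rep y).1.1 x) &
  forall j, gam ((rep y).1.2^~ n) j @[n --> N] --> (rep y).2 j].
Proof. exact: projT2 (cid (represented y)). Qed.

Let Phi y : J4 -> J4 -> R := Psi (rep y).1.1 (rep y).2.

Let Phi_inj y z : Phi y = Phi z -> y = z.
Proof.
have [[oT bT] L hg] := repP y; have [[oT2 bT2] L2 hg2] := repP z.
move=> /Psi_eq e; have ch := change_act cx oT oT2 bT bT2.
have [_ _ _ cM _] := ch.
apply: (flat_cvg_separates _ _ ch L L2) => j l j' l' m n m' n' jl jl' M1 M2 M3 M4.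
exists ((rep y).2 ((j, l), (j', l'))); split.
  by have := hg ((j, l), (j', l')); rewrite /gam /= jl jl' !eqxx.
have -> : (rep y).2 ((j, l), (j', l')) = (rep z).2 ((m, n), (m', n')).
  by apply: e => //; rewrite tens_neq0 /= M1 M2 M3 M4.
have := hg2 ((m, n), (m', n')).
by rewrite /gam /= -(cM _ _ M1) -(cM _ _ M2) -(cM _ _ M3) -(cM _ _ M4) jl jl' !eqxx.
Qed.

Let dist (A B : J4 -> J4 -> R) : R := \sum_m \sum_n `|A m n - B m n|.

Let dist_sym A B : dist A B = dist B A.
Proof. by apply: eq_bigr => m _; apply: eq_bigr => n _; exact: distrC. Qed.

Let dist_tri A B C : dist A C <= dist A B + dist B C.
Proof.
rewrite /dist -big_split /=; apply: ler_sum => m _.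
by rewrite -big_split /=; apply: ler_sum => n _; exact: ler_distD.
Qed.

Let dist_ge0 A B : 0 <= dist A B.
Proof. by do 2!apply: sumr_ge0 => ? _. Qed.

Let dist_eq0 A B : dist A B = 0 -> A = B.
Proof.
move=> /eqP; rewrite psumr_eq0 => [/allP h|m _]; last exact: sumr_ge0.
apply/funext => m; apply/funext => n; apply/eqP; rewrite -subr_eq0 -normr_eq0.
have := h m (mem_index_enum m); rewrite psumr_eq0 // => /allP/(_ n).
by apply; exact: mem_index_enum.
Qed.

Let dist_xx A : dist A A = 0.
Proof. by rewrite /dist big1 // => m _; rewrite big1 // => n _; rewrite subrr normr0. Qed.

Let cvg_dist (U : Type) (F : set_system U) (A : U -> J4 -> J4 -> R) A0 :
  Filter F -> (forall m n, A t m n @[t --> F] --> A0 m n) ->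
  dist (A t) A0 @[t --> F] --> 0.
Proof.
move=> FF AA; rewrite -(dist_xx A0); apply: cvg_fsum => m _.
apply: cvg_fsum => n _; apply: cvg_norm.
by apply: cvgB => //; exact: cvg_cst.
Qed.

Let d y z := dist (Phi y) (Phi z).

Let d_eq0 y z : d y z = 0 <-> y = z.
Proof.
by split=> [e|->]; [exact: Phi_inj (dist_eq0 e)|exact: dist_xx].
Qed.

Let d_tri y z w : d y w <= d y z + d z w.
Proof. exact: dist_tri. Qed.

Let K : topologicalType := metric_topology d_eq0 d_tri.

(* The frames [T t] and the points [a t] of the flat approximate [f t]. *)
Let approx_cvg (U : Type) (F : set_system U) (f : U -> Karp V)
    (T : U -> J -> J -> R) T0 (a : J -> U -> R) z : UltraFilter F ->
  (forall t, good (T t)) -> (forall j m, T t j m @[t --> F] --> T0 j m) ->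
  flat_cvg F a z c (act T0 x) ->
  dist (Psi (T t) (gam (a^~ t))) (Phi (f t)) @[t --> F] --> 0 ->
  d z (f t) @[t --> F] --> 0.
Proof.
move=> UF gT TT L df; have [g gE] := cvg_gam a UF.
have gT0 : good T0.
  split; first exact: orth_limit (fun t => (gT t).1) TT.
  exact: blockwise_limit (fun t => (gT t).2) TT.
have [gz Lz hz] := repP z.
have PhiE : Phi z = Psi T0 g by exact: agree gz gT0 Lz L hz gE.
have dz : dist (Psi (T t) (gam (a^~ t))) (Phi z) @[t --> F] --> 0.
  by rewrite PhiE; apply: cvg_dist; exact: cvg_Psi.
have ub : dist (Psi (T t) (gam (a^~ t))) (Phi z) +
    dist (Psi (T t) (gam (a^~ t))) (Phi (f t)) @[t --> F] --> (0 + 0 : R).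
  exact: cvgD.
rewrite addr0 in ub.
apply: (squeeze_cvgr _ (cvg_cst 0) ub); apply: nearW => t.
by rewrite dist_ge0 /= /d; rewrite [X in _ <= X + _]dist_sym dist_tri.
Qed.

Let flat_cvg_dist T (a : J -> nat -> R) y : good T ->
  flat_cvg N a y c (act T x) ->
  dist (Psi T (gam (a^~ n))) (Phi y) @[n --> N] --> 0.
Proof.
move=> gT L; have [g gE] := cvg_gam a UN; have [gy Ly hy] := repP y.
have -> : Phi y = Psi T g by exact: agree gy gT Ly L hy gE.
apply: cvg_dist.
by apply: cvg_Psi => // j m; exact: cvg_cst.
Qed.

(** Each point [y] and each [n] give a point of the flat in the frame of [y] with error below
    [1 / (n + 1)]. An ultrafilter on the pairs [(y, n)], finer than the product filter, makes the
    error vanish while its first component follows [U]; the limit in [Karp] then exists along it. *)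
Let K_compact : compact [set: K].
Proof.
rewrite compact_ultra => U UU _.
have near_rep (yn : Karp V * nat) : exists k : nat,
    dist (Psi (rep yn.1).1.1 (gam ((rep yn.1).1.2^~ k))) (Phi yn.1) < yn.2.+1%:R^-1.
  have [gy Ly _] := repP yn.1.
  have e0 : 0 < (yn.2.+1%:R^-1 : R) by [].
  have /(filter_ex) : N [set k | dist (Psi (rep yn.1).1.1
      (gam ((rep yn.1).1.2^~ k))) (Phi yn.1) < yn.2.+1%:R^-1].
    exact: (cvgr_lt 0 (flat_cvg_dist gy Ly)).
  by [].
have [k kP] := choice near_rep.
have [G [UG sG]] := ultraFilterLemma (filter_prod_proper :
  ProperFilter (filter_prod U \oo)).
pose T (yn : Karp V * nat) := (rep yn.1).1.1.
pose a j (yn : Karp V * nat) := (rep yn.1).1.2 j (k yn).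
have gT yn : good (T yn) by have [] := repP yn.1.
have [T0 TT] := orth_ultra_cvg UG (fun yn => (gT yn).1).
have gT0 : good T0.
  split; first exact: orth_limit (fun t => (gT t).1) TT.
  exact: blockwise_limit (fun t => (gT t).2) TT.
have [z Lz] := flat_cvg_exists a UG (coords_act gT0.1 gT0.2 cx).
exists z; split=> // A [e /= e0 eA].
have : d z yn.1 @[yn --> G] --> 0.
  apply: (approx_cvg UG gT TT Lz).
  have h : (yn.2.+1%:R^-1 : R) @[yn --> G] --> (0 : R).
    apply: (@cvg_comp _ _ _ snd harmonic _ \oo); last exact: cvg_harmonic.
    move=> B NB; apply: sG; exists (setT, B) => //=.
      by split=> //; exact: filterT.
    by move=> [y n] [].
  apply: (squeeze_cvgr _ (cvg_cst 0) h); apply: nearW => yn.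
  by rewrite dist_ge0 ltW //; exact: kP.
move=> /(cvgr_lt 0)/(_ e e0) Ge.
have [UA|UnA] := in_ultra_setVsetC [set y | d z y < e] UU.
  by apply: filterS UA => y; exact: eA.
have Gn : G [set yn | ~ d z yn.1 < e].
  apply: sG; exists ([set y | ~ d z y < e], setT) => //=.
    by split=> //; exact: filterT.
  by move=> [y n] [].
have /filter_ex[yn []//] : G ([set yn | d z yn.1 < e] `&` [set yn | ~ d z yn.1 < e]).
exact: filterI.
Qed.

Let form_flat_cvg (q : forall i, PE (V i)) T (b : J -> R) :
  (forall i, sval (q i) (fun v => \sum_(j | c j == i) expR (b j) * act T x v j ^+ 2)) ->
  flat_cvg N (fun j _ => b j) (Interior q) c (act T x).
Proof. by move=> h; exists b; split=> // j l _; exact: cvg_cst. Qed.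

Let geodesic_diagonal (I' : finType) (V' : I' -> vectType R) (c' : J -> I')
    (x' : forall i, V' i -> J -> R) (g : geodesic V') : coords c' x' ->
  exists (T : R -> J -> J -> R) (b : J -> R -> R),
   [/\ forall t, orth (T t), forall t, blockwise c' (T t),
    forall t i v, el_curve_form (geo_line g i) t v =
      \sum_(j | c' j == i) expR (b j t) * act (T t) x' v j ^+ 2
    & forall t i, sval (geo_curve g t i)
      (fun v => \sum_(j | c' j == i) expR (b j t) * act (T t) x' v j ^+ 2)].
Proof.
move=> cx'; have diag t : exists Tb : (J -> J -> R) * (J -> R),
    [/\ orth Tb.1, blockwise c' Tb.1 & forall i v,
    el_curve_form (geo_line g i) t v =
      \sum_(j | c' j == i) expR (Tb.2 j) * act Tb.1 x' v j ^+ 2].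
  have [T [b h]] := posdef_diagonal cx' (fun i => el_curve_posdef (geo_line g i) t).
  by exists (T, b).
have [Tb TbP] := choice diag.
exists (fun t => (Tb t).1), (fun j t => (Tb t).2 j); split=> t.
- by have [] := TbP t.
- by have [] := TbP t.
- by have [] := TbP t.
move=> i; have [_ _ h] := TbP t.
have <- : el_curve_form (geo_line g i) t = fun v =>
    \sum_(j | c' j == i) expR ((Tb t).2 j) * act (Tb t).1 x' v j ^+ 2.
  by apply/funext => v; exact: h.
by split; [exact: el_curve_posdef|exact: proportional_refl].
Qed.

(** At each time the constant family [b] represents the point of the geodesic exactly, so the
    approximation error is 0. *)
Let K_geodesic (g : geodesic V) :
  (Interior (geo_curve g t) : K) @[t --> +oo] --> (geo_limit g : K).
Proof.
apply: metric_topology_cvg; apply/cvgrPdist_lt => e e0.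
apply: ultra_near => F UF sF.
have [T [b [oT bT formE curveE]]] := geodesic_diagonal g cx.
have [T0 TT] := orth_ultra_cvg UF oT.
have L := geodesic_flat_cvg cx UF sF oT bT TT formE.
suff h : d (geo_limit g) (Interior (geo_curve g t)) @[t --> F] --> 0.
  by move/cvgrPdist_lt: h; exact.
apply: (approx_cvg UF (fun t => conj (oT t) (bT t)) TT L).
rewrite (_ : (fun t => _) = fun=> 0); first exact: cvg_cst.
apply/funext => t.
have := flat_cvg_dist (conj (oT t) (bT t)) (form_flat_cvg (curveE t)).
by move=> h; apply: eq_limit (cvg_cst _) h.
Qed.

(** For each [t] a speed [n t] is chosen subject to two demands: it dominates the inner family by
    the factor [|t|], so that [flat_cvg_stratum] applies along [F], and the resulting point of the
    flat is within [1 / (1 + |t|)] of the point of the boundary geodesic. *)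
Let K_boundary_geodesic (W : forall i, flag (V i)) (nt : nontrivial_flags W)
    (psi : Delta R (fun i => flag_length (W i))) (g : geodesic (quot_family W)) :
  (Stratum nt psi (Interior (geo_curve g t)) : K) @[t --> +oo] -->
    (Stratum nt psi (geo_limit g) : K).
Proof.
apply: metric_topology_cvg; apply/cvgrPdist_lt => e e0.
apply: ultra_near => F UF sF.
have [T1 [c' [oT1 bT1 ad]]] := adapted_frame W cx.
have cq := coords_quot (coords_act oT1 bT1 cx) ad.
have [T [b [oT bT formE curveE]]] := geodesic_diagonal g cq.
have [T0 TT] := orth_ultra_cvg UF oT.
have L := geodesic_flat_cvg cq UF sF oT bT TT formE.
have oT0 : orth T0 by exact: orth_limit oT TT.
have bT0 : blockwise c' T0 by exact: blockwise_limit bT TT.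
have bc S : blockwise c' S -> blockwise c S.
  by move=> bS j m; rewrite -!ad.1 => jm; apply: bS; apply: contraNneq jm => ->.
have gT t : good (mulk (T t) T1).
  by split; [exact: orthM|apply: blockwiseM => //; exact: bc].
have [psi0 _ ps] := class_inhabited psi (@velocity_refl R _ _).
pose nu j := velocity_at psi0 (c' j).
have pick t : exists n : nat,
    `|t| * (1 + \sum_j `|b j t|) <= n%:R /\
    dist (Psi (mulk (T t) T1) (gam (fun j => n%:R * nu j + b j t)))
      (Phi (Stratum nt psi (Interior (geo_curve g t)))) < (1 + `|t|)^-1.
  have roo : (n%:R : R) @[n --> N] --> +oo.
    by apply: cvg_trans (@cvgr_idn R); apply: cvg_app; exact: sN.
  have sV : (n%:R : R)^-1 @[n --> N] --> (0 : R).
    by apply/gtr0_cvgV0 => //; move/cvgryPgt: roo; exact.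
  have Lt : flat_cvg N (fun j n => n%:R * nu j + b j t)
      (Stratum nt psi (Interior (geo_curve g t))) c (act (mulk (T t) T1) x).
    rewrite actM; apply: flat_cvg_stratum => //.
    - exact: adapted_act.
    - move=> j; rewrite -[X in _ --> X](mulr0 (b j t)).
      by apply: cvgM => //; exact: cvg_cst.
    - by exists (b^~ t); split=> [j l _|]; [exact: cvg_cst|exact: curveE].
  have t0 : 0 < (1 + `|t|)^-1 by rewrite invr_gt0 ltr_pwDl.
  near N => n; exists n; split.
    by apply/ltW; near: n; move/cvgryPgt: roo; exact.
  by near: n; exact: (cvgr_lt 0 (flat_cvg_dist (gT t) Lt) _ t0).
have [n nP] := choice pick.
have too : `|t| @[t --> F] --> +oo.
  apply/cvgryPgt => M; near=> t; apply: (@lt_le_trans _ _ t); last exact: ler_norm.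
  near: t.
  by apply: sF; apply: nbhs_pinfty_gt; exact: num_real.
pose s t : R := (n t)%:R.
have [soo bs0] := @dominated R J _ F b (fun t => `|t|) s _ too
  (nearW _ (fun t => (nP t).1)).
suff h : d (Stratum nt psi (geo_limit g))
    (Stratum nt psi (Interior (geo_curve g t))) @[t --> F] --> 0.
  by move/cvgrPdist_lt: h; exact.
apply: (approx_cvg (T := fun t => mulk (T t) T1) (T0 := mulk T0 T1)
  (a := fun j t => s t * nu j + b j t) UF gT).
- by apply: cvg_mulk => // j m; exact: cvg_cst.
- rewrite actM; apply: flat_cvg_stratum => //; exact: adapted_act.
have h : (1 + `|t|)^-1 @[t --> F] --> (0 : R).
  apply/gtr0_cvgV0; first by apply: nearW => t; rewrite ltr_pwDl.
  apply/cvgryPgt => M; near=> t.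
  have : M < `|t| by near: t; move/cvgryPgt: too; exact.
  by move=> Mt; apply: lt_trans Mt _; rewrite ltrDr.
apply: (squeeze_cvgr _ (cvg_cst 0) h); apply: nearW => t.
by rewrite dist_ge0 ltW //; exact: (nP t).2.
Unshelve. all: by end_near. Qed.

Lemma karpelevich_compactification :
  exists top : Topological (Karp V),
    let K : topologicalType := Topological.Pack top in
    [/\ compact [set: K],
        metrizable R K,
        forall g : geodesic V,
          (Interior (geo_curve g t) : K) @[t --> +oo] --> (geo_limit g : K)
      & forall (W : forall i, flag (V i)) (W_nontriv : nontrivial_flags W)
               (psi : Delta R (fun i => flag_length (W i)))
               (g : geodesic (quot_family W)),
          (Stratum W_nontriv psi (Interior (geo_curve g t)) : K)
            @[t --> +oo] --> (Stratum W_nontriv psi (geo_limit g) : K)].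
Proof.
exists (Topological.class K) => K'; split.
- exact: K_compact.
- by exists d; split=> // y z; exact: dist_sym.
- exact: K_geodesic.
- exact: K_boundary_geodesic.
Qed.

End Compactification.

(** For [tag j = i] the [insub] recovers the row index without a transport along the equality of
    labels; the remaining values are fillers. *)
Lemma standard_coords (R : realType) (beta : nat) (m : 'I_beta -> nat) :
  coords (V := fun i => 'cV[R]_(m i)) (fun j : {i : 'I_beta & 'I_(m i)} => tag j)
    (fun i v j => if insub (tagged j : nat) is Some k then v k 0 else 0).
Proof.
split.
- by move=> i [i' k] /= <- a u v; rewrite valK !mxE.
- move=> i v v0; apply/colP => k; rewrite mxE.
  by have := v0 (existT _ i k) erefl; rewrite /= valK.
- move=> i r; exists (\col_k r (existT _ i k)) => -[i' k] /= ii'.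
  by move: k; rewrite ii' => k; rewrite valK mxE.
Qed.

Theorem theorem5p2 (R : realType) (beta : nat) (m : 'I_beta -> nat)
    (beta_gt0 : (0 < beta)%N) (m_gt0 : forall i, (0 < m i)%N) :
  let V : 'I_beta -> vectType R := fun i => 'cV[R]_(m i) in
  exists top : Topological (Karp V),
    let K : topologicalType := Topological.Pack top in
    [/\ compact [set: K],
        metrizable R K,
        forall g : geodesic V,
          (Interior (geo_curve g t) : K) @[t --> +oo] --> (geo_limit g : K)
      & forall (W : forall i, flag (V i)) (W_nontriv : nontrivial_flags W)
               (psi : Delta R (fun i => flag_length (W i)))
               (g : geodesic (quot_family W)),
          (Stratum W_nontriv psi (Interior (geo_curve g t)) : K)
            @[t --> +oo] --> (Stratum W_nontriv psi (geo_limit g) : K)].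
Proof. exact: karpelevich_compactification (standard_coords R m). Qed.
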